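(* Let $A,N_1,\dots,N_q\in\mathbb R^{n\times n}$, $B\in\mathbb R^{n\times m}$, $C\in\mathbb R^{p\times n}$ be such that $(A,B,N_i)$ is stabilizable and $(A,C,N_i)$ is observable. Let $P>0$ satisfy $$A^\top P^{-1}+P^{-1}A+\sum_{i,j=1}^q N_i^\top P^{-1}N_jk_{ij}-C^\top C+P^{-1}BB^\top P^{-1}\le 0,$$ and let $Q>0$ be the stabilizing solution of $$A^\top Q+QA+\sum_{i,j=1}^q N_i^\top QN_jk_{ij}+C^\top C-QBB^\top Q=0.$$ Let $1\le r<n$, let $\sigma_1\ge\dots\ge\sigma_n>0$ be the square roots of the eigenvalues of $PQ$, and let $(A_r,B_r,C_r,N_{i,r})$ be the coefficients of the reduced system obtained by LQG balanced truncation. If $\{\sigma_1,\dots,\sigma_r\}\cap\{\sigma_{r+1},\dots,\sigma_n\}=\emptyset$, then $(A_r,C_r,N_{i,r})$ is detectable.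
   Context: Probability setting: $(\Omega,\mathcal F,(\mathcal F_t)_{t\ge0},\mathbb P)$ is a filtered probability space with right-continuous complete filtration; $W=(W_1,\dots,W_q)^\top$ is an adapted $\mathbb R^q$-valued mean-zero Wiener process with covariance matrix $K=(k_{ij})$, i.e. $\mathbb E[W(t)W(t)^\top]=Kt$, whose increments $W(t+h)-W(t)$ are independent of $\mathcal F_t$. $L^2$ is the set of adapted processes $v$ with $\mathbb E\int_0^\infty\|v(s)\|_2^2ds<\infty$. Full system: $dx(t)=[Ax(t)+Bu(t)]dt+\sum_{i=1}^qN_ix(t)dW_i(t)$, $x(0)=x_0\in\mathbb R^n$, $y(t)=Cx(t)$. Its state and output are written $x(\cdot,x_0,u)$, $y(\cdot,x_0,u)$. Definitions (in any dimension): $(A,N_i)$ is stable (mean square asymptotically) if there are $M\ge1$, $c>0$ with $\mathbb E\|x(t,x_0,0)\|_2^2\le Me^{-ct}\|x_0\|_2^2$ for all $x_0$, $t\ge0$. $(A,B,N_i)$ is stabilizable if for every $x_0$ there is $u\in L^2$ with $x(\cdot,x_0,u)\in L^2$. $(A,C,N_i)$ is observable if $y(t,x_0,0)=0$ a.s. for all $t\ge0$ implies $x_0=0$. $(A,C,N_i)$ is detectable if $y(t,x_0,0)=0$ a.s. for all $t\ge0$ implies $\lim_{t\to\infty}\mathbb E\|x(t,x_0,0)\|_2^2=0$. A solution $Q$ of the Riccati equation is stabilizing if $(A-BB^\top Q,N_i)$ is stable; under the assumptions of the claim a stabilizing solution exists and is positive definite. LQG balanced truncation: choose a nonsingular $S_b\in\mathbb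 R^{n\times n}$ with $S_bPS_b^\top=S_b^{-\top}QS_b^{-1}=\Sigma_n=\operatorname{diag}(\sigma_1,\dots,\sigma_n)$, and put $(A_n,N_{i,n},B_n,C_n)=(S_bAS_b^{-1},S_bN_iS_b^{-1},S_bB,CS_b^{-1})$. Then $A_r,N_{i,r}$ are the upper-left $r\times r$ blocks of $A_n,N_{i,n}$, $B_r$ consists of the first $r$ rows of $B_n$, and $C_r$ of the first $r$ columns of $C_n$. *)

(* Defs.v *)
From HB Require Import structures.
From mathcomp Require Import all_boot all_order all_algebra.
From mathcomp Require Import all_classical all_reals all_analysis.

Set Implicit Arguments.
Unset Strict Implicit.
Unset Printing Implicit Defensive.

Import Order.TTheory GRing.Theory Num.Theory.
Import numFieldNormedType.Exports.

Local Open Scope classical_set_scope.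
Local Open Scope ring_scope.

Section LinearAlgebra.
Context {R : realType}.

Definition possemidef n (M : 'M[R]_n) : Prop :=
  M^T = M /\ forall v : 'cV[R]_n, 0 <= (v^T *m M *m v) 0 0.

Definition posdef n (M : 'M[R]_n) : Prop :=
  M^T = M /\ forall v : 'cV[R]_n, v != 0 -> 0 < (v^T *m M *m v) 0 0.

Definition sqnorm n (v : 'cV[R]_n) : R := \sum_i v i 0 ^+ 2.

(* sum_{i,j} N_i^T X N_j k_ij *)
Definition noise_term q n (K : 'M[R]_q) (N : 'I_q -> 'M[R]_n) (X : 'M[R]_n) :
    'M[R]_n :=
  \sum_i \sum_j K i j *: ((N i)^T *m X *m N j).

Definition upper_left n r (h : (r <= n)%N) (M : 'M[R]_n) : 'M[R]_r :=
  mxsub (widen_ord h) (widen_ord h) M.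

Definition left_cols p n r (h : (r <= n)%N) (M : 'M[R]_(p, n)) : 'M[R]_(p, r) :=
  colsub (widen_ord h) M.

Definition balanced_rom_A n r (h : (r <= n)%N) (S A : 'M[R]_n) : 'M[R]_r :=
  upper_left h (S *m A *m invmx S).

Definition balanced_rom_C p n r (h : (r <= n)%N) (S : 'M[R]_n)
    (C : 'M[R]_(p, n)) : 'M[R]_(p, r) :=
  left_cols h (C *m invmx S).

(* [normal_prob m 0] is a uniform law in the library, hence the case split. *)
Definition centered_gaussian (v : R) (B : set R) : \bar R :=
  if v == 0 then \d_(0 : R) B else normal_prob 0 (Num.sqrt v) B.

End LinearAlgebra.

(* Processes are functions [X : R -> T -> V] of time and outcome; only the
   times t >= 0 are relevant. *)
Section Processes.
Context {R : realType} {d : measure_display} {T : measurableType d}.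
Variable Pr : probability T R.
Variable F : R -> set (set T).

Local Notation leb := (@lebesgue_measure R).

Definition usual_filtration : Prop :=
  [/\ forall t, 0 <= t -> sigma_algebra setT (F t) /\ F t `<=` measurable,
      forall s t, 0 <= s -> s <= t -> F s `<=` F t,
      forall t, 0 <= t -> \bigcap_(s in [set s | t < s]) F s = F t
    & forall A, Pr.-negligible A -> F 0 A].

Definition sub_measurable (G : set (set T)) (X : T -> R) : Prop :=
  forall B : set R, measurable B -> G (X @^-1` B).

Definition adapted n (X : R -> T -> 'cV[R]_n) : Prop :=
  forall t, 0 <= t -> forall i, sub_measurable (F t) (fun w => X t w i 0).

Definition jointly_measurable n (X : R -> T -> 'cV[R]_n) : Prop :=
  forall i, measurable_fun (`[0, +oo[%classic `*` setT : set (R * T))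
                           (fun z : R * T => X z.1 z.2 i 0).

Definition L2_process n (X : R -> T -> 'cV[R]_n) : Prop :=
  [/\ adapted X, jointly_measurable X
    & (\int[Pr]_w \int[leb]_(s in `[0%R, +oo[) (sqnorm (X s w))%:E < +oo)%E].

Definition L2loc_process n (X : R -> T -> 'cV[R]_n) : Prop :=
  [/\ adapted X, jointly_measurable X
    & forall t, 0 <= t ->
      (\int[Pr]_w \int[leb]_(s in `[0%R, t]) (sqnorm (X s w))%:E < +oo)%E].

(* The joint independence of W(t) - W(s) and F_s is tested on the pi-system of
   boxes, which generates the Borel sets of R^q.  The Gaussian law of the
   increment is the one all of whose linear images are Gaussian. *)
Definition wiener_process q (K : 'M[R]_q) (W : R -> T -> 'cV[R]_q) : Prop :=
  [/\ adapted W,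
      {ae Pr, forall w, W 0 w = 0},
      {ae Pr, forall w, forall i,
         {within `[0, +oo[, continuous (fun t => W t w i 0)}},
      (forall t, 0 <= t ->
         (forall i, 'E_Pr[fun w => W t w i 0%R] = 0)%E /\
         (forall i j, 'E_Pr[(fun w => W t w i 0 * W t w j 0)%R]%E
                      = (t * K i j)%:E))
    & forall s t, 0 <= s -> s <= t ->
        (forall (a : 'cV[R]_q) (B : set R), measurable B ->
           Pr [set w | B ((a^T *m (W t w - W s w)) 0 0)]
           = centered_gaussian ((t - s) * (a^T *m K *m a) 0 0) B) /\
        (forall (A : set T) (B : 'I_q -> set R), F s A ->
           (forall i, measurable (B i)) ->
           let D := [set w | forall i, B i ((W t w - W s w) i 0)] in
           Pr (A `&` D) = (Pr A * Pr D)%E)].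

(* The integrand sum_k el_val k * 1_(el_time k, el_time k.+1], k < el_size *)
Record elementary := Elementary {
  el_size : nat;
  el_time : nat -> R;
  el_val : nat -> T -> R }.

Definition elementary_wf (H : elementary) : Prop :=
  [/\ 0 <= el_time H 0%N,
      forall k, (k < el_size H)%N -> el_time H k <= el_time H k.+1
    & forall k, (k < el_size H)%N ->
        sub_measurable (F (el_time H k)) (el_val H k) /\
        exists M : R, forall w, `|el_val H k w| <= M].

Definition elementary_fun (H : elementary) (s : R) (w : T) : R :=
  \sum_(k < el_size H)
    el_val H k w * \1_(`]el_time H k, el_time H k.+1]%classic : set R) s.

Definition elementary_integral (H : elementary) (b : R -> T -> R) (t : R)
    (w : T) : R :=
  \sum_(k < el_size H)
    el_val H k w *
      (b (Num.min (el_time H k.+1) t) w - b (Num.min (el_time H k) t) w).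

(* I is (a version of) the Ito integral of v over [0, t] with respect to the
   scalar Brownian motion b. *)
Definition is_ito_integral (b : R -> T -> R) (v : R -> T -> R) (t : R)
    (I : T -> R) : Prop :=
  measurable_fun setT I /\
  exists H : nat -> elementary,
    [/\ forall m, elementary_wf (H m),
        (fun m => \int[Pr]_w \int[leb]_(s in `[0%R, t])
                    ((v s w - elementary_fun (H m) s w) ^+ 2)%:E)%E
          @ \oo --> 0%E
      & (fun m => 'E_Pr[(fun w => (I w - elementary_integral (H m) b t w) ^+ 2)%R])%E
          @ \oo --> 0%E].

(* dx = [A x + f] dt + sum_i N_i x dW_i, x(0) = x0.  Path continuity is not
   required: solutions are unique up to modification, and all notions below
   are invariant under modification. *)
Definition sde_solution q n (W : R -> T -> 'cV[R]_q) (A : 'M[R]_n)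
    (N : 'I_q -> 'M[R]_n) (f : R -> T -> 'cV[R]_n) (x0 : 'cV[R]_n)
    (x : R -> T -> 'cV[R]_n) : Prop :=
  L2loc_process x /\
  exists I : 'I_q -> R -> T -> 'cV[R]_n,
    (forall i t k, 0 <= t ->
       is_ito_integral (fun s w => W s w i 0) (fun s w => (N i *m x s w) k 0)
                       t (fun w => I i t w k 0)) /\
    (forall t, 0 <= t -> {ae Pr, forall w,
       x t w = x0
         + \col_k \int[leb]_(s in `[0, t]) ((A *m x s w + f s w) k 0)
         + \sum_i I i t w}).

Section Notions.
Variables (q : nat) (W : R -> T -> 'cV[R]_q).

Definition free_solution n (A : 'M[R]_n) (N : 'I_q -> 'M[R]_n)
    (x0 : 'cV[R]_n) (x : R -> T -> 'cV[R]_n) : Prop :=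
  sde_solution W A N (fun _ _ => 0) x0 x.

Definition ms_stable n (A : 'M[R]_n) (N : 'I_q -> 'M[R]_n) : Prop :=
  exists M c : R, [/\ 1 <= M, 0 < c &
    forall x0 x, free_solution A N x0 x -> forall t, 0 <= t ->
      ('E_Pr[fun w => sqnorm (x t w)] <= (M * expR (- c * t) * sqnorm x0)%:E)%E].

Definition stabilizable n m (A : 'M[R]_n) (B : 'M[R]_(n, m))
    (N : 'I_q -> 'M[R]_n) : Prop :=
  forall x0, exists (u : R -> T -> 'cV[R]_m) (x : R -> T -> 'cV[R]_n),
    [/\ L2_process u,
        sde_solution W A N (fun s w => B *m u s w) x0 x
      & L2_process x].

Definition zero_output n p (C : 'M[R]_(p, n)) (x : R -> T -> 'cV[R]_n) : Prop :=
  forall t, 0 <= t -> {ae Pr, forall w, C *m x t w = 0}.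

Definition observable n p (A : 'M[R]_n) (C : 'M[R]_(p, n))
    (N : 'I_q -> 'M[R]_n) : Prop :=
  forall x0 x, free_solution A N x0 x -> zero_output C x -> x0 = 0.

Definition detectable n p (A : 'M[R]_n) (C : 'M[R]_(p, n))
    (N : 'I_q -> 'M[R]_n) : Prop :=
  forall x0 x, free_solution A N x0 x -> zero_output C x ->
    (fun t : R => 'E_Pr[fun w => sqnorm (x t w)])%E @ +oo --> 0%E.

End Notions.

End Processes.

(* Main.v *)
(** Let Y(t) be the integral over [0, t] of E[x x^T] along a free reduced
    trajectory with vanishing output. The Ito isometry gives
    E[x(t) x(t)^T] = x0 x0^T + L(Y(t)), L the Lyapunov operator of the reduced
    system, and the Riccati inequality makes tr(Sigma^-1 E[x x^T]) nonincreasing.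
    If it stays away from 0, a limit point V of Y(t)/t is a nonzero positive
    semidefinite matrix with L(V) = 0 and C_r V = 0.
    Padded with zeros to the full balanced system, V makes every term in the
    trace of the Riccati inequality vanish. Testing the Riccati equation with
    Sigma^-2 V Sigma^-2 then yields a vanishing sum of squares, which says that
    Sigma^-2 commutes with A and the N_i on the range of V. So V may be replaced
    by (Sigma^-2 - c) V (Sigma^-2 - c) until its columns lie in a single
    eigenspace of Sigma. The separation of the singular values keeps this
    eigenspace within the first r coordinates, hence A and the N_i map the range
    of V into itself, without truncation. The orthogonal
    projector Y onto that range satisfies Y B = 0 and
    A^T Y + Y A + sum k_ij N_i^T Y N_j >= 0: no control can make E[x^T Y x]
    decrease, which contradicts stabilizability. *)

Require Import Defs.
From HB Require Import structures.
From mathcomp Require Import all_boot all_order all_algebra.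
From mathcomp Require Import all_classical all_reals all_analysis.
From mathcomp Require Import measurable_realfun ring lra.

Set Implicit Arguments.
Unset Strict Implicit.
Unset Printing Implicit Defensive.

Import Order.TTheory GRing.Theory Num.Theory.
Import numFieldNormedType.Exports.

Local Open Scope classical_set_scope.
Local Open Scope ring_scope.

(** * Square-integrable functions and independence *)

(** Only squares of linear functionals [g x] of the state are ever computed. Their mean follows from
    the Ito isometry, the martingale property and Fubini, so neither Ito's formula nor a time
    derivative of moments enters. A functional with [g B = 0] does not see the control, which is all
    that the obstruction to stabilizability requires. The algebraic obstacle is that the padded V
    satisfies L(V) = 0 only after compression to the leading block: A and the N_i might carry its
    range out of that block. The trace against Sigma^-1 shows that the noise leaks nothing and that
    the Riccati inequality is an equality on the range of V; only then does the trace against Sigma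
    give Sigma B in the kernel of V. The test matrices for the sum of squares are chosen so that all
    drift terms cancel and the noise terms complete the squares of the commutators of Sigma^-2 with
    the N_i. The reduction to one eigenspace serves twice: it makes the compression vacuous, and it
    turns Sigma into a scalar, so that the Riccati equation becomes a relation free of Sigma from
    which the projector gets its inequality. *)

Section SquareIntegrable.
Context d (T : measurableType d) (R : realType).
Variable mu : {measure set T -> \bar R}.
Implicit Types f g h : T -> R.

(** Functions rather than classes modulo null sets: solutions and Ito integrals are given as
    versions, and each passage to an almost everywhere equal function is made explicit by [ip_aeE]
    or [sqint_ae]. *)
Definition sqint f :=
  measurable_fun setT f /\ (\int[mu]_x ((f x) ^+ 2)%:E < +oo)%E.

(** The real-valued integral takes a default value when the extended one is infinite, so bilinearity
    needs square-integrable arguments; symmetry and nonnegativity hold without them. *)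
Definition ip f g : R := \int[mu]_x (f x * g x).

Lemma sqint_measurable f : sqint f -> measurable_fun setT f.
Proof. by case. Qed.

Lemma sqint_sqr f : sqint f -> mu.-integrable setT (fun x => ((f x) ^+ 2)%:E).
Proof.
move=> [mf fi]; apply/integrableP; split.
  by apply/measurable_EFinP; exact: measurable_funX.
apply: le_lt_trans fi; rewrite le_eqVlt; apply/orP; left; apply/eqP.
by apply: eq_integral => x _; rewrite gee0_abs// lee_fin sqr_ge0.
Qed.

Lemma sqint_mul f g : sqint f -> sqint g ->
  mu.-integrable setT (fun x => (f x * g x)%:E).
Proof.
move=> sf sg.
have ifg := integrableD measurableT (sqint_sqr sf) (sqint_sqr sg).
apply: le_integrable ifg => //.
  by apply/measurable_EFinP; apply: measurable_funM; [case: sf|case: sg].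
move=> x _; rewrite -EFinD !abse_EFin lee_fin.
rewrite [leRHS]ger0_norm ?addr_ge0 ?sqr_ge0// normrM.
have := sqr_ge0 (`|f x| - `|g x|); rewrite -(real_normK (num_real (f x))).
rewrite -(real_normK (num_real (g x))).
have := normr_ge0 (f x); have := normr_ge0 (g x); nra.
Qed.

Lemma ipE f g : sqint f -> sqint g ->
  (\int[mu]_x (f x * g x)%:E)%E = (ip f g)%:E.
Proof.
by move=> sf sg; rewrite /ip/= fineK// integrable_fin_num//; exact: sqint_mul.
Qed.

Lemma ipEsqr f : sqint f -> (\int[mu]_x ((f x) ^+ 2)%:E)%E = (ip f f)%:E.
Proof. by move=> sf; rewrite -ipE. Qed.

Lemma sqint_domin f g : measurable_fun setT f -> sqint g ->
  (forall x, (f x) ^+ 2 <= (g x) ^+ 2) -> sqint f.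
Proof.
move=> mf [mg ig] fg; split=> //; apply: le_lt_trans ig.
apply: ge0_le_integral => //.
- by move=> x _; rewrite lee_fin sqr_ge0.
- by apply/measurable_EFinP; exact: measurable_funX.
- by apply/measurable_EFinP; exact: measurable_funX.
- by move=> x _; rewrite lee_fin.
Qed.

Lemma sqintZ r f : sqint f -> sqint (fun x => r * f x).
Proof.
move=> sf; split; first by apply: measurable_funM => //; case: sf.
under eq_integral do rewrite exprMn EFinM.
rewrite integralZl//; last exact: sqint_sqr.
by rewrite ipEsqr// -EFinM ltry.
Qed.

Lemma sqintD f g : sqint f -> sqint g -> sqint (fun x => f x + g x).
Proof.
move=> sf sg; split; first by apply: measurable_funD; [case: sf|case: sg].
have := integrableD measurableT (integrableD measurableT (sqint_sqr sf)
  (sqint_mul (sqintZ 2 sf) sg)) (sqint_sqr sg).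
move=> /(integrable_lty measurableT); apply: le_lt_trans; rewrite le_eqVlt; apply/orP; left.
by apply/eqP/eq_integral => x _ /=; rewrite -!EFinD; congr EFin; ring.
Qed.

Lemma sqintN f : sqint f -> sqint (fun x => - f x).
Proof.
by move=> /(sqintZ (-1)); congr sqint; apply/funext => x; rewrite mulN1r.
Qed.

Lemma sqintB f g : sqint f -> sqint g -> sqint (fun x => f x - g x).
Proof. by move=> sf sg; apply: sqintD => //; exact: sqintN. Qed.

Lemma sqint0 : sqint (fun=> 0).
Proof.
split; first exact: measurable_cst.
by under eq_integral do rewrite expr0n/=; rewrite integral0 ltry.
Qed.

Lemma sqint_sum (I : Type) (s : seq I) (F : I -> T -> R) :
  (forall i, sqint (F i)) -> sqint (fun x => \sum_(i <- s) F i x).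
Proof.
move=> sF; elim: s => [|i s IH].
  by rewrite (_ : (fun _ => _) = fun=> 0); [exact: sqint0|
    apply/funext => x; rewrite big_nil].
rewrite (_ : (fun _ => _) = fun x => F i x + \sum_(j <- s) F j x).
  exact: sqintD.
by apply/funext => x; rewrite big_cons.
Qed.

Lemma ipC f g : ip f g = ip g f.
Proof. by apply: eq_Rintegral => x _; rewrite mulrC. Qed.

Lemma ip_ge0 f : 0 <= ip f f.
Proof. by apply: Rintegral_ge0 => x _; rewrite -expr2 sqr_ge0. Qed.

Lemma ipDl f g h : sqint f -> sqint g -> sqint h ->
  ip (fun x => f x + g x) h = ip f h + ip g h.
Proof.
move=> sf sg sh; rewrite /ip -RintegralD//; [|exact: sqint_mul..].
by apply: eq_Rintegral => x _; rewrite mulrDl.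
Qed.

Lemma ipDr f g h : sqint f -> sqint g -> sqint h ->
  ip h (fun x => f x + g x) = ip h f + ip h g.
Proof. by move=> sf sg sh; rewrite ipC ipDl// !(ipC h). Qed.

Lemma ipZl r f h : sqint f -> sqint h -> ip (fun x => r * f x) h = r * ip f h.
Proof.
move=> sf sh; rewrite /ip -RintegralZl//; [|exact: sqint_mul].
by apply: eq_Rintegral => x _; rewrite mulrA.
Qed.

Lemma ipZr r f h : sqint f -> sqint h -> ip h (fun x => r * f x) = r * ip h f.
Proof. by move=> sf sh; rewrite ipC ipZl// ipC. Qed.

Lemma ip0l h : ip (fun=> 0) h = 0.
Proof.
rewrite /ip /Rintegral; under eq_integral do rewrite mul0r.
by rewrite integral0.
Qed.

Lemma ipBl f g h : sqint f -> sqint g -> sqint h ->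
  ip (fun x => f x - g x) h = ip f h - ip g h.
Proof.
move=> sf sg sh; rewrite /ip -RintegralB//; [|exact: sqint_mul..].
by apply: eq_Rintegral => x _; rewrite mulrBl.
Qed.

Lemma ipBr f g h : sqint f -> sqint g -> sqint h ->
  ip h (fun x => f x - g x) = ip h f - ip h g.
Proof. by move=> sf sg sh; rewrite ipC ipBl// !(ipC h). Qed.

Lemma ip_suml (I : Type) (s : seq I) (F : I -> T -> R) h :
  (forall i, sqint (F i)) -> sqint h ->
  ip (fun x => \sum_(i <- s) F i x) h = \sum_(i <- s) ip (F i) h.
Proof.
move=> sF sh; elim: s => [|i s IH].
  rewrite (_ : (fun _ => _) = fun=> 0); first by rewrite ip0l big_nil.
  by apply/funext => x; rewrite big_nil.
rewrite (_ : (fun _ => _) = fun x => F i x + \sum_(j <- s) F j x).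
  by rewrite ipDl// ?big_cons ?IH//; exact: sqint_sum.
by apply/funext => x; rewrite big_cons.
Qed.

Lemma ip_sumr (I : Type) (s : seq I) (F : I -> T -> R) h :
  (forall i, sqint (F i)) -> sqint h ->
  ip h (fun x => \sum_(i <- s) F i x) = \sum_(i <- s) ip h (F i).
Proof.
by move=> sF sh; rewrite ipC ip_suml//; apply: eq_bigr => i _; rewrite ipC.
Qed.

Lemma cauchy_schwarz f g : sqint f -> sqint g ->
  (ip f g) ^+ 2 <= ip f f * ip g g.
Proof.
move=> sf sg.
have P a b : 0 <= a ^+ 2 * ip f f + 2 * a * b * ip f g + b ^+ 2 * ip g g.
  have := ip_ge0 (fun x => a * f x + b * g x).
  have sa := sqintZ a sf; have sb := sqintZ b sg; have sab := sqintD sa sb.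
  rewrite ipDl// !ipDr// !ipZl// !ipZr// (ipC g f).
  by congr (is_true (_ <= _)); ring.
have [g0|g0] := eqVneq (ip g g) 0.
  (* With [ip g g = 0] these weights turn [P] into [0 <= - (ip f g) ^+ 2]. *)
  have /= := P (ip f g) (- ((ip f f + 1) / 2)).
  rewrite g0 mulr0 => h; have ff := ip_ge0 f.
  have : (ip f g) ^+ 2 * (ip f f) - (ip f f + 1) * (ip f g) ^+ 2 >= 0.
    by move: h; congr (is_true (_ <= _)); field.
  lra.
have gp : 0 < ip g g by rewrite lt_neqAle eq_sym g0 ip_ge0.
have := P (ip g g) (- ip f g); rewrite -(pmulr_rge0 _ gp) => h.
rewrite -subr_ge0 -(pmulr_rge0 _ gp) -(pmulr_rge0 _ gp).
by move: h; congr (is_true (_ <= _)); ring.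
Qed.

Lemma ip_aeE f f' g : measurable_fun setT f -> measurable_fun setT f' ->
  measurable_fun setT g ->
  {ae mu, forall x, f x = f' x} -> ip f g = ip f' g.
Proof.
move=> mf mf' mg ff'; rewrite /ip /Rintegral; congr fine.
apply: ae_eq_integral => //.
- by apply/measurable_EFinP; exact: measurable_funM.
- by apply/measurable_EFinP; exact: measurable_funM.
- by apply: filterS ff' => x -> _.
Qed.

Lemma sqint_ae f f' : measurable_fun setT f' -> sqint f ->
  {ae mu, forall x, f' x = f x} -> sqint f'.
Proof.
move=> mf' [mf fi] ff'; split=> //.
rewrite (ae_eq_integral (fun x => ((f x) ^+ 2)%:E))//.
- by apply/measurable_EFinP; exact: measurable_funX.
- by apply/measurable_EFinP; exact: measurable_funX.
- by apply: filterS ff' => x -> _.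
Qed.

Lemma ip_cvgl (F : nat -> T -> R) f g : (forall m, sqint (F m)) -> sqint f ->
  sqint g -> ((fun m => ip (fun x => f x - F m x) (fun x => f x - F m x)) @ \oo
    --> (0 : R)) ->
  (fun m => ip (F m) g) @ \oo --> ip f g.
Proof.
move=> sF sf sg h.
have e0 : (fun m => Num.sqrt (ip (fun x => f x - F m x) (fun x => f x - F m x)
    * ip g g)) @ \oo --> (0 : R).
  rewrite -[X in _ --> X](sqrtr0 R) -[X in _ --> Num.sqrt X](mul0r (ip g g)).
  apply: cvg_comp; last exact: sqrt_continuous.
  by apply: cvgM => //; exact: cvg_cst.
apply/cvgrPdist_le => e ep.
move/cvgrPdist_le : e0 => /(_ _ ep); apply: filterS => m.
rewrite sub0r normrN ger0_norm ?sqrtr_ge0//; apply: le_trans.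
rewrite -ipBl// -sqrtr_sqr ler_wsqrtr//.
by apply: cauchy_schwarz => //; exact: sqintB.
Qed.

Lemma ip_cvg (F G : nat -> T -> R) f g :
  (forall m, sqint (F m)) -> (forall m, sqint (G m)) -> sqint f -> sqint g ->
  ((fun m => ip (fun x => f x - F m x) (fun x => f x - F m x)) @ \oo
    --> (0 : R)) ->
  ((fun m => ip (fun x => g x - G m x) (fun x => g x - G m x)) @ \oo
    --> (0 : R)) ->
  (fun m => ip (F m) (G m)) @ \oo --> ip f g.
Proof.
move=> sF sG sf sg hF hG.
(* Expanding the product of the two errors isolates terms linear in [F m] or [G m], which converge
   by [ip_cvgl]; Cauchy-Schwarz disposes of the error product. *)
have -> : (fun m => ip (F m) (G m)) = (fun m => ip (F m) g + ip (G m) f -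
    ip f g + ip (fun x => f x - F m x) (fun x => g x - G m x)).
  apply/funext => m.
  have sgG := sqintB sg (sG m).
  rewrite ipBl// !ipBr// (ipC f (G m)); ring.
have cFG : (fun m => ip (fun x => f x - F m x) (fun x => g x - G m x)) @ \oo
    --> (0 : R).
  have e0 : (fun m => Num.sqrt (ip (fun x => f x - F m x) (fun x => f x - F m x)
     * ip (fun x => g x - G m x) (fun x => g x - G m x))) @ \oo --> (0 : R).
    rewrite -[X in _ --> X](sqrtr0 R) -[X in _ --> Num.sqrt X](mul0r 0).
    apply: cvg_comp; last exact: sqrt_continuous.
    exact: (cvgM hF hG).
  apply/cvgrPdist_le => e ep.
  move/cvgrPdist_le : e0 => /(_ _ ep); apply: filterS => m.
  rewrite sub0r normrN ger0_norm ?sqrtr_ge0//; apply: le_trans.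
  rewrite sub0r normrN -sqrtr_sqr ler_wsqrtr//.
  by apply: cauchy_schwarz; exact: sqintB.
rewrite -[X in _ --> X](_ : ip f g + ip g f - ip f g + 0 = _); last first.
  by rewrite (ipC g f); ring.
apply: cvgD => //; apply: cvgB; last exact: cvg_cst.
by apply: cvgD; exact: ip_cvgl.
Qed.

End SquareIntegrable.

Section Independence.
Context d (T : measurableType d) (R : realType) (P : probability T R).

(** The joint law agrees with the product of the two laws on rectangles, hence everywhere, and
    Fubini splits the expectation. *)
Lemma indep_expectation (X Y : T -> R) :
  measurable_fun setT X -> measurable_fun setT Y ->
  P.-integrable setT (EFin \o X) -> P.-integrable setT (EFin \o Y) ->
  (forall A B : set R, measurable A -> measurable B ->
     P (X @^-1` A `&` Y @^-1` B) = P (X @^-1` A) * P (Y @^-1` B))%E ->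
  P.-integrable setT (fun w => (X w * Y w)%:E) /\
  \int[P]_w (X w * Y w) = (\int[P]_w X w) * (\int[P]_w Y w).
Proof.
move=> mX mY iX iY XY.
pose X' : {mfun T >-> R} := HB.pack X (isMeasurableFun.Build _ _ _ _ X mX).
pose Y' : {mfun T >-> R} := HB.pack Y (isMeasurableFun.Build _ _ _ _ Y mY).
have mXY : measurable_fun setT (fun w => (X w, Y w)).
  exact: measurable_fun_pair.
pose XY' : {mfun T >-> (R * R)%type} :=
  HB.pack (fun w => (X w, Y w)) (isMeasurableFun.Build _ _ _ _ _ mXY).
pose m1 := distribution P X'; pose m2 := distribution P Y'.
have mE (A : set (R * R)) : measurable A ->
    (m1 \x m2)%E A = distribution P XY' A.
  apply: product_measure_unique => C D mC mD /=.
  by rewrite /distribution/= /pushforward -XY.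
pose f (z : R * R) := (z.1 * z.2)%:E : \bar R.
have mf : measurable_fun setT f.
  by apply/measurable_EFinP/measurable_funM.
have i1 : (\int[m1]_x `|x%:E| < +oo)%E.
  rewrite ge0_integral_distribution//.
    by move/integrableP : iX => [].
  by apply: measurableT_comp => //; exact: EFin_measurable.
have i2 : (\int[m2]_x `|x%:E| < +oo)%E.
  rewrite ge0_integral_distribution//.
    by move/integrableP : iY => [].
  by apply: measurableT_comp => //; exact: EFin_measurable.
have mid : measurable_fun setT (fun x : R => `|x%:E|%E).
  by apply: measurableT_comp => //; exact: EFin_measurable.
rewrite /= in i1 i2 mid.
have i12 : (m1 \x m2)%E.-integrable setT f.
  apply/integrable12ltyP => //.
  under eq_integral => x _.
    under eq_integral => y _ do rewrite /f/= normrM EFinM.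
    rewrite ge0_integralZl//.
    over.
  rewrite /= ge0_integralZr//; last exact: integral_ge0.
  by rewrite lte_mul_pinfty// ?integral_ge0// ge0_fin_numE// integral_ge0.
have iXY : P.-integrable setT (fun w => (X w * Y w)%:E).
  apply/integrableP; split.
    by apply/measurable_EFinP; exact: measurable_funM.
  have /integrableP[_] := i12.
  rewrite (eq_measure_integral (distribution P XY')); last first.
    by move=> A mA _; exact: mE.
  rewrite ge0_integral_distribution//.
  by apply: measurableT_comp.
split=> //.
have iX1 : m1.-integrable setT EFin.
  by apply/integrableP; split=> //; exact: EFin_measurable.
have iY1 : m2.-integrable setT EFin.
  by apply/integrableP; split=> //; exact: EFin_measurable.
have eX : (\int[P]_w (X w)%:E)%E = (\int[m1]_x x%:E)%E.
  by rewrite integral_distribution//; exact: EFin_measurable.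
have eY : (\int[P]_w (Y w)%:E)%E = (\int[m2]_x x%:E)%E.
  by rewrite integral_distribution//; exact: EFin_measurable.
have : (\int[P]_w (X w * Y w)%:E = \int[m1]_x x%:E * \int[m2]_y y%:E)%E.
  transitivity (\int[distribution P XY']_z f z)%E.
    by rewrite integral_distribution.
  rewrite (eq_measure_integral (m1 \x m2)%E); last first.
    by move=> A mA _; exact/esym/mE.
  rewrite -integral12_prod_meas1// /fubini_F /f/=.
  under eq_integral => x _.
    under eq_integral => y _ do rewrite EFinM.
    rewrite integralZl//.
    over.
  rewrite /= -(fineK (integrable_fin_num _ iY1))//.
  by rewrite integralZr.
rewrite /Rintegral => ->; rewrite -eX -eY fineM//.
  exact: integrable_fin_num.
exact: integrable_fin_num.
Qed.

(** Independence from the past is given on boxes only, whereas the product of two increments depends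
    on the pair. Both sides are finite measures in [D] that agree on the pi-system of rectangles. *)
Lemma indep_prod_sigma (A : set T) (U V : T -> R) :
  measurable A -> measurable_fun setT U -> measurable_fun setT V ->
  (forall B C : set R, measurable B -> measurable C ->
     P (A `&` (U @^-1` B `&` V @^-1` C)) =
     P A * P (U @^-1` B `&` V @^-1` C))%E ->
  forall D : set (R * R), measurable D ->
    P (A `&` (fun w => (U w, V w)) @^-1` D) =
    (P A * P ((fun w => (U w, V w)) @^-1` D))%E.
Proof.
move=> mA mU mV AUV D mD.
have mUV : measurable_fun setT (fun w => (U w, V w)).
  exact: measurable_fun_pair.
pose UV : {mfun T >-> (R * R)%type} :=
  HB.pack (fun w => (U w, V w)) (isMeasurableFun.Build _ _ _ _ _ mUV).
pose m1 : {measure set (R * R) -> \bar R} :=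
  measure_function_pushforward__canonical__measure_function_Measure (mrestr P mA) mUV.
have PA0 : 0 <= fine (P A) by rewrite fine_ge0.
pose m2 := mscale (NngNum PA0) (distribution P UV).
pose G : set (set (R * R)) :=
  [set C | exists A, measurable A /\ exists B, measurable B /\ C = A `*` B].
have PAE : (fine (P A))%:E = P A by rewrite fineK// fin_num_measure.
have m1E X : m1 X = P (A `&` UV @^-1` X) by rewrite setIC.
have m2E X : m2 X = (P A * P (UV @^-1` X))%E by rewrite -[in RHS]PAE.
rewrite -m1E -m2E.
apply: (measure_unique G (fun=> setT)) => //.
- rewrite measurable_prod_measurableType //; congr (<<s _ >>).
    rewrite predeqE; split => [[B mB [C mC <-]]|[B [mB [C [mC ->]]]]].
      by exists B; split => //; exists C.
    by exists B => //; exists C.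
- move=> /= _ _ [X1 [mX1 [X2 [mX2 ->]]]] [Y1 [mY1 [Y2 [mY2 ->]]]].
    rewrite -setXI; exists (X1 `&` Y1); split; first exact: measurableI.
    by exists (X2 `&` Y2); split => //; exact: measurableI.
- by move=> i; exists setT; split=> //; exists setT; split=> //; rewrite setXTT.
- by rewrite bigcup_const.
- move=> _ [B [mB [C [mC ->]]]].
  by apply: etrans (m1E _) _; apply: etrans (esym (m2E _)); exact: AUV.
- by move=> _; rewrite m1E preimage_setT setIT -PAE ltry.
Qed.

End Independence.

(** * Wiener increments and Ito integrals *)

Section Wiener.
Context (R : realType) (d : measure_display) (T : measurableType d).
Variables (Pr : probability T R) (F : R -> set (set T)).
Hypothesis hF : usual_filtration Pr F.

Let Fsigma t : 0 <= t -> sigma_algebra setT (F t).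
Proof. by case: hF => h _ _ _ /h[]. Qed.

Lemma sub_measurable_measurable t X : 0 <= t -> sub_measurable (F t) X ->
  measurable_fun setT (X : T -> R).
Proof.
move=> t0 hX _ B mB; rewrite setTI; case: hF => + _ _ _ => /(_ t t0)[_]; apply.
exact: hX.
Qed.

Lemma sub_measurable_mono s t (X : T -> R) : 0 <= s -> s <= t ->
  sub_measurable (F s) X -> sub_measurable (F t) X.
Proof.
by move=> s0 st hX B mB; case: hF => _ + _ _; apply; [exact: s0|exact: st|exact: hX].
Qed.

Lemma sub_measurableP t (X : T -> R) : 0 <= t -> sub_measurable (F t) X <->
  measurable_fun setT (X : g_sigma_algebraType (F t) -> R).
Proof.
move=> t0; have FE := sigma_algebra_id (Fsigma t0).
split=> [hX _ B mB|hX B mB].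
  by rewrite setTI; apply: sub_sigma_algebra; exact: hX.
by have := hX measurableT B mB; rewrite setTI /measurable/= FE.
Qed.

Lemma sub_measurableM t (X Y : T -> R) : 0 <= t -> sub_measurable (F t) X ->
  sub_measurable (F t) Y -> sub_measurable (F t) (fun w => X w * Y w).
Proof.
move=> t0 /(sub_measurableP _ t0) hX /(sub_measurableP _ t0) hY.
by apply/(sub_measurableP _ t0); exact: measurable_funM.
Qed.

Lemma sub_measurableB t (X Y : T -> R) : 0 <= t -> sub_measurable (F t) X ->
  sub_measurable (F t) Y -> sub_measurable (F t) (fun w => X w - Y w).
Proof.
move=> t0 /(sub_measurableP _ t0) hX /(sub_measurableP _ t0) hY.
by apply/(sub_measurableP _ t0); exact: measurable_funB.
Qed.

Lemma sub_measurable_cst t (r : R) : 0 <= t -> sub_measurable (F t) (fun=> r).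
Proof. by move=> t0; apply/(sub_measurableP _ t0); exact: measurable_cst. Qed.

Lemma sub_measurable_sum t (I : Type) (s : seq I) (X : I -> T -> R) : 0 <= t ->
  (forall i, sub_measurable (F t) (X i)) ->
  sub_measurable (F t) (fun w => \sum_(i <- s) X i w).
Proof.
move=> t0 hX; apply/(sub_measurableP _ t0); apply: measurable_sum => i.
exact/(sub_measurableP _ t0).
Qed.

Lemma sqint_cst (r : R) : sqint Pr (fun=> r).
Proof.
split; first exact: measurable_cst.
by rewrite integral_cst//= probability_setT mule1 ltry.
Qed.

Lemma sqint_integrable X : sqint Pr X -> Pr.-integrable setT (EFin \o X).
Proof.
move=> sX; have := sqint_mul sX (sqint_cst 1).
by apply: eq_integrable => // x _ /=; rewrite mulr1.
Qed.

Variables (q : nat) (K : 'M[R]_q) (W : R -> T -> 'cV[R]_q).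
Hypothesis hW : wiener_process Pr F K W.

Let W_ i t w := W t w i 0.

Lemma wiener_sub t i : 0 <= t -> sub_measurable (F t) (W_ i t).
Proof. by move=> t0; case: hW => + _ _ _ _; exact. Qed.

Lemma wiener_sqint t i : 0 <= t -> sqint Pr (W_ i t).
Proof.
move=> t0; split; first exact: (sub_measurable_measurable t0 (wiener_sub _ t0)).
case: hW => _ _ _ /(_ t t0)[_ /(_ i i)] + _.
by rewrite unlock => -> ; rewrite ltry.
Qed.

Lemma wiener_mean t i : 0 <= t -> \int[Pr]_w W_ i t w = 0.
Proof.
move=> t0; case: hW => _ _ _ /(_ t t0)[/(_ i) + _] _.
by rewrite unlock /Rintegral => ->.
Qed.

Lemma wiener_cov t i j : 0 <= t -> ip Pr (W_ i t) (W_ j t) = t * K i j.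
Proof.
move=> t0; case: hW => _ _ _ /(_ t t0)[_ /(_ i j)] + _.
by rewrite unlock /ip /Rintegral => ->.
Qed.

Lemma wiener_K_sym i j : K i j = K j i.
Proof.
by rewrite -[LHS]mul1r -[RHS]mul1r -!wiener_cov// ipC.
Qed.

(** The quadratic form of [K] at [v] is the second moment of the combination of the components of
    W(1) with weights [v]. *)
Lemma wiener_K_psd : possemidef K.
Proof.
split; first by apply/matrixP => i j; rewrite mxE wiener_K_sym.
move=> v.
have -> : (v^T *m K *m v) 0 0 = ip Pr (fun w => \sum_i v i 0 * W_ i 1 w)
    (fun w => \sum_i v i 0 * W_ i 1 w).
  have sW i : sqint Pr (fun w => v i 0 * W_ i 1 w).
    by apply: sqintZ; exact: wiener_sqint.
  rewrite ip_suml//; last exact: sqint_sum.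
  rewrite -mulmxA mxE; apply: eq_bigr => i _; rewrite !mxE.
  rewrite ip_sumr// mulr_sumr; apply: eq_bigr => j _.
  by rewrite ipZl// ?ipZr// ?wiener_cov//; [ring|exact: wiener_sqint..].
exact: ip_ge0.
Qed.

Definition incr i s t w := W_ i t w - W_ i s w.

Lemma incr_sqint i s t : 0 <= s -> s <= t -> sqint Pr (incr i s t).
Proof.
by move=> s0 st; apply: sqintB; apply: wiener_sqint => //; exact: le_trans st.
Qed.

Lemma incr_sub i s t : 0 <= s -> s <= t -> sub_measurable (F t) (incr i s t).
Proof.
move=> s0 st; have t0 := le_trans s0 st.
apply: sub_measurableB => //; first exact: wiener_sub.
by apply: (@sub_measurable_mono s) => //; exact: wiener_sub.
Qed.

Lemma incr_mean i s t : 0 <= s -> s <= t -> \int[Pr]_w incr i s t w = 0.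
Proof.
move=> s0 st; have t0 := le_trans s0 st.
rewrite RintegralB ?wiener_mean ?subrr//.
  by apply: sqint_integrable; exact: wiener_sqint.
by apply: sqint_integrable; exact: wiener_sqint.
Qed.

Lemma incr_indep i j s t A (B C : set R) : 0 <= s -> s <= t -> F s A ->
  measurable B -> measurable C ->
  Pr (A `&` (incr i s t @^-1` B `&` incr j s t @^-1` C)) =
  (Pr A * Pr (incr i s t @^-1` B `&` incr j s t @^-1` C))%E.
Proof.
move=> s0 st FA mB mC.
(* The two constraints are intersected rather than assigned by cases, so that [i = j] is covered. *)
pose D k := (if k == i then B else setT) `&` (if k == j then C else setT).
case: hW => _ _ _ _ /(_ s t s0 st)[_ /(_ A D FA)] h.
have <- : [set w | forall k, D k ((W t w - W s w) k 0)] =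
    incr i s t @^-1` B `&` incr j s t @^-1` C.
  apply/seteqP; split => w /=.
    move=> Dw; split.
      by have := Dw i; rewrite /D eqxx !mxE => -[].
    by have := Dw j; rewrite /D eqxx !mxE => -[].
  move=> [Bw Cw] k; rewrite /D !mxE; split.
    by case: eqP => // ->.
  by case: eqP => // ->.
apply: h => k; apply: measurableI; case: ifP => // _; exact: measurableT.
Qed.

Lemma incr_orth i s t (xi : T -> R) : 0 <= s -> s <= t ->
  sub_measurable (F s) xi -> Pr.-integrable setT (EFin \o xi) ->
  \int[Pr]_w (xi w * incr i s t w) = 0.
Proof.
move=> s0 st hxi ixi.
have mxi := sub_measurable_measurable s0 hxi.
have sI := incr_sqint i s0 st.
have [] := indep_expectation mxi (sqint_measurable sI) ixi (sqint_integrable sI).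
  move=> A B mA mB.
  have := incr_indep i i s0 st (hxi A mA) mB (measurableT : measurable [set: R]).
  by rewrite preimage_setT setIT.
by move=> _ ->; rewrite incr_mean// mulr0.
Qed.

Lemma incr_cov i j s t : 0 <= s -> s <= t ->
  ip Pr (incr i s t) (incr j s t) = (t - s) * K i j.
Proof.
move=> s0 st; have t0 := le_trans s0 st.
have sW k u : 0 <= u -> sqint Pr (W_ k u) by exact: wiener_sqint.
(* The covariance is given at equal times only; at times [s <= t] the extra increment is orthogonal
   to what is known at [s]. *)
have st_cov k l : ip Pr (W_ k s) (W_ l t) = s * K k l.
  have -> : W_ l t = fun w => W_ l s w + incr l s t w.
    by apply/funext => w; rewrite /incr addrC subrK.
  rewrite ipDr ?wiener_cov//; [|exact: sW|exact: incr_sqint|exact: sW].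
  rewrite [ip _ _ _]incr_orth ?addr0//; first exact: wiener_sub.
  by apply: sqint_integrable; exact: sW.
have sI k := incr_sqint k s0 st.
rewrite {1}/incr ipBl//; [|exact: sW..].
rewrite /incr !ipBr//; [|exact: sW..].
rewrite (ipC _ (W_ i t) (W_ j s)) !wiener_cov// !st_cov (wiener_K_sym j i); ring.
Qed.

Lemma incr_orth2 i j s t (xi : T -> R) : 0 <= s -> s <= t ->
  sub_measurable (F s) xi -> Pr.-integrable setT (EFin \o xi) ->
  \int[Pr]_w (xi w * (incr i s t w * incr j s t w)) =
  (t - s) * K i j * \int[Pr]_w xi w.
Proof.
move=> s0 st hxi ixi.
have mxi := sub_measurable_measurable s0 hxi.
have sI k := incr_sqint k s0 st.
have mI k := sqint_measurable (sI k).
have mIJ : measurable_fun setT (fun w => incr i s t w * incr j s t w).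
  exact: measurable_funM.
have [] := indep_expectation mxi mIJ ixi (sqint_mul (sI i) (sI j)).
  move=> A B mA mB.
  pose D := (fun z : R * R => z.1 * z.2) @^-1` B.
  have mD : measurable D.
    rewrite -[D]setTI; have : measurable_fun setT (fun z : R * R => z.1 * z.2).
      exact: measurable_funM.
    by apply.
  have := indep_prod_sigma _ (mI i) (mI j) _ mD.
  apply.
    by case: hF => + _ _ _ => /(_ s s0)[_]; apply; exact: hxi.
  by move=> B' C' mB' mC'; apply: incr_indep => //; exact: hxi.
move=> _ ->.
by rewrite -incr_cov// mulrC.
Qed.

End Wiener.

(** * Covariance of single integration steps *)

Section Steps.
Context (R : realType) (d : measure_display) (T : measurableType d).
Variables (Pr : probability T R) (F : R -> set (set T)).
Hypothesis hF : usual_filtration Pr F.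
Variables (q : nat) (K : 'M[R]_q) (W : R -> T -> 'cV[R]_q).
Hypothesis hW : wiener_process Pr F K W.

Definition bounded_sub (G : set (set T)) (h : T -> R) :=
  sub_measurable G h /\ exists M : R, forall w, `|h w| <= M.

Lemma bounded_sub_mono s t h : 0 <= s -> s <= t -> bounded_sub (F s) h ->
  bounded_sub (F t) h.
Proof. by move=> s0 st [hm hb]; split=> //; exact: (sub_measurable_mono hF s0). Qed.

Lemma bounded_mul_sqint t h (f : T -> R) : 0 <= t -> bounded_sub (F t) h ->
  sqint Pr f -> sqint Pr (fun w => h w * f w).
Proof.
move=> t0 [hm [M hM]] sf.
apply: (@sqint_domin _ _ _ _ _ (fun w => M * f w)).
- by apply: measurable_funM; [exact: (sub_measurable_measurable hF t0)|case: sf].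
- exact: sqintZ.
move=> w; rewrite !exprMn ler_wpM2r ?sqr_ge0//.
by rewrite -(real_normK (num_real (h w))) lerXn2r ?nnegrE// (le_trans _ (hM w)).
Qed.

Lemma bounded_sub_sqint t h : 0 <= t -> bounded_sub (F t) h -> sqint Pr h.
Proof.
move=> t0 hb; have := bounded_mul_sqint t0 hb (sqint_cst Pr 1).
by congr sqint; apply/funext => w; rewrite mulr1.
Qed.

Definition step i (h : T -> R) a b w := h w * incr W i a b w.

Lemma step_sqint i h t a b : 0 <= t -> bounded_sub (F t) h -> 0 <= a -> a <= b ->
  sqint Pr (step i h a b).
Proof.
move=> t0 hb a0 ab; apply: (bounded_mul_sqint t0) => //.
exact: (incr_sqint hF hW).
Qed.

Lemma step_orth i j a b c d' h h' : 0 <= a -> a <= b -> b <= c -> c <= d' ->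
  bounded_sub (F c) h -> bounded_sub (F c) h' ->
  ip Pr (step i h a b) (step j h' c d') = 0.
Proof.
move=> a0 ab bc cd hb hb'.
have c0 : 0 <= c by rewrite (le_trans a0)// (le_trans ab).
rewrite -[RHS](incr_orth hF hW j (xi := fun w => step i h a b w * h' w) c0 cd).
- by apply: eq_Rintegral => w _; rewrite /step; ring.
- apply: (sub_measurableM hF) => //; last by case: hb'.
  apply: (sub_measurableM hF) => //; first by case: hb.
  apply: (sub_measurable_mono hF (le_trans a0 ab) bc).
  exact: (incr_sub hF hW).
- apply: sqint_mul; first exact: (step_sqint i c0).
  exact: (bounded_sub_sqint c0).
Qed.

Lemma step_same i j a b h h' : 0 <= a -> a <= b ->
  bounded_sub (F a) h -> bounded_sub (F a) h' ->
  ip Pr (step i h a b) (step j h' a b) = (b - a) * K i j * ip Pr h h'.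
Proof.
move=> a0 ab hb hb'.
rewrite -(incr_orth2 hF hW i j (xi := fun w => h w * h' w) a0 ab).
- by apply: eq_Rintegral => w _; rewrite /step; ring.
- by apply: (sub_measurableM hF) => //; [case: hb|case: hb'].
- by apply: sqint_mul; exact: (bounded_sub_sqint a0).
Qed.

Lemma step_split i h t a m b : 0 <= t -> bounded_sub (F t) h -> 0 <= a ->
  a <= m -> m <= b -> forall f, sqint Pr f ->
  ip Pr (step i h a b) f = ip Pr (step i h a m) f + ip Pr (step i h m b) f.
Proof.
move=> t0 hb a0 am mb f sf; have m0 := le_trans a0 am.
rewrite -ipDl//; [|exact: (step_sqint _ t0)..].
by congr ip; apply/funext => w; rewrite /step /incr; ring.
Qed.

Definition overlap (a b c e : R) := Num.max 0 (Num.min b e - Num.max a c).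

Lemma overlapC a b c e : overlap a b c e = overlap c e a b.
Proof. by rewrite /overlap (minC b) (maxC a). Qed.

(** Cutting each interval at the endpoints of the other leaves at most one common piece, evaluated
    by [step_same]. All other pairs of pieces are ordered in time and contribute nothing by
    [step_orth]. *)
Lemma step_cov i j a b c e h h' : 0 <= a -> a <= b -> 0 <= c -> c <= e ->
  bounded_sub (F a) h -> bounded_sub (F c) h' ->
  ip Pr (step i h a b) (step j h' c e) = K i j * (overlap a b c e * ip Pr h h').
Proof.
wlog ac : i j a b c e h h' / a <= c.
  move=> H a0 ab c0 ce hb hb'; have [ac|ca] := leP a c; first exact: H.
  by rewrite ipC H// ?ltW// (wiener_K_sym hW) overlapC (ipC _ h').
move=> a0 ab c0 ce hb hb'.
have hc := bounded_sub_mono a0 ac hb.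
have sce := step_sqint j c0 hb' c0 ce.
rewrite /overlap (max_idPr ac).
have [bc|cb] := leP b c.
  rewrite step_orth//.
  have -> : Num.max 0 (Num.min b e - c) = 0.
    by apply/max_idPl; rewrite subr_le0 ge_min bc.
  by rewrite mul0r mulr0.
rewrite (step_split _ c0 hc a0 ac (ltW cb))// step_orth// add0r.
have [be|eb] := leP b e.
  have s1 := step_sqint i c0 hc c0 (ltW cb).
  rewrite ipC (step_split _ c0 hb' c0 (ltW cb) be)//.
  have b0 := le_trans c0 (ltW cb).
  rewrite step_same// ?(ltW cb)// [X in _ + X]ipC step_orth// ?(ltW cb)//;
    [|exact: (bounded_sub_mono c0 (ltW cb))..].
  have -> : Num.max 0 (b - c) = b - c.
    by apply/max_idPr; rewrite subr_ge0 ltW.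
  rewrite addr0 (wiener_K_sym hW) (ipC _ h').
  ring.
have sce' := step_sqint i c0 hc c0 (le_trans ce (ltW eb)).
have e0 := le_trans c0 ce.
rewrite (step_split _ c0 hc c0 ce (ltW eb))// step_same//.
rewrite [X in _ + X]ipC step_orth// ?(ltW eb)//;
    [|exact: (bounded_sub_mono c0 ce)..].
have -> : Num.max 0 (e - c) = e - c by apply/max_idPr; rewrite subr_ge0.
rewrite addr0; ring.
Qed.

(** An interval starting after [t] collapses to a point. Its coefficient need not be known at time
    [t], so [step_cov] does not apply there, but both sides vanish. *)
Lemma step_cov_min i j t a b c e h h' : 0 <= t ->
  0 <= a -> a <= b -> 0 <= c -> c <= e ->
  bounded_sub (F a) h -> bounded_sub (F c) h' ->
  ip Pr (step i h (Num.min a t) (Num.min b t))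
        (step j h' (Num.min c t) (Num.min e t)) =
  K i j * (overlap (Num.min a t) (Num.min b t) (Num.min c t) (Num.min e t) *
    ip Pr h h').
Proof.
move=> t0 a0 ab c0 ce hb hb'.
have ov x y : overlap t t x y = 0.
  by apply/max_idPl; rewrite subr_le0 le_max ge_min lexx.
have st k g : step k g t t = fun=> 0.
  by apply/funext => w; rewrite /step /incr subrr mulr0.
have [ta|at'] := ltP t a.
  rewrite (min_idPr (le_trans (ltW ta) ab)).
  by rewrite ov mul0r mulr0 st ip0l.
have [tc|ct] := ltP t c.
  rewrite (min_idPr (le_trans (ltW tc) ce)).
  by rewrite overlapC ov mul0r mulr0 ipC st ip0l.
by apply: step_cov; rewrite ?le_min ?ab ?at' ?ce ?ct.
Qed.

End Steps.

(** * Cut processes on the product of time and outcomes *)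

Section Truncation.
Context (R : realType) (d : measure_display) (T : measurableType d).
Variable Pr : probability T R.

Local Notation leb := (@lebesgue_measure R).
Local Notation pm := (leb \x Pr)%E.

(* A process cut at time t is a function on the product of the Lebesgue line
   and the space of outcomes. *)
Definition trunc (t : R) (v : R -> T -> R) (z : measurableTypeR R * T) : R :=
  v z.1 z.2 * \1_(`[0, t]%classic : set R) z.1.

Definition tens (h : T -> R) (A : set R) (z : measurableTypeR R * T) : R := h z.2 * \1_A z.1.

(** Moves the iterated integral used to define the Ito integral to the product measure, where [ip]
    and its Cauchy-Schwarz inequality live. *)
Lemma trunc_sqr_integral t v : measurable_fun setT (trunc t v) ->
  (\int[Pr]_w \int[leb]_(s in `[0%R, t]) ((v s w) ^+ 2)%:E)%E =
  (\int[pm]_z ((trunc t v z) ^+ 2)%:E)%E.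
Proof.
move=> mv; rewrite (fubini_tonelli2 (fun z => ((trunc t v z) ^+ 2)%:E)).
- apply: eq_integral => w _; rewrite /fubini_G [LHS]integral_mkcond.
  apply: eq_integral => s _; rewrite /trunc /= patchE indicE.
  by case: ifP; rewrite ?mulr1 ?mulr0 ?expr0n.
- by apply/measurable_EFinP; exact: measurable_funX.
- by move=> z; rewrite lee_fin sqr_ge0.
Qed.

Lemma tens_measurable h A : measurable_fun setT h -> measurable A ->
  measurable_fun setT (tens h A).
Proof.
move=> mh mA; apply: measurable_funM.
  by apply: measurableT_comp.
by apply: measurableT_comp => //; exact: measurable_indic.
Qed.

Lemma tens_int (h : T -> R) A : measurable_fun setT h -> measurable A ->
  Pr.-integrable setT (EFin \o h) -> (leb A < +oo)%E ->
  pm.-integrable setT (EFin \o tens h A) /\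
  \int[pm]_z tens h A z = (\int[Pr]_w h w) * fine (leb A).
Proof.
move=> mh mA ih lA.
have mt := tens_measurable mh mA.
have lAf : leb A \is a fin_num by rewrite ge0_fin_numE.
have mt' : measurable_fun setT (EFin \o tens h A) by exact/measurable_EFinP.
have int_ind (r : R) : (\int[leb]_s (r * \1_A s)%:E)%E = (r%:E * leb A)%E.
  under eq_integral do rewrite EFinM.
  rewrite integralZl//.
    by rewrite integral_indic// setIT.
  apply/integrableP; split; first by apply/measurable_EFinP; exact: measurable_indic.
  under eq_integral do rewrite gee0_abs ?lee_fin//.
  by rewrite integral_indic// setIT.
have it : pm.-integrable setT (EFin \o tens h A).
  apply/integrable21ltyP => //.
  under eq_integral => w _.
    under eq_integral => s _.
      rewrite /tens/= normrM (ger0_norm (_ : 0 <= \1_A s)); last first.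
        by rewrite indicE.
      over.
    rewrite /= int_ind.
    over.
  rewrite /= ge0_integralZr//; last by apply/measurable_EFinP/measurableT_comp.
  rewrite lte_mul_pinfty//.
  - by apply: integral_ge0 => w _; rewrite lee_fin.
  - by case/integrableP : ih => _ ?; rewrite ge0_fin_numE// integral_ge0.
split=> //; rewrite /Rintegral -integral21_prod_meas1//= /fubini_G.
rewrite (eq_integral (fun w => (h w)%:E * leb A)%E); last first.
  by move=> w _; exact: (int_ind (h w)).
rewrite -(fineK lAf) integralZr// fineM ?fineK//.
exact: integrable_fin_num.
Qed.

Lemma tens_sqint h A : sqint Pr h -> measurable A -> (leb A < +oo)%E ->
  sqint pm (tens h A).
Proof.
move=> sh mA lA; split; first by apply: tens_measurable => //; case: sh.
have [] := @tens_int (fun w => h w ^+ 2) A _ mA (sqint_sqr sh) lA.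
  by apply: measurable_funX; case: sh.
move=> /(integrable_lty measurableT) + _; apply: le_lt_trans.
rewrite le_eqVlt; apply/orP; left; apply/eqP; apply: eq_integral => z _.
by rewrite /tens /= exprMn indicE; case: (_ \in _); rewrite ?expr1n ?expr0n.
Qed.

Lemma tens_ip h h' A A' : sqint Pr h -> sqint Pr h' ->
  measurable A -> measurable A' -> (leb A < +oo)%E ->
  ip pm (tens h A) (tens h' A') = ip Pr h h' * fine (leb (A `&` A')).
Proof.
move=> sh sh' mA mA' lA.
have lI : (leb (A `&` A') < +oo)%E.
  by apply: le_lt_trans lA; apply: le_measure; rewrite ?inE//;
    exact: measurableI.
have [|_ <-] := @tens_int (fun w => h w * h' w) (A `&` A') _
  (measurableI _ _ mA mA') (sqint_mul sh sh') lI.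
  by apply: measurable_funM; [case: sh|case: sh'].
apply: eq_Rintegral => z _; rewrite /tens indicI/=; ring.
Qed.

(** The length found here on the time axis is the one produced by [step_cov_min]; this coincidence
    is the Ito isometry for single steps. *)
Lemma overlap_measure t a b c e : 0 <= a -> 0 <= c ->
  fine (leb ((`]a, b]%classic `&` `[0, t]%classic) `&`
             (`]c, e]%classic `&` `[0, t]%classic))) =
  overlap (Num.min a t) (Num.min b t) (Num.min c t) (Num.min e t).
Proof.
move=> a0 c0.
rewrite (_ : _ `&` _ = `]Num.max a c, Num.min (Num.min b e) t]%classic).
  rewrite lebesgue_measure_itv/= lte_fin /overlap.
  have -> : Num.max (Num.min a t) (Num.min c t) = Num.min (Num.max a c) t.
    have [ac|/ltW ca] := leP a c; first by apply/max_idPr; exact: le_min2.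
    by apply/max_idPl; exact: le_min2.
  have -> : Num.min (Num.min b t) (Num.min e t) = Num.min (Num.min b e) t.
    have [be|/ltW eb] := leP b e; first by apply/min_idPl; exact: le_min2.
    by apply/min_idPr; exact: le_min2.
  set M := Num.max a c; set m := Num.min b e.
  by case: (leP m t) => ?; case: (leP M t) => ?; case: ltP => ? /=;
    case: leP => ?; lra.
apply/seteqP; split => x /=; rewrite !in_itv/= !le_min !gt_max.
  by move=> [[/andP[-> ->] /andP[_ ->]] [/andP[-> ->] _]].
move=> /andP[/andP[-> cx] /andP[/andP[-> ->] ->]].
by rewrite cx (le_trans c0 (ltW cx)).
Qed.

End Truncation.

Section ElementaryIntegral.
Context (R : realType) (d : measure_display) (T : measurableType d).
Variables (Pr : probability T R) (F : R -> set (set T)).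
Hypothesis hF : usual_filtration Pr F.
Variables (q : nat) (K : 'M[R]_q) (W : R -> T -> 'cV[R]_q).
Hypothesis hW : wiener_process Pr F K W.
Implicit Types H : @elementary R d T.

Local Notation leb := (@lebesgue_measure R).
Local Notation pm := (leb \x Pr)%E.

Lemma elementary_time_ge0 H k : elementary_wf F H -> (k <= el_size H)%N ->
  0 <= el_time H k.
Proof.
move=> [t0 tmono _]; elim: k => // k IH kH.
by rewrite (le_trans (IH (ltnW kH)))// tmono.
Qed.

Lemma elementary_bounded H k : elementary_wf F H -> (k < el_size H)%N ->
  bounded_sub (F (el_time H k)) (el_val H k).
Proof. by move=> [_ _ /(_ k)] + kH => /(_ kH)[]. Qed.

Lemma elementary_integralE H i t w :
  elementary_integral H (fun s w => W s w i 0) t w =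
  \sum_(k < el_size H) step W i (el_val H k) (Num.min (el_time H k) t)
    (Num.min (el_time H k.+1) t) w.
Proof. by []. Qed.

Lemma elementary_funE H t z :
  trunc t (elementary_fun H) z = \sum_(k < el_size H) tens (el_val H k)
     (`]el_time H k, el_time H k.+1]%classic `&` `[0, t]%classic) z.
Proof.
rewrite /trunc /elementary_fun mulr_suml; apply: eq_bigr => k _.
by rewrite /tens indicI /= mulrA.
Qed.

Let wfval H k : elementary_wf F H -> (k < el_size H)%N ->
  sqint Pr (el_val H k).
Proof.
move=> wH kH; apply: (bounded_sub_sqint hF _ (elementary_bounded wH kH)).
exact: (elementary_time_ge0 wH (ltnW kH)).
Qed.

Let lebt (A : set R) t : measurable A ->
  (leb (A `&` `[0%R, t]%classic) < +oo)%E.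
Proof.
move=> mA; apply: (@le_lt_trans _ _ (leb `[0, t]%classic)).
  by apply: le_measure; rewrite ?inE//; apply: measurableI.
by rewrite lebesgue_measure_itv/=; case: ifP => _; rewrite ?ltry// -EFinB ltry.
Qed.

Let stepval H i k t : elementary_wf F H -> (k < el_size H)%N -> 0 <= t ->
  sqint Pr (step W i (el_val H k) (Num.min (el_time H k) t)
    (Num.min (el_time H k.+1) t)).
Proof.
move=> wH kH t0; have ek0 := elementary_time_ge0 wH (ltnW kH).
apply: (step_sqint hF hW _ ek0 (elementary_bounded wH kH)).
  by rewrite le_min ek0.
by apply: le_min2 => //; case: wH => _ + _; apply.
Qed.

Let tensval H k t : elementary_wf F H -> (k < el_size H)%N ->
  sqint pm (tens (el_val H k)
     (`]el_time H k, el_time H k.+1]%classic `&` `[0, t]%classic)).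
Proof.
move=> wH kH; apply: tens_sqint; first exact: wfval.
  exact: measurableI.
exact: lebt.
Qed.

Lemma elementary_integral_sqint H i t : elementary_wf F H -> 0 <= t ->
  sqint Pr (elementary_integral H (fun s w => W s w i 0) t).
Proof.
move=> wH t0; rewrite (funext (elementary_integralE H i t)).
by apply: sqint_sum => k; exact: stepval.
Qed.

Lemma elementary_fun_sqint H t : elementary_wf F H ->
  sqint pm (trunc t (elementary_fun H)).
Proof.
move=> wH; rewrite (funext (elementary_funE H t)).
by apply: sqint_sum => k; exact: tensval.
Qed.

(** Both sides are double sums over pairs of steps and agree term by term. Overlapping intervals are
    allowed in [step_cov_min], so the two subdivisions need no common refinement. *)
Lemma elementary_isometry H H' i j t :
  elementary_wf F H -> elementary_wf F H' -> 0 <= t ->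
  ip Pr (elementary_integral H (fun s w => W s w i 0) t)
        (elementary_integral H' (fun s w => W s w j 0) t) =
  K i j * ip pm (trunc t (elementary_fun H)) (trunc t (elementary_fun H')).
Proof.
move=> wH wH' t0.
rewrite (funext (elementary_integralE H i t)) (funext (elementary_integralE H' j t)).
rewrite (funext (elementary_funE H t)) (funext (elementary_funE H' t)).
rewrite !ip_suml//; [|by move=> k; exact: tensval
  |by apply: sqint_sum => k; exact: tensval |by move=> k; exact: stepval
  |by apply: sqint_sum => k; exact: stepval].
rewrite mulr_sumr; apply: eq_bigr => k _.
rewrite !ip_sumr//; [|by move=> l; exact: tensval |exact: tensval
  |by move=> l; exact: stepval |exact: stepval].
rewrite mulr_sumr; apply: eq_bigr => l _.
have k0 := elementary_time_ge0 wH (ltnW (ltn_ord k)).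
have l0 := elementary_time_ge0 wH' (ltnW (ltn_ord l)).
rewrite (step_cov_min hF hW)//; first last.
- exact: elementary_bounded.
- exact: elementary_bounded.
- by case: wH' => _ + _; apply.
- by case: wH => _ + _; apply.
rewrite tens_ip ?overlap_measure//; first by rewrite mulrC [_ * K _ _]mulrC [X in _ * X]mulrC.
- exact: wfval.
- exact: wfval.
- exact: measurableI.
- exact: measurableI.
- exact: lebt.
Qed.

Lemma elementary_martingale H i s t xi : elementary_wf F H ->
  0 <= s -> s <= t -> sub_measurable (F s) xi -> sqint Pr xi ->
  ip Pr xi (elementary_integral H (fun s w => W s w i 0) t) =
  ip Pr xi (elementary_integral H (fun s w => W s w i 0) s).
Proof.
move=> wH s0 st mxi sxi; have t0 := le_trans s0 st.
rewrite (funext (elementary_integralE H i t)) (funext (elementary_integralE H i s)).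
rewrite !ip_sumr//; [|by move=> k; exact: stepval..].
apply: eq_bigr => k _; apply/eqP; rewrite -subr_eq0 -ipBr//;
  [|exact: stepval..].
set a := el_time H k; set b := el_time H k.+1; set h := el_val H k.
have a0 : 0 <= a := elementary_time_ge0 wH (ltnW (ltn_ord k)).
have ab : a <= b by case: wH => _ + _; apply.
have hb : bounded_sub (F a) h := elementary_bounded wH (ltn_ord k).
apply/eqP.
(* Raising the endpoints to at least [s] keeps exactly the part of the step gained between [s] and
   [t]; its starting time is then late enough for both [xi] and [h] to be known. *)
transitivity (\int[Pr]_w (xi w * h w *
    incr W i (Num.max (Num.min a t) s) (Num.max (Num.min b t) s) w)).
  apply: eq_Rintegral => w _; rewrite /step /incr -mulrA -mulrBr; congr (_ * (_ * _)).
  have e x : W (Num.max (Num.min x t) s) w i 0 =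
      W (Num.min x t) w i 0 - W (Num.min x s) w i 0 + W s w i 0.
    have [xs|sx] := leP x s.
      rewrite (min_idPl (le_trans xs st)) (max_idPr xs); ring.
    rewrite (max_idPl _) ?le_min ?(ltW sx)//; ring.
  rewrite !e; ring.
have [ta|at'] := ltP t a.
  rewrite (min_idPr (le_trans (ltW ta) ab)) (max_idPl st).
  rewrite /Rintegral; under eq_integral do rewrite /incr subrr mulr0.
  by rewrite integral0.
apply: (incr_orth hF hW).
- by rewrite le_max a0.
- rewrite ge_max !le_max lexx orbT andbT le_min ab at' //.
- apply: (sub_measurableM hF); first by rewrite le_max a0.
    by apply: (sub_measurable_mono hF s0) mxi; rewrite le_max lexx orbT.
  by case: hb => + _; apply: (sub_measurable_mono hF a0); rewrite le_max lexx.
- by apply: sqint_mul => //; exact: (bounded_sub_sqint hF a0).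
Qed.

End ElementaryIntegral.

Section SquareConvergence.
Context d (T : measurableType d) (R : realType) (mu : {measure set T -> \bar R}).

Lemma ip_cvg0 (f : nat -> T -> R) : (forall m, sqint mu (f m)) ->
  ((fun m => \int[mu]_x ((f m x) ^+ 2)%:E) @ \oo --> 0)%E ->
  (fun m => ip mu (f m) (f m)) @ \oo --> (0 : R).
Proof.
move=> sf h; have -> : (fun m => ip mu (f m) (f m)) =
    fine \o (fun m => \int[mu]_x ((f m x) ^+ 2)%:E)%E.
  by apply/funext => m /=; rewrite ipEsqr.
exact: fine_cvg.
Qed.

End SquareConvergence.

Section TruncationMonotone.
Context (R : realType) (d : measure_display) (T : measurableType d).
Variable Pr : probability T R.
Local Notation pm := (@lebesgue_measure R \x Pr)%E.
Implicit Types v : R -> T -> R.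

Lemma trunc_truncE s t v : s <= t ->
  trunc s v = fun z => trunc t v z * \1_(`[0, s]%classic : set R) z.1.
Proof.
move=> st; apply/funext => z; rewrite /trunc -mulrA; congr (_ * _).
rewrite !indicE !mem_setE !in_itv/=.
have [zs|_] := leP z.1 s; last by rewrite andbF mulr0.
by rewrite (le_trans zs st) andbT; case: (0 <= z.1); rewrite ?mul1r ?mulr0.
Qed.

Lemma trunc_sqint_le s t v : s <= t -> sqint pm (trunc t v) ->
  sqint pm (trunc s v).
Proof.
move=> st sv; apply: sqint_domin (sv) _.
  rewrite (trunc_truncE _ st); apply: measurable_funM; first by case: sv.
  by apply: measurableT_comp => //; exact: measurable_indic.
move=> z; rewrite (trunc_truncE _ st) exprMn.
by rewrite ler_piMr ?sqr_ge0// indicE; case: (_ \in _);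
  rewrite ?expr1n ?expr0n.
Qed.

Lemma trunc_ip_le s t v : s <= t -> sqint pm (trunc t v) ->
  ip pm (trunc s v) (trunc s v) <= ip pm (trunc t v) (trunc t v).
Proof.
move=> st sv; have sv' := trunc_sqint_le st sv.
apply: le_Rintegral => // [||z _]; [exact: sqint_mul..|].
rewrite -!expr2 (trunc_truncE _ st) exprMn.
by rewrite ler_piMr ?sqr_ge0// indicE; case: (_ \in _);
  rewrite ?expr1n ?expr0n.
Qed.

Lemma truncB t u v :
  trunc t (fun s w => u s w - v s w) = (fun z => trunc t u z - trunc t v z)
    :> (_ * T -> R).
Proof. by apply/funext => z; rewrite /trunc mulrBl. Qed.

End TruncationMonotone.

(** * Ito isometry and martingale property *)

Section ItoIntegral.
Context (R : realType) (d : measure_display) (T : measurableType d).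
Variables (Pr : probability T R) (F : R -> set (set T)).
Hypothesis hF : usual_filtration Pr F.
Variables (q : nat) (K : 'M[R]_q) (W : R -> T -> 'cV[R]_q).
Hypothesis hW : wiener_process Pr F K W.
Local Notation pm := (@lebesgue_measure R \x Pr)%E.
Local Notation Wc i := (fun s w => W s w i 0).
Local Notation eint H i := (elementary_integral H (Wc i)).
Local Notation efun H := (elementary_fun H).

Lemma ito_approx i v t I : 0 <= t -> sqint pm (trunc t v) ->
  is_ito_integral Pr F (Wc i) v t I ->
  sqint Pr I /\ exists H : nat -> @elementary R d T,
    [/\ forall m, elementary_wf F (H m),
        (fun m => ip pm (fun z => trunc t v z - trunc t (efun (H m)) z)
           (fun z => trunc t v z - trunc t (efun (H m)) z)) @ \oo --> (0 : R)
      & (fun m => ip Pr (fun w => I w - eint (H m) i t w)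
           (fun w => I w - eint (H m) i t w)) @ \oo --> (0 : R)].
Proof.
move=> t0 sv [mI [H [wH cv cI]]].
have sJ m : sqint Pr (eint (H m) i t) by exact: (elementary_integral_sqint hF hW).
have sI : sqint Pr I.
  (* The errors tend to 0 in the extended reals, so one of them is finite, and [I] differs from a
     square-integrable elementary integral by a square-integrable function. *)
  have [m hm] : exists m,
      (\int[Pr]_w ((I w - eint (H m) i t w) ^+ 2)%:E < +oo)%E.
    have [m _ /(_ m (leqnn m))] := cvg_is_fine cI.
    rewrite unlock => hm; exists m; move: hm => /=.
    by rewrite ge0_fin_numE//; apply: integral_ge0 => w _; rewrite lee_fin sqr_ge0.
  have sd : sqint Pr (fun w => I w - eint (H m) i t w).
    by split=> //; apply: measurable_funB => //; case: (sJ m).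
  have := sqintD sd (sJ m); congr sqint; apply/funext => w; ring.
split=> //; exists H; split=> //.
  apply: ip_cvg0.
    by move=> m; apply: sqintB => //; exact: (elementary_fun_sqint hF).
  suff <- : (fun m => \int[Pr]_w \int[@lebesgue_measure R]_(s in `[0%R, t])
      ((v s w - efun (H m) s w) ^+ 2)%:E)%E =
    (fun m => \int[pm]_z ((trunc t v z - trunc t (efun (H m)) z) ^+ 2)%:E)%E.
    exact: cv.
  apply/funext => m; rewrite trunc_sqr_integral truncB//.
  apply: measurable_funB; first by case: sv.
  by case: (elementary_fun_sqint hF t (wH m)).
apply: ip_cvg0; first by move=> m; exact: sqintB.
by move: cI; rewrite unlock.
Qed.

Lemma ito_sqint i v t I : 0 <= t -> sqint pm (trunc t v) ->
  is_ito_integral Pr F (Wc i) v t I -> sqint Pr I.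
Proof. by move=> t0 sv /(ito_approx t0 sv)[]. Qed.

(** Polarized Ito isometry between different components: [ip_cvg] passes to the limit along separate
    approximating sequences on the two sides. *)
Lemma ito_cov i j v v' t I I' : 0 <= t ->
  sqint pm (trunc t v) -> sqint pm (trunc t v') ->
  is_ito_integral Pr F (Wc i) v t I -> is_ito_integral Pr F (Wc j) v' t I' ->
  ip Pr I I' = K i j * ip pm (trunc t v) (trunc t v').
Proof.
move=> t0 sv sv' /(ito_approx t0 sv)[sI [H [wH cH cI]]].
move=> /(ito_approx t0 sv')[sI' [H' [wH' cH' cI']]].
have sJ k (h : elementary) : elementary_wf F h -> sqint Pr (eint h k t).
  by move=> ?; exact: (elementary_integral_sqint hF hW).
have sE (h : elementary) : elementary_wf F h -> sqint pm (trunc t (efun h)).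
  by move=> ?; exact: (elementary_fun_sqint hF).
have c1 := ip_cvg (fun m => sJ i _ (wH m)) (fun m => sJ j _ (wH' m)) sI sI' cI cI'.
have c2 := ip_cvg (fun m => sE _ (wH m)) (fun m => sE _ (wH' m)) sv sv' cH cH'.
apply: (cvg_unique _ c1) => //.
rewrite (_ : (fun m => _) = (fun m => K i j *
  ip pm (trunc t (efun (H m))) (trunc t (efun (H' m))))).
  by apply: cvgM => //; exact: cvg_cst.
by apply/funext => m; rewrite (elementary_isometry hF hW).
Qed.

Lemma elementary_is_ito H i t : elementary_wf F H -> 0 <= t ->
  is_ito_integral Pr F (Wc i) (efun H) t (eint H i t).
Proof.
move=> wH t0; split.
  by case: (elementary_integral_sqint hF hW i wH t0).
exists (fun=> H); split=> //.
- rewrite (_ : (fun _ => _) = fun=> 0%E); first exact: cvg_cst.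
  apply/funext => m; under eq_integral => w _.
    under eq_integral do rewrite subrr expr0n/=.
    rewrite integral0; over.
  by rewrite integral0.
- rewrite (_ : (fun _ => _) = fun=> 0%E); first exact: cvg_cst.
  apply/funext => m; rewrite unlock.
  under eq_integral do rewrite subrr expr0n/=.
  by rewrite integral0.
Qed.

(** [I] and [I'] may come with different approximating sequences. By the isometry, the sequence for
    [I] also approximates [I'] at time [s]: the squared distance there is [K i i] times the distance
    of the integrands cut at [s], hence at most that of the integrands cut at [t]. *)
Lemma ito_martingale i v s t I I' xi : 0 <= s -> s <= t ->
  sub_measurable (F s) xi -> sqint Pr xi -> sqint pm (trunc t v) ->
  is_ito_integral Pr F (Wc i) v t I -> is_ito_integral Pr F (Wc i) v s I' ->
  ip Pr xi I = ip Pr xi I'.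
Proof.
move=> s0 st mxi sxi sv hI hI'; have t0 := le_trans s0 st.
have [sI [H [wH cH cI]]] := ito_approx t0 sv hI.
have sv' := trunc_sqint_le st sv.
have sI' := ito_sqint s0 sv' hI'.
have sJ r m : 0 <= r -> sqint Pr (eint (H m) i r).
  by move=> ?; exact: (elementary_integral_sqint hF hW).
have sE r m : sqint pm (trunc r (efun (H m))).
  exact: (elementary_fun_sqint hF).
have c1 := ip_cvgl (fun m => sJ t m t0) sI sxi cI.
have cI' : (fun m => ip Pr (fun w => I' w - eint (H m) i s w)
    (fun w => I' w - eint (H m) i s w)) @ \oo --> (0 : R).
  have c0 : (fun m => K i i * ip pm
      (fun z => trunc t v z - trunc t (efun (H m)) z)
      (fun z => trunc t v z - trunc t (efun (H m)) z)) @ \oo --> (0 : R).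
    by rewrite -[X in _ --> X](mulr0 (K i i)); apply: cvgM => //; exact: cvg_cst.
  apply: (squeeze_cvgr _ (cvg_cst 0) c0); apply: nearW => m.
  rewrite ip_ge0/=.
  have sIJ := sqintB sI' (sJ s m s0).
  have hJ := elementary_is_ito i (wH m) s0.
  rewrite (ipBl sI' (sJ s m s0) sIJ) (ipBr sI' (sJ s m s0) sI') (ipBr sI' (sJ s m s0) (sJ s m s0)).
  rewrite (ito_cov s0 sv' sv' hI' hI') (ito_cov s0 sv' (sE s m) hI' hJ).
  rewrite (ito_cov s0 (sE s m) sv' hJ hI') (ito_cov s0 (sE s m) (sE s m) hJ hJ).
  rewrite -!mulrBr ler_wpM2l//.
    have := (wiener_K_psd hF hW).2 (delta_mx i 0).
    by rewrite trmx_delta -rowE -colE !mxE.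
  have sd : sqint pm (trunc t (fun s w => v s w - efun (H m) s w)).
    by rewrite truncB; exact: sqintB.
  have sb := sqintB sv' (sE s m).
  have := trunc_ip_le st sd; rewrite !truncB; apply: le_trans.
  rewrite (ipBl sv' (sE s m) sb) (ipBr sv' (sE s m) sv').
  by rewrite (ipBr sv' (sE s m) (sE s m)).
have c2 := ip_cvgl (fun m => sJ s m s0) sI' sxi cI'.
rewrite ipC (ipC _ xi); apply: (cvg_unique _ c1) => //.
rewrite (_ : (fun m => _) = (fun m => ip Pr (eint (H m) i s) xi))//.
apply/funext => m; rewrite ipC [RHS]ipC.
exact: (elementary_martingale hF hW).
Qed.

(** Comparison with time 0, where every step of an elementary integral has collapsed. *)
Lemma ito_mean i v t I : 0 <= t -> sqint pm (trunc t v) ->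
  is_ito_integral Pr F (Wc i) v t I -> ip Pr (fun=> 1) I = 0.
Proof.
move=> t0 sv hI; have [sI [H [wH cH cI]]] := ito_approx t0 sv hI.
have s1 := sqint_cst Pr 1.
have c1 := ip_cvgl (fun m => elementary_integral_sqint hF hW i (wH m) t0)
  sI s1 cI.
rewrite ipC; apply: (cvg_unique _ c1) => //.
rewrite (_ : (fun m => _) = (fun=> 0)); first exact: cvg_cst.
apply/funext => m; rewrite ipC (elementary_martingale hF hW i (wH m) (lexx 0) t0 _ s1)//.
  rewrite (_ : eint _ _ _ = fun=> 0); first by rewrite ipC ip0l.
  apply/funext => w; rewrite elementary_integralE big1// => k _.
  have k0 := elementary_time_ge0 (wH m) (ltnW (ltn_ord k)).
  have k1 := elementary_time_ge0 (wH m) (ltn_ord k).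
  by rewrite !(min_idPr _)// /step /incr subrr mulr0.
exact: (sub_measurable_cst hF).
Qed.

End ItoIntegral.

(** * Energy of a semimartingale *)

Section RealFubini.
Context d1 d2 (X : measurableType d1) (Y : measurableType d2) (R : realType).
Variable m1 : {sigma_finite_measure set X -> \bar R}.
Variable m2 : {sigma_finite_measure set Y -> \bar R}.
Variable f : X * Y -> R.
Hypothesis fi : (m1 \x m2)%E.-integrable setT (EFin \o f).

(** Making the inner integral real changes it only where it is infinite, which is a null set. *)
Lemma Rintegral_fubini1 :
  m1.-integrable setT (fun x => (\int[m2]_y f (x, y))%:E) /\
  \int[m1]_x (\int[m2]_y f (x, y)) = \int[(m1 \x m2)%E]_z f z.
Proof.
have iF := integrable_fubini_F fi.
have mF := measurable_int _ iF.
have mfF : measurable_fun setT (fun x => (\int[m2]_y f (x, y))%:E).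
  apply/measurable_EFinP; rewrite /Rintegral.
  exact: (measurableT_comp (fine_measurable measurableT) mF).
split.
  apply: le_integrable iF => // x _.
  rewrite /Rintegral -/(fubini_F m2 (EFin \o f) x).
  by case: (fubini_F _ _ _) => [r||] //=; rewrite leey.
rewrite /Rintegral -integral12_prod_meas1//; congr fine.
apply: ae_eq_integral => //.
have := integrable_ae measurableT iF; apply: filterS => x /= /(_ I) + _.
by move=> /fineK.
Qed.

Lemma Rintegral_fubini2 :
  m2.-integrable setT (fun y => (\int[m1]_x f (x, y))%:E) /\
  \int[m2]_y (\int[m1]_x f (x, y)) = \int[(m1 \x m2)%E]_z f z.
Proof.
have iF : m2.-integrable setT (fubini_G m1 (EFin \o f)).
  have mfs : measurable_fun setT (EFin \o f \o (fun p : Y * X => (p.2, p.1))).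
    apply: measurableT_comp; first exact: measurable_int fi.
    by apply: measurable_fun_pair.
  apply: (@integrable_fubini_F _ _ _ _ _ m2 m1 (EFin \o f \o (fun p : Y * X => (p.2, p.1)))).
  apply/integrable12ltyP => //=.
  exact: (integrable21ltyP m1 m2 (measurable_int _ fi)).1.
have mF := measurable_int _ iF.
have mfF : measurable_fun setT (fun y => (\int[m1]_x f (x, y))%:E).
  apply/measurable_EFinP; rewrite /Rintegral.
  exact: (measurableT_comp (fine_measurable measurableT) mF).
split.
  apply: le_integrable iF => // x _.
  rewrite /Rintegral -/(fubini_G m1 (EFin \o f) x).
  by case: (fubini_G _ _ _) => [r||] //=; rewrite leey.
rewrite /Rintegral -integral21_prod_meas1//; congr fine.
apply: ae_eq_integral => //.
have := integrable_ae measurableT iF; apply: filterS => x /= /(_ I) + _.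
by move=> /fineK.
Qed.

End RealFubini.

Section AeRintegral.
Context d (X : measurableType d) (R : realType) (mu : {measure set X -> \bar R}).

Lemma ae_eq_Rintegral (f g : X -> R) : measurable_fun setT f ->
  measurable_fun setT g -> {ae mu, forall x, f x = g x} ->
  \int[mu]_x f x = \int[mu]_x g x.
Proof.
move=> mf mg fg; rewrite /Rintegral; congr fine; apply: ae_eq_integral => //.
- exact/measurable_EFinP.
- exact/measurable_EFinP.
- by apply: filterS fg => x -> _.
Qed.

Lemma integrable_bool (f : X -> R) (b : X -> bool) :
  measurable_fun setT b -> mu.-integrable setT (EFin \o f) ->
  mu.-integrable setT (EFin \o (fun x => f x * (b x)%:R)).
Proof.
move=> mb fi; apply: le_integrable (fi) => //.
  apply/measurable_EFinP; apply: measurable_funM.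
    by apply/measurable_EFinP; exact: measurable_int fi.
  rewrite (_ : (fun _ => _) = (fun x => if b x then 1 else 0)).
    by apply: measurable_fun_ifT.
  by apply/funext => x; case: (b x).
move=> x _ /=; rewrite lee_fin normrM.
by case: (b x); rewrite ?normr1 ?normr0 ?mulr1 ?mulr0.
Qed.

End AeRintegral.

Section Triangle.
Context (R : realType).
Local Notation leb := (@lebesgue_measure R).
Local Notation TR := (measurableTypeR R).

(** Symmetry exchanges the two triangles of the square, and their common diagonal is negligible. *)
Lemma Rintegral_triangle (h : TR * TR -> R) :
  (leb \x leb)%E.-integrable setT (EFin \o h) ->
  (forall s u, h (s, u) = h (u, s)) ->
  \int[leb]_s (\int[leb]_u h (s, u)) =
  2 * \int[leb]_s (\int[leb]_u (h (s, u) * ((u : R) <= s)%R%:R)).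
Proof.
move=> hi hsym.
pose h1 (z : TR * TR) : R := h z * ((z.2 : R) <= z.1)%R%:R.
pose h2 (z : TR * TR) : R := h z * ((z.1 : R) < z.2)%R%:R.
pose h3 (z : TR * TR) : R := h z * ((z.2 : R) < z.1)%R%:R.
have m1 : measurable_fun setT (fun z : TR * TR => z.1 : R).
  exact: measurable_fst.
have m2 : measurable_fun setT (fun z : TR * TR => z.2 : R).
  exact: measurable_snd.
have i1 : (leb \x leb)%E.-integrable setT (EFin \o h1).
  by apply: integrable_bool => //; exact: measurable_fun_ler.
have i2 : (leb \x leb)%E.-integrable setT (EFin \o h2).
  by apply: integrable_bool => //; exact: measurable_fun_ltr.
have i3 : (leb \x leb)%E.-integrable setT (EFin \o h3).
  by apply: integrable_bool => //; exact: measurable_fun_ltr.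
have -> : \int[leb]_s (\int[leb]_u h (s, u)) = \int[(leb \x leb)%E]_z h z.
  exact: (Rintegral_fubini1 hi).2.
have -> : \int[leb]_s (\int[leb]_u (h (s, u) * ((u : R) <= s)%R%:R)) =
    \int[(leb \x leb)%E]_z h1 z.
  exact: (Rintegral_fubini1 i1).2.
have -> : \int[(leb \x leb)%E]_z h z =
    \int[(leb \x leb)%E]_z h1 z + \int[(leb \x leb)%E]_z h2 z.
  rewrite -RintegralD//; apply: eq_Rintegral => z _; rewrite /h1 /h2.
  by rewrite -mulrDr; case: leP => _; rewrite ?addr0 ?add0r mulr1.
have -> : \int[(leb \x leb)%E]_z h2 z = \int[(leb \x leb)%E]_z h3 z.
  have [_ <-] := Rintegral_fubini2 i2; have [_ <-] := Rintegral_fubini1 i3.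
  by apply: eq_Rintegral => u _; apply: eq_Rintegral => s _; rewrite /h2 /h3 hsym.
(* The strict and the wide triangle differ on each section by a single point. *)
have -> : \int[(leb \x leb)%E]_z h3 z = \int[(leb \x leb)%E]_z h1 z.
  have [_ <-] := Rintegral_fubini1 i3; have [_ <-] := Rintegral_fubini1 i1.
  apply: eq_Rintegral => s _; apply: ae_eq_Rintegral.
  - have m3 : measurable_fun setT h3.
      by apply/measurable_EFinP; exact: measurable_int i3.
    exact: (measurableT_comp m3).
  - have m3 : measurable_fun setT h1.
      by apply/measurable_EFinP; exact: measurable_int i1.
    exact: (measurableT_comp m3).
  - exists [set s]; split => //; first exact: lebesgue_measure_set1.
    move=> u /= us; apply: contra_notP us => /eqP us.
    rewrite /h1 /h3/= le_eqVlt (negbTE us)//.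
ring.
Qed.

End Triangle.

Section ProductIntegral.
Context d1 d2 (X : measurableType d1) (Y : measurableType d2) (R : realType).
Variable m1 : {sigma_finite_measure set X -> \bar R}.
Variable m2 : {sigma_finite_measure set Y -> \bar R}.

Lemma ge0_integral_prod (f : X -> \bar R) (g : Y -> \bar R) :
  measurable_fun setT f -> measurable_fun setT g ->
  (forall x, 0 <= f x)%E -> (forall y, 0 <= g y)%E ->
  (\int[(m1 \x m2)%E]_z (f z.1 * g z.2) = \int[m1]_x f x * \int[m2]_y g y)%E.
Proof.
move=> mf mg f0 g0; rewrite (fubini_tonelli1 (fun z => f z.1 * g z.2)%E).
- rewrite -ge0_integralZr//; last exact: integral_ge0.
  by apply: eq_integral => x _; rewrite /fubini_F/= ge0_integralZl.
- by apply: emeasurable_funM; exact: measurableT_comp.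
- by move=> z; rewrite mule_ge0.
Qed.

Lemma sqint_product (g : X * Y -> R) : measurable_fun setT g ->
  (\int[m1]_x \int[m2]_y ((g (x, y)) ^+ 2)%:E < +oo)%E ->
  sqint (m1 \x m2)%E g.
Proof.
move=> mg h; split=> //.
rewrite (fubini_tonelli1 (fun z => ((g z) ^+ 2)%:E))//.
- by apply/measurable_EFinP/measurable_funX.
- by move=> z; rewrite lee_fin sqr_ge0.
Qed.

End ProductIntegral.

Section LebesgueSquare.
Context (R : realType).
Local Notation leb := (@lebesgue_measure R).

(** Needed to use the plane of two times as one factor in Fubini's theorem, the other factor being
    the outcomes. *)
Lemma lebesgue_square_sigma_finite : sigma_finite setT (leb \x leb)%E.
Proof.
pose F (n : nat) : set (measurableTypeR R) := `[- n%:R, n%:R]%classic.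
exists (fun n => F n `*` F n).
  apply/esym; rewrite -subTset => -[x y] _.
  have := archi_boundP (addr_ge0 (normr_ge0 x) (normr_ge0 y)).
  set n := Num.bound _ => hn; exists n => //.
  have := normr_ge0 x; have := normr_ge0 y => y0 x0.
  by split; rewrite /F/= in_itv/= -ler_norml; apply: ltW; apply: le_lt_trans hn;
    rewrite ?lerDl ?lerDr.
move=> n; have mF : measurable (F n) by exact: measurable_itv.
have FE : (leb (F n) = (n%:R + n%:R)%:E)%E.
  rewrite lebesgue_measure_itv/= lte_fin -EFinD opprK.
  case: ltP => // h; congr EFin; apply/eqP.
  by rewrite eq_le addr_ge0//=; move: h; rewrite -subr_le0 opprK.
split; first exact: measurableX.
rewrite product_measure1E//.
apply: (@le_lt_trans _ _ ((n%:R + n%:R)%:E * (n%:R + n%:R)%:E)%E).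
  by rewrite le_eqVlt; apply/orP; left; apply/eqP; congr (_ * _)%E; exact: FE.
by rewrite -EFinM ltry.
Qed.

End LebesgueSquare.

Section Drift.
Context (R : realType) (d : measure_display) (T : measurableType d).
Variable Pr : probability T R.
Local Notation leb := (@lebesgue_measure R).
Local Notation pm := (leb \x Pr)%E.
Local Notation TR := (measurableTypeR R).
Local Notation I0 t := (`[0, t]%classic : set R).

Lemma sqint_section (f : TR * T -> R) : sqint pm f ->
  {ae Pr, forall w, sqint leb (fun s => f (s, w))}.
Proof.
move=> sf; have := ae_integrable2 (sqint_sqr sf); apply: filterS => w h.
split; last exact: (integrable_lty measurableT h).
by apply: (measurableT_comp (sqint_measurable sf)).
Qed.

Lemma lebesgue_measure_I0 t : 0 <= t -> leb (I0 t) = t%:E.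
Proof.
move=> t0; rewrite lebesgue_measure_itv/= lte_fin.
by case: ltP => [_|t0']; rewrite ?oppr0 ?adde0 ?oppe0//; congr EFin; apply/le_anti; rewrite t0 t0'.
Qed.

Lemma indic_sqint t : 0 <= t -> sqint leb (\1_(I0 t) : R -> R).
Proof.
move=> t0; split; first exact: measurable_indic.
rewrite (eq_integral (fun s : TR => (\1_(I0 t) s)%:E)); last first.
  by move=> s _; rewrite indicE; case: (_ \in _); rewrite ?expr1n ?expr0n.
rewrite integral_indic// setIT [X in (X < _)%E](_ : _ = t%:E) ?ltry//.
exact: lebesgue_measure_I0.
Qed.

Lemma tens_trunc_sqint t xi : 0 <= t -> sqint Pr xi -> sqint pm (tens xi (I0 t)).
Proof.
by move=> t0 sxi; apply: tens_sqint => //; rewrite lebesgue_measure_I0// ltry.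
Qed.

Variable phi : R -> T -> R.

(** The integrand is cut and the domain left whole, so that this is a partial integral of one
    function on the product space. *)
Definition drift t w : R := \int[leb]_s trunc t phi (s, w).

Lemma driftE t w : drift t w = \int[leb]_(s in `[0, t]) phi s w.
Proof.
rewrite /drift [RHS]Rintegral_mkcond; apply: eq_Rintegral => s _.
by rewrite /trunc /= patchE indicE; case: ifP; rewrite ?mulr1 ?mulr0.
Qed.

Lemma tens_mul_trunc t xi z : tens xi (I0 t) z * trunc t phi z =
  xi z.2 * trunc t phi z.
Proof.
rewrite /tens /trunc indicE; case: (_ \in _); rewrite ?mulr1 ?mulr0//.
Qed.

Section FixedHorizon.
Variable t : R.
Hypothesis t0 : 0 <= t.
Hypothesis sphi : sqint pm (trunc t phi).

Lemma drift_measurable : measurable_fun setT (drift t).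
Proof.
have := sqint_mul (tens_trunc_sqint t0 (sqint_cst Pr 1)) sphi.
under eq_fun do rewrite tens_mul_trunc mul1r.
by move=> /Rintegral_fubini2[+ _] => /measurable_int /measurable_EFinP.
Qed.

Lemma drift_ip xi : sqint Pr xi ->
  ip Pr xi (drift t) = ip pm (tens xi (I0 t)) (trunc t phi).
Proof.
move=> sxi; have st := tens_trunc_sqint t0 sxi.
have [i2 e2] := Rintegral_fubini2 (sqint_mul st sphi).
rewrite [RHS]/ip -e2; apply: ae_eq_Rintegral.
- by apply: measurable_funM; [case: sxi|exact: drift_measurable].
- by apply/measurable_EFinP; exact: measurable_int i2.
have := sqint_section sphi; apply: filterS => w sw.
under eq_Rintegral do rewrite tens_mul_trunc/=.
rewrite RintegralZl//.
have := sqint_mul sw (indic_sqint t0); apply: eq_integrable => // s _ /=.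
by rewrite /trunc/= indicE; case: (_ \in _); rewrite ?mulr1 ?mulr0.
Qed.

(** Cauchy-Schwarz in time against the indicator of [[0, t]]: for almost every outcome the square of
    the drift is at most [t] times the time integral of the squared rate. *)
Lemma drift_sqint : sqint Pr (drift t).
Proof.
split; first exact: drift_measurable.
pose f z := ((trunc t phi z) ^+ 2)%:E.
have mf : measurable_fun setT f.
  by apply/measurable_EFinP/measurable_funX; case: sphi.
have f0 z : (0 <= f z)%E by rewrite lee_fin sqr_ge0.
have : (\int[Pr]_w (t%:E * \int[leb]_s f (s, w)) < +oo)%E.
  rewrite ge0_integralZl//; last 2 first.
  - exact: measurable_fun_fubini_tonelli_G.
  - by move=> w _; exact: integral_ge0.
  rewrite -fubini_tonelli2// -/f.
  have [_ h] := sphi.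
  by rewrite lte_mul_pinfty.
apply: le_lt_trans; apply: ae_ge0_le_integral => //.
- by move=> w _; rewrite lee_fin sqr_ge0.
- by apply/measurable_EFinP/measurable_funX; exact: drift_measurable.
- by move=> w _; rewrite mule_ge0// integral_ge0.
- apply: emeasurable_funM => //.
  exact: measurable_fun_fubini_tonelli_G.
have := sqint_section sphi; apply: filterS => w sw _.
have s1 := indic_sqint t0.
rewrite /f ipEsqr// -EFinM lee_fin.
have -> : drift t w = ip leb (\1_(I0 t)) (fun s => trunc t phi (s, w)).
  apply: eq_Rintegral => s _; rewrite /trunc/= indicE.
  by case: (_ \in _); rewrite ?mul1r ?mulr1 ?mulr0.
have e : ip leb (\1_(I0 t)) (\1_(I0 t)) = t.
  transitivity (\int[leb]_s (\1_(I0 t) s : R)).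
    apply: eq_Rintegral => s _; rewrite indicE.
    by case: (_ \in _); rewrite ?mulr1 ?mulr0.
  rewrite /Rintegral integral_indic// setIT [X in fine X](_ : _ = t%:E)//.
  exact: lebesgue_measure_I0.
rewrite -[X in _ <= X * _]e.
exact: cauchy_schwarz.
Qed.

Hypothesis sphis : forall s, 0 <= s -> sqint Pr (phi s).

Lemma trunc_sqint_slice s : sqint Pr (fun w => trunc t phi (s, w)).
Proof.
rewrite /trunc/= indicE mem_setE in_itv/=.
case: (leP 0 s) => [s0|_] /=.
  case: (s <= t); last by rewrite (_ : (fun _ => _) = fun=> 0);
    [exact: sqint0|apply/funext => w; rewrite mulr0].
  by have := sphis s0; congr sqint; apply/funext => w; rewrite mulr1.
rewrite (_ : (fun _ => _) = fun=> 0); first exact: sqint0.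
by apply/funext => w; rewrite mulr0.
Qed.

Let ft := trunc t phi.
Let fs s w := ft (s, w).
Let rr s u := ip Pr (fs s) (fs u).

Lemma ip_tens_trunc xi s : 0 <= s -> s <= t -> sqint Pr xi ->
  ip pm (tens xi (I0 s)) (trunc s phi) =
  \int[leb]_u (ip Pr xi (fs u) * (u <= s)%R%:R).
Proof.
move=> s0 st sxi; have st' := tens_trunc_sqint s0 sxi.
have sphi' := trunc_sqint_le st sphi.
rewrite [LHS]/ip -(Rintegral_fubini1 (sqint_mul st' sphi')).2.
apply: eq_Rintegral => u _; rewrite /ip -RintegralZr//; last first.
  exact: (sqint_mul sxi (trunc_sqint_slice u)).
apply: eq_Rintegral => w _; rewrite tens_mul_trunc -mulrA; congr (_ * _).
rewrite /fs /ft /trunc/= -mulrA; congr (_ * _).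
rewrite !indicE !mem_setE !in_itv/=.
case: (leP u s) => [us|]; last by rewrite andbF mulr0.
by rewrite (le_trans us st) mulr1.
Qed.

(** The product of the process at two times is [G1 * G2] on pairs of times and outcomes. Each factor
    carries an indicator of the time it does not depend on, which makes it square integrable;
    Cauchy-Schwarz and Fubini then conclude. *)
Lemma trunc_pair_integrable : (leb \x leb)%E.-integrable setT
  (EFin \o (fun z => rr z.1 z.2)).
Proof.
pose G1 (z : (TR * TR) * T) := ft (z.1.1, z.2) * \1_(I0 t) z.1.2.
pose G2 (z : (TR * TR) * T) := ft (z.1.2, z.2) * \1_(I0 t) z.1.1.
have mft : measurable_fun setT ft by case: sphi.
have m1 : measurable_fun setT G1.
  apply: measurable_funM.
    apply: (measurableT_comp mft); apply: measurable_fun_pair => //.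
    by apply: measurableT_comp.
  apply: measurableT_comp; first exact: measurable_indic.
  by apply: measurableT_comp.
have m2 : measurable_fun setT G2.
  apply: measurable_funM.
    apply: (measurableT_comp mft); apply: measurable_fun_pair => //.
    by apply: measurableT_comp.
  apply: measurableT_comp; first exact: measurable_indic.
  by apply: measurableT_comp.
pose A s := (\int[Pr]_w ((ft (s, w)) ^+ 2)%:E)%E.
pose B (s : TR) : \bar R := (\1_(I0 t) s)%:E.
have mft2 : measurable_fun setT (fun z => ((ft z) ^+ 2)%:E).
  by apply/measurable_EFinP/measurable_funX.
have ft20 z : (0 <= ((ft z) ^+ 2)%:E)%E by rewrite lee_fin sqr_ge0.
have mA : measurable_fun setT A.
  by apply: (measurable_fun_fubini_tonelli_F (fun z => ((ft z) ^+ 2)%:E)).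
have A0 s : (0 <= A s)%E by apply: integral_ge0.
have mB : measurable_fun setT B by apply/measurable_EFinP; exact: measurable_indic.
have B0 s : (0 <= B s)%E by rewrite lee_fin.
have Aoo : (\int[leb]_s A s < +oo)%E.
  rewrite /A -(fubini_tonelli1 (fun z => ((ft z) ^+ 2)%:E))//.
  by case: sphi.
have BE : (\int[leb]_s B s = t%:E)%E.
  by rewrite /B integral_indic// setIT; exact: lebesgue_measure_I0.
have ind2 (x : R) : (\1_(I0 t) x) ^+ 2 = \1_(I0 t) x :> R.
  by rewrite indicE; case: (_ \in _); rewrite ?expr1n ?expr0n.
pose mm : SigmaFiniteMeasure.type _ R := HB.pack (leb \x leb)%E
  (Measure_isSigmaFinite.Build _ _ _ (leb \x leb)%E (lebesgue_square_sigma_finite R)).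
have s1 : sqint (mm \x Pr)%E G1.
  apply: sqint_product => //.
  rewrite (eq_integral (fun z : TR * TR => (A z.1 * B z.2)%E)).
    rewrite ge0_integral_prod// BE lte_mul_pinfty// ?ltry// ?integral_ge0//.
    by rewrite ge0_fin_numE// integral_ge0.
  move=> z _; rewrite /A -ge0_integralZr//.
    by apply: eq_integral => w _; rewrite /G1/= exprMn ind2 EFinM.
  by apply: (measurableT_comp mft2); exact: measurable_fun_pair.
have s2 : sqint (mm \x Pr)%E G2.
  apply: sqint_product => //.
  rewrite (eq_integral (fun z : TR * TR => (B z.1 * A z.2)%E)).
    by rewrite ge0_integral_prod// BE lte_mul_pinfty.
  move=> z _; rewrite /A muleC -ge0_integralZr//.
    by apply: eq_integral => w _; rewrite /G2/= exprMn ind2 EFinM.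
  by apply: (measurableT_comp mft2); exact: measurable_fun_pair.
have [+ _] := Rintegral_fubini1 (sqint_mul s1 s2).
apply: eq_integrable => // -[s u] _ /=; congr EFin.
apply: eq_Rintegral => w _; rewrite /G1 /G2 /fs /ft /trunc/= !indicE.
by do 2 case: (_ \in _); rewrite ?mulr1 ?mulr0 ?mul0r.
Qed.

End FixedHorizon.

Section Moment.
Variable t : R.
Hypothesis t0 : 0 <= t.
Hypothesis sphi : sqint pm (trunc t phi).
Hypothesis sphis : forall s, 0 <= s -> sqint Pr (phi s).

Let fs s w := trunc t phi (s, w).
Let rr s u := ip Pr (fs s) (fs u).
Let sfs s : sqint Pr (fs s) := trunc_sqint_slice t sphis s.

Let irr := trunc_pair_integrable t0 sphi.

Let fsE s : 0 <= s -> s <= t -> fs s = phi s.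
Proof.
move=> s0 st; apply/funext => w.
by rewrite /fs /trunc/= indicE mem_setE in_itv/= s0 st mulr1.
Qed.

Let fs0 s : ~~ ((0 <= s) && (s <= t)) -> fs s = fun=> 0.
Proof.
move=> h; apply/funext => w.
by rewrite /fs /trunc/= indicE mem_setE in_itv/= (negbTE h) mulr0.
Qed.

Lemma drift_slice s : 0 <= s -> s <= t ->
  ip Pr (phi s) (drift s) = \int[leb]_u (rr s u * ((u : R) <= s)%R%:R).
Proof.
move=> s0 st; have sps := sphis s0.
rewrite (drift_ip s0 (trunc_sqint_le st sphi) sps).
rewrite (ip_tens_trunc sphi sphis s0 st sps).
by apply: eq_Rintegral => u _; rewrite /rr (fsE s0 st).
Qed.

Lemma drift_energy : ip Pr (drift t) (drift t) =
  2 * \int[leb]_s (\int[leb]_u (rr s u * ((u : R) <= s)%R%:R)).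
Proof.
have sD := drift_sqint t0 sphi.
rewrite -(Rintegral_triangle irr) => [|s u]; last exact: ipC.
rewrite (drift_ip t0 sphi sD) (ip_tens_trunc sphi sphis)//.
apply: eq_Rintegral => s _.
have -> : \int[leb]_u rr s u = \int[leb]_u (rr s u * ((u : R) <= t)%R%:R).
  apply: eq_Rintegral => u _; have [_|tu] := leP u t; first by rewrite mulr1.
  by rewrite mulr0 /rr [fs u]fs0 1?ipC ?ip0l// negb_and -!ltNge tu orbT.
rewrite -(ip_tens_trunc sphi sphis)// -(drift_ip t0 sphi)// ipC.
have [_|ts] := leP s t; first by rewrite mulr1.
by rewrite mulr0 [fs s]fs0 ?ip0l// negb_and -!ltNge ts orbT.
Qed.

Variables (M y : R -> T -> R) (y0 : R).
Hypothesis sM : forall s, 0 <= s -> sqint Pr (M s).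
Hypothesis hM : forall s, 0 <= s -> s <= t -> ip Pr (phi s) (M t) = ip Pr (phi s) (M s).
Hypothesis M_mean : ip Pr (fun=> 1) (M t) = 0.
Hypothesis my : forall s, 0 <= s -> measurable_fun setT (y s).
Hypothesis hy : forall s, 0 <= s -> s <= t ->
  {ae Pr, forall w, y s w = y0 + drift s w + M s w}.
Hypothesis sy : sqint pm (trunc t y).

Let ip_cst (r : R) : ip Pr (fun=> r) (fun=> r) = r ^+ 2.
Proof.
rewrite /ip /Rintegral integral_cst//=.
by rewrite probability_setT mule1 expr2.
Qed.

Local Opaque drift ip sqint.

(* The square of the drift is twice the integral over the triangle s <= u, and
   the martingale property replaces M(t) by M(s) in the cross term; the two add
   up to twice the pairing of the drift rate with y itself. *)
Lemma semimartingale_energy : ip Pr (y t) (y t) =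
  y0 ^+ 2 + ip Pr (M t) (M t) + 2 * ip pm (trunc t phi) (trunc t y).
Proof.
have s1 := sqint_cst Pr 1.
have sc r : sqint Pr (fun=> r : R) := sqint_cst Pr r.
have sMt := sM t0.
have sD := drift_sqint t0 sphi.
have sZ : sqint Pr (fun w => y0 + M t w) by exact: sqintD.
have rhs s : 0 <= s -> s <= t -> sqint Pr (fun w => y0 + drift s w + M s w).
  move=> s0 st; apply: (sqintD _ (sM s0)).
  exact: (sqintD (sc y0) (drift_sqint s0 (trunc_sqint_le st sphi))).
have eyt : ip Pr (y t) (y t) = ip Pr (fun w => y0 + drift t w + M t w)
    (fun w => y0 + drift t w + M t w).
  have sr := rhs _ t0 (lexx t).
  rewrite (ip_aeE (my t0) (sqint_measurable sr) (my t0) (hy t0 (lexx t))) ipC.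
  exact: (ip_aeE (my t0) (sqint_measurable sr) (sqint_measurable sr) (hy t0 (lexx t))).
have e1 : ip pm (trunc t phi) (trunc t y) =
    \int[leb]_s (ip Pr (fs s) (fun w => y0 + M t w) +
      \int[leb]_u (rr s u * ((u : R) <= s)%R%:R)).
  transitivity (\int[leb]_s (ip Pr (fs s) (fun w => trunc t y (s, w)))).
    exact/esym/(Rintegral_fubini1 (sqint_mul sphi sy)).2.
  apply: eq_Rintegral => s _.
  have [/andP[s0 st]|ns] := boolP ((0 <= s) && (s <= t)); last first.
    rewrite fs0// !ip0l add0r.
    rewrite /Rintegral; under eq_integral do rewrite /rr fs0// ip0l mul0r.
    by rewrite integral0.
  rewrite -(drift_slice s0 st) (fsE s0 st).
  rewrite (_ : (fun w => trunc t y (s, w)) = y s); last first.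
    by apply/funext => w; rewrite /trunc/= indicE mem_setE in_itv/= s0 st mulr1.
  have sr := rhs _ s0 st.
  have sDs : sqint Pr (drift s).
    exact: (drift_sqint s0 (trunc_sqint_le st sphi)).
  have sp := sphis s0.
  rewrite ipC (ip_aeE (my s0) (sqint_measurable sr) (sqint_measurable sp) (hy s0 st)).
  rewrite ipC (ipDr (sqintD (sc y0) sDs) (sM s0) sp) (ipDr (sc y0) sDs sp).
  rewrite (ipDr (sc y0) sMt sp) (hM s0 st); ring.
have e2 : \int[leb]_s ip Pr (fs s) (fun w => y0 + M t w) =
    ip Pr (fun w => y0 + M t w) (drift t).
  rewrite (drift_ip t0 sphi sZ) (ip_tens_trunc sphi sphis)//.
  apply: eq_Rintegral => s _; rewrite ipC.
  have [_|ts] := leP s t; first by rewrite mulr1.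
  by rewrite mulr0 ipC fs0 ?ip0l// negb_and -!ltNge ts orbT.
have i1 : leb.-integrable setT
    (fun s => (ip Pr (fs s) (fun w => y0 + M t w))%:E).
  have [+ _] := Rintegral_fubini1 (sqint_mul (tens_trunc_sqint t0 sZ) sphi).
  apply: eq_integrable => // s _; congr EFin.
  by rewrite ipC; apply: eq_Rintegral => w _; rewrite tens_mul_trunc.
have i2 : leb.-integrable setT
    (fun s => (\int[leb]_u (rr s u * ((u : R) <= s)%R%:R))%:E).
  have mle : measurable_fun setT (fun z : TR * TR => ((z.2 : R) <= z.1)%R).
    by apply: measurable_fun_ler; [exact: measurable_snd|exact: measurable_fst].
  exact: (Rintegral_fubini1 (integrable_bool mle irr)).1.
rewrite eyt e1 RintegralD// e2 mulrDr -drift_energy.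
have sDy : sqint Pr (fun w => y0 + drift t w) by exact: sqintD.
rewrite ipDl//; [|exact: sqintD].
rewrite !ipDr// !ipDl// ?ipDl//; try exact: sqintD.
rewrite (ipC _ (M t) (fun=> y0)) (ipC _ (drift t) (fun=> y0)) (ipC _ (drift t) (M t)).
have -> : ip Pr (fun=> y0) (M t) = 0.
  rewrite (_ : (fun=> y0) = fun w : T => y0 * 1); last first.
    by apply/funext => w; rewrite mulr1.
  by rewrite ipZl// M_mean mulr0.
have -> : ip Pr (fun=> y0) (fun=> y0) = y0 ^+ 2.
  exact: ip_cst.
ring.
Qed.

End Moment.
End Drift.

(** * Second moments of solutions *)

Section Processes.
Context (R : realType) (d : measure_display) (T : measurableType d).
Variable Pr : probability T R.
Local Notation leb := (@lebesgue_measure R).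
Local Notation pm := (leb \x Pr)%E.
Local Notation TR := (measurableTypeR R).

Lemma cut_integral (D : set TR) (v : R -> T -> R) : measurable D ->
  measurable_fun setT (fun z : TR * T => v z.1 z.2 * \1_D z.1) ->
  (forall s w, 0 <= v s w) ->
  (\int[Pr]_w \int[leb]_(s in D) (v s w)%:E)%E =
  (\int[pm]_z (v z.1 z.2 * \1_D z.1)%:E)%E.
Proof.
move=> mD mv v0; rewrite (fubini_tonelli2 (fun z : TR * T => (v z.1 z.2 * \1_D z.1)%:E)).
- apply: eq_integral => w _; rewrite /fubini_G [LHS]integral_mkcond.
  apply: eq_integral => s _; rewrite /= patchE indicE.
  by case: ifP; rewrite ?mulr1 ?mulr0.
- exact/measurable_EFinP.
- by move=> z; rewrite lee_fin mulr_ge0.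
Qed.

(** Joint measurability is known for nonnegative times only; multiplying by the indicator of a set
    of such times extends it to the whole product. *)
Lemma cut_measurable (D : set R) (v : R -> T -> R) : measurable D ->
  D `<=` `[0, +oo[%classic ->
  measurable_fun (`[0, +oo[%classic `*` setT : set (R * T))
    (fun z : R * T => v z.1 z.2) ->
  measurable_fun setT (fun z : TR * T => v z.1 z.2 * \1_D z.1).
Proof.
move=> mD D0 mv.
have mI : measurable (`[0, +oo[%classic `*` setT : set (R * T)).
  by apply: measurableX => //; exact: measurable_itv.
have m1 : measurable_fun setT ((fun z : R * T => v z.1 z.2) \_
    (`[0, +oo[%classic `*` setT)).
  by apply/(measurable_restrictT _ mI).
have m2 : measurable_fun setT (fun z : R * T => ((fun z : R * T => v z.1 z.2) \_
    (`[0, +oo[%classic `*` setT)) z * \1_D z.1).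
  apply: measurable_funM => //.
  by apply: measurableT_comp => //; exact: measurable_indic.
move: m2; congr measurable_fun; apply/funext => z; rewrite patchE.
case: ifPn => // zI; rewrite mul0r indicE memNset ?mulr0// => Dz.
by move: zI; rewrite notin_setE; apply; split=> //; exact: D0.
Qed.

Variables (n : nat) (F : R -> set (set T)) (x : R -> T -> 'cV[R]_n).

Let I0_sub t : (`[0, t]%classic : set R) `<=` `[0, +oo[%classic.
Proof. by move=> s /=; rewrite !in_itv/= => /andP[->]. Qed.

Lemma trunc_measurable t k : jointly_measurable x ->
  measurable_fun setT (trunc t (fun s w => x s w k 0)).
Proof. by move=> jx; apply: cut_measurable. Qed.

Lemma sqnorm_ge0 (v : 'cV[R]_n) : 0 <= sqnorm v.
Proof. by apply: sumr_ge0 => i _; exact: sqr_ge0. Qed.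

Lemma sqnorm_cut_measurable (D : set R) : measurable D ->
  D `<=` `[0, +oo[%classic -> jointly_measurable x ->
  measurable_fun setT (fun z : TR * T => sqnorm (x z.1 z.2) * \1_D z.1).
Proof.
move=> mD D0 jx; apply: (cut_measurable (v := fun s w => sqnorm (x s w))) => //.
by rewrite /sqnorm; apply: measurable_sum => i; exact: measurable_funX.
Qed.

Lemma le_sqnorm (v : 'cV[R]_n) k : v k 0 ^+ 2 <= sqnorm v.
Proof.
rewrite /sqnorm (bigD1 k)//= lerDl; apply: sumr_ge0 => i _; exact: sqr_ge0.
Qed.

(** Used with [D] equal to [[0, t]] for locally square-integrable processes and to the half-line for
    global ones. In the second case the bound is independent of [t]. *)
Lemma trunc_energy_le (D : set R) t k : measurable D -> `[0, t]%classic `<=` D ->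
  D `<=` `[0, +oo[%classic -> jointly_measurable x ->
  (\int[Pr]_w \int[leb]_(s in D) (sqnorm (x s w))%:E < +oo)%E ->
  sqint pm (trunc t (fun s w => x s w k 0)) /\
  ((ip pm (trunc t (fun s w => x s w k 0)) (trunc t (fun s w => x s w k 0)))%:E
    <= \int[Pr]_w \int[leb]_(s in D) (sqnorm (x s w))%:E)%E.
Proof.
move=> mD tD D0 jx h.
have mt := trunc_measurable t k jx.
have mc := sqnorm_cut_measurable mD D0 jx.
have le : (\int[pm]_z ((trunc t (fun s w => x s w k 0) z) ^+ 2)%:E <=
    \int[Pr]_w \int[leb]_(s in D) (sqnorm (x s w))%:E)%E.
  rewrite (cut_integral mD mc); last by move=> s w; exact: sqnorm_ge0.
  apply: ge0_le_integral => //.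
  - by move=> z _; rewrite lee_fin sqr_ge0.
  - by apply/measurable_EFinP/measurable_funX.
  - exact/measurable_EFinP.
  move=> z _; rewrite lee_fin /trunc exprMn !indicE.
  case: (boolP (z.1 \in `[0, t]%classic)) => zt; last first.
    by rewrite expr0n mulr0 mulr_ge0 ?sqnorm_ge0.
  rewrite (mem_set (tD _ (set_mem zt))) expr1n !mulr1.
  exact: le_sqnorm.
have st : sqint pm (trunc t (fun s w => x s w k 0)).
  by split=> //; exact: le_lt_trans h.
by split=> //; rewrite -ipEsqr.
Qed.

Lemma L2loc_trunc t k : 0 <= t -> L2loc_process Pr F x ->
  sqint pm (trunc t (fun s w => x s w k 0)).
Proof.
by move=> t0 [_ jx /(_ t t0) h]; have [] := @trunc_energy_le `[0, t]%classic t k.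
Qed.

Lemma L2_trunc t k : L2_process Pr F x ->
  sqint pm (trunc t (fun s w => x s w k 0)).
Proof.
by move=> [_ jx h]; have [] := @trunc_energy_le `[0, +oo[%classic t k.
Qed.

Lemma L2_trunc_bounded : L2_process Pr F x -> exists c : R, forall t k,
  ip pm (trunc t (fun s w => x s w k 0)) (trunc t (fun s w => x s w k 0)) <= c.
Proof.
move=> [_ jx h]; exists (fine (\int[Pr]_w \int[leb]_(s in `[0%R, +oo[)
   (sqnorm (x s w))%:E)%E) => t k.
rewrite -lee_fin [leRHS]fineK.
  by have [] := @trunc_energy_le `[0, +oo[%classic t k.
rewrite ge0_fin_numE//; apply: integral_ge0 => w _; apply: integral_ge0 => s _.
by rewrite lee_fin sqnorm_ge0.
Qed.

Hypothesis hF : usual_filtration Pr F.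

Lemma adapted_measurable t k : 0 <= t -> adapted F x ->
  measurable_fun setT (fun w => x t w k 0).
Proof. by move=> t0 /(_ t t0 k); exact: (sub_measurable_measurable hF t0). Qed.

End Processes.

Section SDE.
Context (R : realType) (d : measure_display) (T : measurableType d).
Variables (Pr : probability T R) (F : R -> set (set T)).
Hypothesis hF : usual_filtration Pr F.
Variables (q : nat) (K : 'M[R]_q) (W : R -> T -> 'cV[R]_q).
Hypothesis hW : wiener_process Pr F K W.
Variables (n m : nat) (A : 'M[R]_n) (N : 'I_q -> 'M[R]_n) (B : 'M[R]_(n, m)).
Variables (u : R -> T -> 'cV[R]_m) (x0 : 'cV[R]_n) (x : R -> T -> 'cV[R]_n).
Hypothesis hu : forall t k, 0 <= t -> sqint (@lebesgue_measure R \x Pr)%E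
  (trunc t (fun s w => u s w k 0)).
Hypothesis hx : sde_solution Pr F W A N (fun s w => B *m u s w) x0 x.

Local Notation leb := (@lebesgue_measure R).
Local Notation pm := (leb \x Pr)%E.
Local Notation TR := (measurableTypeR R).

Let hxt t k : 0 <= t -> sqint pm (trunc t (fun s w => x s w k 0)).
Proof. by move=> t0; case: hx => + _; exact: L2loc_trunc. Qed.

Definition lin p (y : R -> T -> 'cV[R]_p) (a : 'rV[R]_p) s w : R := (a *m y s w) 0 0.

Lemma linE p (y : R -> T -> 'cV[R]_p) (a : 'rV[R]_p) s w :
  lin y a s w = \sum_k a 0 k * y s w k 0.
Proof. by rewrite /lin mxE. Qed.

Lemma trunc_linE p (y : R -> T -> 'cV[R]_p) (a : 'rV[R]_p) t :
  trunc t (lin y a) = fun z => \sum_k a 0 k * trunc t (fun s w => y s w k 0) z.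
Proof.
apply/funext => z; rewrite /trunc linE mulr_suml.
by apply: eq_bigr => k _; rewrite mulrA.
Qed.

Lemma lin_sqint t (a : 'rV[R]_n) : 0 <= t -> sqint pm (trunc t (lin x a)).
Proof.
move=> t0; rewrite trunc_linE; apply: sqint_sum => k; apply: sqintZ.
exact: hxt.
Qed.

(** Linearity holds at the outcomes where every section is integrable, hence almost surely, since
    the index type is finite. *)
Lemma drift_sum (I : finType) (c : I -> R) (phi : I -> R -> T -> R) t : 0 <= t ->
  (forall i, sqint pm (trunc t (phi i))) ->
  {ae Pr, forall w, drift (fun s w => \sum_i c i * phi i s w) t w =
     \sum_i c i * drift (phi i) t w}.
Proof.
move=> t0 sphi.
have H : {ae Pr, forall w, forall i, sqint leb (fun s => trunc t (phi i) (s, w))}.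
  by apply: filter_forall => i; exact: (sqint_section (sphi i)).
apply: filterS H => w H.
have s1 := indic_sqint t0.
have dE psi : drift psi t w =
    ip leb (fun s => trunc t psi (s, w)) (\1_(`[0, t]%classic : set R)).
  apply: eq_Rintegral => s _; rewrite /trunc/= indicE.
  by case: (_ \in _); rewrite ?mulr1 ?mulr0.
rewrite dE (_ : (fun s => _) =
   (fun s => \sum_i c i * trunc t (phi i) (s, w))); last first.
  apply/funext => s; rewrite /trunc/= mulr_suml.
  by apply: eq_bigr => i _; rewrite mulrA.
rewrite ip_suml//; last by move=> i; exact: sqintZ.
by apply: eq_bigr => i _; rewrite ipZl// dE.
Qed.

Section LinearForm.
Variable I : 'I_q -> R -> T -> 'cV[R]_n.
Hypothesis hI : forall i t k, 0 <= t ->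
  is_ito_integral Pr F (fun s w => W s w i 0) (fun s w => (N i *m x s w) k 0)
                       t (fun w => I i t w k 0).
Hypothesis hxI : forall t, 0 <= t -> {ae Pr, forall w,
       x t w = x0
         + \col_k \int[leb]_(s in `[0, t]) ((A *m x s w + B *m u s w) k 0)
         + \sum_i I i t w}.

Let NxE i k : (fun s w => (N i *m x s w) k 0) = lin x (row k (N i)).
Proof.
by apply/funext => s; apply/funext => w; rewrite /lin -row_mul [RHS]mxE.
Qed.

Let sN i k t : 0 <= t -> sqint pm (trunc t (fun s w => (N i *m x s w) k 0)).
Proof. by move=> t0; rewrite NxE; exact: lin_sqint. Qed.

Let sI i k t : 0 <= t -> sqint Pr (fun w => I i t w k 0).
Proof. by move=> t0; exact: (ito_sqint hF hW t0 (sN i k t0) (hI i k t0)). Qed.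

Variable g : 'rV[R]_n.

Definition mart t w : R := \sum_i (g *m I i t w) 0 0.

Let martE t : mart t = fun w => \sum_i \sum_k g 0 k * I i t w k 0.
Proof. by apply/funext => w; apply: eq_bigr => i _; rewrite mxE. Qed.

Let mart_sqint t : 0 <= t -> sqint Pr (mart t).
Proof.
move=> t0; rewrite martE; apply: sqint_sum => i; apply: sqint_sum => k.
by apply: sqintZ; exact: sI.
Qed.

Let mart_martingale s t xi : 0 <= s -> s <= t -> sub_measurable (F s) xi ->
  sqint Pr xi -> ip Pr xi (mart t) = ip Pr xi (mart s).
Proof.
move=> s0 st mxi sxi; have t0 := le_trans s0 st.
rewrite !martE !ip_sumr//; try by move=> i; apply: sqint_sum => k; apply: sqintZ; exact: sI.
apply: eq_bigr => i _.
rewrite !ip_sumr//; try by move=> k; apply: sqintZ; exact: sI.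
apply: eq_bigr => k _; rewrite !ipZr//; try exact: sI.
by rewrite (ito_martingale hF hW s0 st mxi sxi (sN i k t0) (hI i k t0) (hI i k s0)).
Qed.

Let mart_mean t : 0 <= t -> ip Pr (fun=> 1) (mart t) = 0.
Proof.
move=> t0; have s1 := sqint_cst Pr 1.
rewrite martE ip_sumr//; last by move=> i; apply: sqint_sum => k; apply: sqintZ; exact: sI.
rewrite big1// => i _.
rewrite ip_sumr//; last by move=> k; apply: sqintZ; exact: sI.
rewrite big1// => k _; rewrite ipZr//; last exact: sI.
by rewrite (ito_mean hF hW t0 (sN i k t0) (hI i k t0)) mulr0.
Qed.

Let mart_energy t : 0 <= t -> ip Pr (mart t) (mart t) =
  \sum_i \sum_j K i j * ip pm (trunc t (lin x (g *m N i))) (trunc t (lin x (g *m N j))).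
Proof.
move=> t0.
have s1 i : sqint Pr (fun w => \sum_k g 0 k * I i t w k 0).
  by apply: sqint_sum => k; apply: sqintZ; exact: sI.
have s2 i k : sqint Pr (fun w => g 0 k * I i t w k 0) by apply: sqintZ; exact: sI.
have tE i : trunc t (lin x (g *m N i)) =
    fun z => \sum_k g 0 k * trunc t (fun s w => (N i *m x s w) k 0) z.
  apply/funext => z; rewrite /trunc/lin -mulmxA mxE mulr_suml.
  by apply: eq_bigr => k _; rewrite mulrA.
have s3 i k : sqint pm (fun z => g 0 k * trunc t (fun s w => (N i *m x s w) k 0) z).
  by apply: sqintZ; exact: sN.
have s4 i : sqint pm (fun z => \sum_k g 0 k * trunc t (fun s w => (N i *m x s w) k 0) z).
  exact: sqint_sum.
rewrite martE ip_suml//; last exact: sqint_sum.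
apply: eq_bigr => i _; rewrite ip_sumr//; apply: eq_bigr => j _.
rewrite !tE !ip_suml// mulr_sumr; apply: eq_bigr => k _.
rewrite !ip_sumr// mulr_sumr; apply: eq_bigr => l _.
rewrite !ipZl// ?ipZr//; try exact: sI; try exact: sN.
rewrite (ito_cov hF hW t0 (sN i k t0) (sN j l t0) (hI i k t0) (hI j l t0)).
ring.
Qed.

Let phic k s w : R := (A *m x s w + B *m u s w) k 0.

Let phic_sqint k t : 0 <= t -> sqint pm (trunc t (phic k)).
Proof.
move=> t0.
have -> : trunc t (phic k) = fun z => trunc t (lin x (row k A)) z +
    trunc t (lin u (row k B)) z.
  apply/funext => z; rewrite /trunc -mulrDl; congr (_ * _).
  by rewrite /phic /lin mxE -!row_mul; congr (_ + _); rewrite [RHS]mxE.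
apply: sqintD; first exact: lin_sqint.
by rewrite trunc_linE; apply: sqint_sum => l; apply: sqintZ; exact: hu.
Qed.

Let adaptx : adapted F x. Proof. by case: hx => -[]. Qed.

(** A solution is assumed square integrable over time and outcomes jointly. At each fixed time the
    property comes from the equation, whose drift and Ito terms have it. *)
Lemma state_sqint t k : 0 <= t -> sqint Pr (fun w => x t w k 0).
Proof.
move=> t0.
have sr : sqint Pr (fun w => x0 k 0 + drift (phic k) t w + \sum_i I i t w k 0).
  apply: sqintD; last by apply: sqint_sum => i; exact: sI.
  apply: sqintD; first exact: sqint_cst.
  exact: (drift_sqint t0 (phic_sqint k t0)).
apply: (sqint_ae _ sr); first exact: (adapted_measurable hF k t0 adaptx).
apply: filterS (hxI t0) => w ->.
by rewrite !mxE summxE driftE.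
Qed.

Let lin_state_sqint t (a : 'rV[R]_n) : 0 <= t -> sqint Pr (lin x a t).
Proof.
move=> t0; rewrite (_ : lin x a t = fun w => \sum_k a 0 k * x t w k 0).
  by apply: sqint_sum => k; apply: sqintZ; exact: state_sqint.
by apply/funext => w; rewrite linE.
Qed.

Let lin_adapted t (a : 'rV[R]_n) : 0 <= t -> sub_measurable (F t) (lin x a t).
Proof.
move=> t0; rewrite (_ : lin x a t = fun w => \sum_k a 0 k * x t w k 0).
  apply: (sub_measurable_sum hF) => // k; apply: (sub_measurableM hF) => //.
    exact: (sub_measurable_cst hF).
  exact: adaptx.
by apply/funext => w; rewrite linE.
Qed.

Hypothesis gB : g *m B = 0.

(** Since [g *m B = 0], the control drops out of the drift of [g x], and the energy identity closes
    in the state alone. *)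
Lemma lin_energy t : 0 <= t -> ip Pr (lin x g t) (lin x g t) =
  ((g *m x0) 0 0) ^+ 2 +
  (2 * ip pm (trunc t (lin x (g *m A))) (trunc t (lin x g)) +
  \sum_i \sum_j K i j * ip pm (trunc t (lin x (g *m N i))) (trunc t (lin x (g *m N j)))).
Proof.
move=> t0; rewrite -mart_energy// [X in _ + X]addrC addrA.
apply: (@semimartingale_energy _ _ _ Pr (lin x (g *m A)) t t0 _ _ mart (lin x g)).
- exact: lin_sqint.
- by move=> s s0; exact: lin_state_sqint.
- by move=> s s0; exact: mart_sqint.
- move=> s s0 st; apply: mart_martingale => //; first exact: lin_adapted.
  exact: lin_state_sqint.
- exact: mart_mean.
- by move=> s s0; case: (lin_state_sqint g s0).
- move=> s s0 st.
  have D := drift_sum (g 0) s0 (fun k => phic_sqint k s0).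
  apply: filterS2 (hxI s0) D => w xE DE.
  have <- : (fun s w => \sum_i g 0 i * phic i s w) = lin x (g *m A).
    apply/funext => s'; apply/funext => w'.
    have -> : lin x (g *m A) s' w' = (g *m (A *m x s' w' + B *m u s' w')) 0 0.
      by rewrite mulmxDr !mulmxA gB mul0mx addr0.
    by rewrite [RHS]mxE.
  rewrite DE /lin xE !mulmxDr mxE [in LHS]mxE; congr (_ + _ + _).
    by rewrite mxE; apply: eq_bigr => k _; rewrite mxE driftE.
  by rewrite mulmx_sumr summxE.
- exact: lin_sqint.
Qed.

End LinearForm.

Lemma solution_sqint t k : 0 <= t -> sqint Pr (fun w => x t w k 0).
Proof. by case: hx => _ [I [hI hxI]]; exact: (state_sqint hI hxI). Qed.

Lemma solution_trunc_sqint t k : 0 <= t ->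
  sqint pm (trunc t (fun s w => x s w k 0)).
Proof. exact: hxt. Qed.

Lemma solution_lin_energy (g : 'rV[R]_n) t : g *m B = 0 -> 0 <= t ->
  ip Pr (lin x g t) (lin x g t) = ((g *m x0) 0 0) ^+ 2 +
  (2 * ip pm (trunc t (lin x (g *m A))) (trunc t (lin x g)) +
  \sum_i \sum_j K i j *
    ip pm (trunc t (lin x (g *m N i))) (trunc t (lin x (g *m N j)))).
Proof. by case: hx => _ [I [hI hxI]] gB t0; exact: (lin_energy hI hxI). Qed.

End SDE.

Section MomentMatrices.
Context (R : realType) (d : measure_display) (T : measurableType d).
Variable Pr : probability T R.
Variables (n : nat) (x : R -> T -> 'cV[R]_n).
Local Notation leb := (@lebesgue_measure R).
Local Notation pm := (leb \x Pr)%E.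
Local Notation TR := (measurableTypeR R).

Definition second_moment t : 'M[R]_n :=
  \matrix_(k, l) ip Pr (fun w => x t w k 0) (fun w => x t w l 0).

(** Taken on the product space, so that its quadratic form is a squared norm; [integrated_momentE]
    relates it to the time integral of [second_moment]. *)
Definition integrated_moment t : 'M[R]_n :=
  \matrix_(k, l) ip pm (trunc t (fun s w => x s w k 0))
                       (trunc t (fun s w => x s w l 0)).

Hypothesis hs : forall t k, 0 <= t -> sqint Pr (fun w => x t w k 0).
Hypothesis ht : forall t k, 0 <= t -> sqint pm (trunc t (fun s w => x s w k 0)).

Lemma second_moment_sym t : (second_moment t)^T = second_moment t.
Proof. by apply/matrixP => i j; rewrite !mxE ipC. Qed.

Lemma integrated_moment_sym t : (integrated_moment t)^T = integrated_moment t.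
Proof. by apply/matrixP => i j; rewrite !mxE ipC. Qed.

Lemma ip_linE t (a b : 'rV[R]_n) : 0 <= t ->
  ip Pr (lin x a t) (lin x b t) = (a *m second_moment t *m b^T) 0 0.
Proof.
move=> t0; have lE c : lin x c t = fun w => \sum_k c 0 k * x t w k 0.
  by apply/funext => w; rewrite linE.
have sc c k : sqint Pr (fun w => c * x t w k 0) by apply: sqintZ; exact: hs.
rewrite !lE ip_sumr//; last exact: sqint_sum.
rewrite mxE; apply: eq_bigr => l _; rewrite ip_suml// !mxE mulr_suml.
apply: eq_bigr => k _; rewrite !mxE ipZl ?ipZr//; try exact: hs.
ring.
Qed.

Lemma ip_trunc_linE t (a b : 'rV[R]_n) : 0 <= t ->
  ip pm (trunc t (lin x a)) (trunc t (lin x b)) =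
  (a *m integrated_moment t *m b^T) 0 0.
Proof.
move=> t0; rewrite !trunc_linE.
have sc c k : sqint pm (fun z => c * trunc t (fun s w => x s w k 0) z).
  by apply: sqintZ; exact: ht.
rewrite ip_sumr//; last exact: sqint_sum.
rewrite mxE; apply: eq_bigr => l _; rewrite ip_suml// !mxE mulr_suml.
apply: eq_bigr => k _; rewrite !mxE ipZl ?ipZr//; try exact: ht.
ring.
Qed.

Lemma trunc_lin_sqint t (a : 'rV[R]_n) : 0 <= t -> sqint pm (trunc t (lin x a)).
Proof.
by move=> t0; rewrite trunc_linE; apply: sqint_sum => k; apply: sqintZ; exact: ht.
Qed.

Lemma integrated_momentE t (a : 'rV[R]_n) : 0 <= t ->
  leb.-integrable setT (fun s => ((a *m second_moment s *m a^T) 0 0 *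
    \1_(`[0, t]%classic : set R) s)%:E) /\
  (a *m integrated_moment t *m a^T) 0 0 =
  \int[leb]_s ((a *m second_moment s *m a^T) 0 0 *
    \1_(`[0, t]%classic : set R) s).
Proof.
move=> t0; have st := trunc_lin_sqint a t0.
have [i1 e1] := Rintegral_fubini1 (sqint_mul st st).
have eI s : \int[Pr]_w (trunc t (lin x a) (s, w) * trunc t (lin x a) (s, w)) =
    (a *m second_moment s *m a^T) 0 0 * \1_(`[0, t]%classic : set R) s.
  rewrite /trunc/= indicE.
  have [s0|s0] := boolP (s \in `[0, t]%classic).
    rewrite mulr1 -ip_linE; last first.
      by move: s0; rewrite mem_setE in_itv/= => /andP[].
    by apply: eq_Rintegral => w _; rewrite !mulr1.
  rewrite mulr0 /Rintegral; under eq_integral do rewrite !mulr0.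
  by rewrite integral0.
split; first by apply: eq_integrable i1 => // s _; rewrite eI.
rewrite -ip_trunc_linE// /ip -e1; apply: eq_Rintegral => s _.
by rewrite eI.
Qed.

Lemma trace_rows p (G : 'M[R]_(p, n)) (Z : 'M[R]_n) :
  \tr (G *m Z *m G^T) = \sum_i (row i G *m Z *m (row i G)^T) 0 0.
Proof.
apply: eq_bigr => i _.
by rewrite tr_row -row_mul -row_mul !mxE; apply: eq_bigr => j _; rewrite !mxE.
Qed.

Lemma trace_integrated_moment p (G : 'M[R]_(p, n)) t : 0 <= t ->
  leb.-integrable setT (fun s => (\tr (G *m second_moment s *m G^T) *
    \1_(`[0, t]%classic : set R) s)%:E) /\
  \tr (G *m integrated_moment t *m G^T) =
  \int[leb]_s (\tr (G *m second_moment s *m G^T) *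
    \1_(`[0, t]%classic : set R) s).
Proof.
move=> t0; have H i := integrated_momentE (row i G) t0.
have fE (s : TR) : \tr (G *m second_moment s *m G^T) *
    \1_(`[0, t]%classic : set R) s = \sum_i ((row i G *m second_moment s *m
      (row i G)^T) 0 0 * \1_(`[0, t]%classic : set R) s).
  by rewrite trace_rows mulr_suml.
under eq_fun do rewrite fE.
rewrite (eq_Rintegral _ (fun s _ => fE s)) trace_rows.
rewrite (eq_bigr _ (fun i _ => (H i).2)).
elim: (index_enum 'I_p) => [|i r [IH1 IH2]].
  rewrite big_nil; split.
    by under eq_fun do rewrite big_nil; exact: integrable0.
  rewrite /Rintegral; under [in RHS]eq_integral do rewrite big_nil.
  by rewrite integral0.
rewrite big_cons; split.
  under eq_fun do rewrite big_cons.
  exact: (integrableD _ (H i).1 IH1).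
rewrite (eq_Rintegral _ (fun s _ => big_cons _ _ _ _ _ _))/=.
by rewrite RintegralD//; [rewrite IH2|exact: (H i).1].
Qed.

Let indic_cst t c : 0 <= t ->
  leb.-integrable setT (fun s => (c * \1_(`[0, t]%classic : set R) s)%:E) /\
  \int[leb]_s (c * \1_(`[0, t]%classic : set R) s) = c * t.
Proof.
move=> t0; have s1 := indic_sqint t0.
have i2 c' : leb.-integrable setT (fun s => (c' * \1_(`[0, t]%classic : set R) s)%:E).
  have := sqint_mul (sqintZ c' s1) s1.
  apply: eq_integrable => // s _; rewrite -mulrA indicE.
  by case: (_ \in _); rewrite ?mulr1 ?mulr0.
split=> //; rewrite RintegralZl//; last first.
  by have := i2 1; apply: eq_integrable => // s _; rewrite mul1r.
congr (_ * _); rewrite /Rintegral integral_indic// setIT [X in fine X](_ : _ = t%:E)//.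
exact: lebesgue_measure_I0.
Qed.

Lemma trace_integrated_moment_ge p (G : 'M[R]_(p, n)) t a : 0 <= t ->
  (forall s, 0 <= s -> s <= t -> a <= \tr (G *m second_moment s *m G^T)) ->
  a * t <= \tr (G *m integrated_moment t *m G^T).
Proof.
move=> t0 h; have [i1 ->] := trace_integrated_moment G t0.
have [i2 <-] := indic_cst a t0; apply: le_Rintegral => // s _.
rewrite indicE; have [s0|_] := boolP (s \in `[0, t]%classic); last by rewrite !mulr0.
by rewrite !mulr1; move: s0; rewrite mem_setE in_itv/= => /andP[/h]; apply.
Qed.

Lemma trace_integrated_moment_le p (G : 'M[R]_(p, n)) t b : 0 <= t ->
  (forall s, 0 <= s -> s <= t -> \tr (G *m second_moment s *m G^T) <= b) ->
  \tr (G *m integrated_moment t *m G^T) <= b * t.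
Proof.
move=> t0 h; have [i1 ->] := trace_integrated_moment G t0.
have [i2 <-] := indic_cst b t0; apply: le_Rintegral => // s _.
rewrite indicE; have [s0|_] := boolP (s \in `[0, t]%classic); last by rewrite !mulr0.
by rewrite !mulr1; move: s0; rewrite mem_setE in_itv/= => /andP[/h]; apply.
Qed.

Lemma integrated_moment_mono s t (a : 'rV[R]_n) : 0 <= s -> s <= t ->
  (a *m integrated_moment s *m a^T) 0 0 <= (a *m integrated_moment t *m a^T) 0 0.
Proof.
move=> s0 st; have t0 := le_trans s0 st; rewrite -!ip_trunc_linE//.
by apply: trunc_ip_le => //; exact: trunc_lin_sqint.
Qed.

(** The quadratic form vanishes at the rows of [C]; Cauchy-Schwarz against the coordinate
    functionals extends this to the whole product. *)
Lemma zero_output_integrated_moment p (C : 'M[R]_(p, n)) t : 0 <= t ->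
  zero_output Pr C x -> C *m integrated_moment t = 0.
Proof.
move=> t0 hC; have e i : (row i C *m integrated_moment t *m (row i C)^T) 0 0 = 0.
  rewrite (integrated_momentE _ t0).2.
  transitivity (\int[leb]_s (0 : R)); last first.
    by rewrite /Rintegral integral0.
  apply: eq_Rintegral => s _; rewrite indicE.
  have [s0|] := boolP (s \in `[0, t]%classic); last by rewrite mulr0.
  rewrite mulr1; have {}s0 : 0 <= s by move: s0; rewrite mem_setE in_itv/= => /andP[].
  rewrite -ip_linE//.
  have sl : sqint Pr (lin x (row i C) s).
    rewrite (_ : lin x (row i C) s = fun w => \sum_k row i C 0 k * x s w k 0).
      by apply: sqint_sum => k; apply: sqintZ; exact: hs.
    by apply/funext => w; rewrite linE.
  rewrite (ip_aeE (f' := fun=> 0)) ?ip0l//; try by case: sl.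
  apply: filterS (hC s s0) => w Cw.
  by rewrite /lin -row_mul Cw !mxE.
apply/row_matrixP => i; apply/rowP => l.
have sC := trunc_lin_sqint (row i C) t0.
have sl := trunc_lin_sqint (delta_mx 0 l) t0.
have := cauchy_schwarz sC sl.
rewrite !ip_trunc_linE// e mul0r trmx_delta -!colE -row_mul.
rewrite [in X in X ^+ 2]mxE => h.
rewrite [RHS]mxE [RHS]mxE; apply/eqP; rewrite -sqrf_eq0 eq_le sqr_ge0 andbT.
exact: h.
Qed.

End MomentMatrices.

Definition lyapunov_op (R : realType) n q (K : 'M[R]_q) (A : 'M[R]_n)
    (N : 'I_q -> 'M[R]_n) (Z : 'M[R]_n) : 'M[R]_n :=
  A *m Z + Z *m A^T + \sum_i \sum_j K i j *: (N i *m Z *m (N j)^T).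

Section MomentEquation.
Context (R : realType) (d : measure_display) (T : measurableType d).
Variables (Pr : probability T R) (F : R -> set (set T)).
Hypothesis hF : usual_filtration Pr F.
Variables (q : nat) (K : 'M[R]_q) (W : R -> T -> 'cV[R]_q).
Hypothesis hW : wiener_process Pr F K W.
Variables (n m : nat) (A : 'M[R]_n) (N : 'I_q -> 'M[R]_n) (B : 'M[R]_(n, m)).
Variables (u : R -> T -> 'cV[R]_m) (x0 : 'cV[R]_n) (x : R -> T -> 'cV[R]_n).
Hypothesis hu : forall t k, 0 <= t -> sqint (@lebesgue_measure R \x Pr)%E
  (trunc t (fun s w => u s w k 0)).
Hypothesis hx : sde_solution Pr F W A N (fun s w => B *m u s w) x0 x.

Lemma second_moment_equation (g : 'rV[R]_n) t : g *m B = 0 -> 0 <= t ->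
  (g *m second_moment Pr x t *m g^T) 0 0 =
  (g *m (x0 *m x0^T + lyapunov_op K A N (integrated_moment Pr x t)) *m g^T) 0 0.
Proof.
move=> gB t0.
have hs s k : 0 <= s -> sqint Pr (fun w => x s w k 0).
  exact: (solution_sqint hF hW hu hx).
have ht s k : 0 <= s -> sqint (@lebesgue_measure R \x Pr)%E
    (trunc s (fun s w => x s w k 0)).
  exact: (solution_trunc_sqint hx).
rewrite -ip_linE// (solution_lin_energy hF hW hu hx gB t0).
rewrite mulmxDr mulmxDl [RHS]mxE; congr (_ + _).
  have -> : g *m (x0 *m x0^T) *m g^T = (g *m x0) *m (g *m x0)^T.
    by rewrite trmx_mul !mulmxA.
  by rewrite [RHS]mxE big_ord1 [X in _ = _ * X]mxE expr2.
rewrite /lyapunov_op !mulmxDr !mulmxDl [RHS]mxE; congr (_ + _).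
  rewrite ip_trunc_linE// mulr_natl mulr2n [RHS]mxE; congr (_ + _).
    by rewrite !mulmxA.
  rewrite -[in RHS]integrated_moment_sym.
  set Y := integrated_moment _ _ _.
  have -> : g *m (Y^T *m A^T) *m g^T = (g *m A *m Y *m g^T)^T.
    by rewrite !trmx_mul trmxK !mulmxA.
  by rewrite [RHS]mxE.
rewrite mulmx_sumr mulmx_suml summxE; apply: eq_bigr => i _.
rewrite mulmx_sumr mulmx_suml summxE; apply: eq_bigr => j _.
rewrite ip_trunc_linE// -scalemxAr -scalemxAl [RHS]mxE.
by rewrite trmx_mul !mulmxA.
Qed.

End MomentEquation.

(** * Positive semidefinite solutions of the balanced equations *)

Section PositiveSemidefinite.
Context {R : realType}.

Lemma trace_sqr p n (Y : 'M[R]_(p, n)) :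
  \tr (Y *m Y^T) = \sum_i \sum_j Y i j ^+ 2.
Proof.
apply: eq_bigr => i _; rewrite mxE; apply: eq_bigr => j _.
by rewrite mxE expr2.
Qed.

Lemma trace_sqr_ge0 p n (Y : 'M[R]_(p, n)) : 0 <= \tr (Y *m Y^T).
Proof.
rewrite trace_sqr; apply: sumr_ge0 => i _; apply: sumr_ge0 => j _.
exact: sqr_ge0.
Qed.

Lemma trace_sqr_eq0 p n (Y : 'M[R]_(p, n)) : \tr (Y *m Y^T) = 0 -> Y = 0.
Proof.
rewrite trace_sqr => h; apply/matrixP => i j; rewrite mxE.
have r0 k : 0 <= \sum_j Y k j ^+ 2 by apply: sumr_ge0 => l _; exact: sqr_ge0.
have h1 := psumr_eq0P (fun k _ => r0 k) h (i:=i) isT.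
have h2 := psumr_eq0P (fun l _ => sqr_ge0 (Y i l)) h1 (i:=j) isT.
by apply/eqP; rewrite -sqrf_eq0 h2.
Qed.

Lemma mx11_trace (M : 'M[R]_1) : M 0 0 = \tr M.
Proof. by rewrite /mxtrace big_ord1. Qed.

Lemma psd_gram p n (G : 'M[R]_(p, n)) : possemidef (G^T *m G).
Proof.
split; first by rewrite trmx_mul trmxK.
move=> v; rewrite mx11_trace.
have -> : v^T *m (G^T *m G) *m v = (v^T *m G^T) *m (v^T *m G^T)^T.
  by rewrite trmx_mul !trmxK !mulmxA.
exact: trace_sqr_ge0.
Qed.

Lemma psd_congr p n (Y : 'M[R]_(p, n)) X : possemidef X ->
  possemidef (Y *m X *m Y^T).
Proof.
move=> [sX hX]; split; first by rewrite !trmx_mul trmxK sX mulmxA.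
move=> v; have := hX (Y^T *m v).
by rewrite trmx_mul trmxK !mulmxA.
Qed.

Lemma psd_diag_ge0 n (M : 'M[R]_n) i : possemidef M -> 0 <= M i i.
Proof.
by move=> [_ /(_ (delta_mx i 0))]; rewrite trmx_delta -rowE -colE !mxE.
Qed.

Lemma psd_qform2 n (M : 'M[R]_n) i (v : 'cV[R]_n) (a : R) : M^T = M ->
  ((a *: delta_mx i 0 + v)^T *m M *m (a *: delta_mx i 0 + v)) 0 0 =
  a ^+ 2 * M i i + 2 * a * (M *m v) i 0 + (v^T *m M *m v) 0 0.
Proof.
move=> sM; set e := delta_mx i 0 : 'cV[R]_n.
have -> : (a *: e + v)^T *m M *m (a *: e + v) = a ^+ 2 *: (e^T *m M *m e) +
    a *: (e^T *m M *m v) + a *: (e^T *m M *m v)^T + v^T *m M *m v.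
  have -> : (a *: e + v)^T = a *: e^T + v^T.
    by apply/matrixP => j k; rewrite !mxE.
  rewrite !trmx_mul trmxK sM mulmxA !mulmxDl !mulmxDr.
  by rewrite -!scalemxAl -!scalemxAr scalerA expr2 !addrA.
have -> : e^T *m M *m e = (M i i)%:M.
  apply/matrixP => j k; rewrite !ord1 /e trmx_delta -rowE -colE !mxE.
  by rewrite eqxx mulr1n.
have -> : e^T *m M *m v = ((M *m v) i 0)%:M.
  apply/matrixP => j k; rewrite !ord1 /e -mulmxA trmx_delta -rowE !mxE.
  by rewrite eqxx mulr1n.
by rewrite tr_scalar_mx !mxE eqxx !mulr1n; ring.
Qed.

Lemma psd_diag0 n (M : 'M[R]_n) i j : possemidef M -> M i i = 0 -> M i j = 0.
Proof.
move=> [sM hM] Mi0; apply/eqP; apply: contraT => Mij0.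
(* With [M i i = 0] the form at [a e_i + e_j] is [2 a M_ij + M_jj]; this [a] makes it -1. *)
have := hM (- ((M j j + 1) / (2 * M i j)) *: delta_mx i 0 + delta_mx j 0).
rewrite psd_qform2// Mi0 mulr0 add0r trmx_delta -rowE -!colE.
rewrite ![(col _ _) _ _]mxE ![(row _ _) _ _]mxE.
have -> : 2 * - ((M j j + 1) / (2 * M i j)) * M i j + M j j = -1 by field.
by rewrite lerNr oppr0 ler10.
Qed.

(** Cholesky factorization by Schur complements. Subtracting the rank-one term built from row [i]
    clears the diagonal entry [i] and revives no vanished one, so the number of nonzero diagonal
    entries decreases. *)
Lemma psd_factor n (M : 'M[R]_n) : possemidef M ->
  exists p (G : 'M[R]_(p, n)), M = G^T *m G.
Proof.
have [k] := ubnP #|[pred i | M i i != 0]|.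
elim: k M => // k IH M hk pM.
have [i Mi0|M0] := pickP (fun i => M i i != 0); last first.
  exists 0%N, 0; rewrite mulmx0; apply/matrixP => i j; rewrite mxE.
  by apply: psd_diag0 => //; apply/eqP; move/negbFE: (M0 i).
have Mip : 0 < M i i by rewrite lt_neqAle eq_sym Mi0 psd_diag_ge0.
have sM := pM.1.
pose c := row i M.
pose M' := M - (M i i)^-1 *: (c^T *m c).
have M'E j l : M' j l = M j l - (M i i)^-1 * (M i j * M i l).
  by rewrite !mxE big_ord1 !mxE.
have pM' : possemidef M'.
  split.
    by rewrite linearB/= linearZ/= trmx_mul trmxK sM.
  (* The coefficient of [delta_mx i 0] minimizes the form along that direction, and the minimum is
     the form of the Schur complement at [v]. *)
  move=> v; have := pM.2 (- ((M i i)^-1 * (M *m v) i 0) *: delta_mx i 0 + v).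
  rewrite psd_qform2//.
  have -> : (v^T *m M' *m v) 0 0 = (v^T *m M *m v) 0 0 -
      (M i i)^-1 * ((M *m v) i 0) ^+ 2.
    have cv : c *m v = ((M *m v) i 0)%:M.
      apply/matrixP => a b; rewrite !ord1 -row_mul !mxE eqxx mulr1n.
      by [].
    rewrite /M' mulmxBr mulmxBl -scalemxAr -scalemxAl.
    have -> : v^T *m (c^T *m c) *m v = (c *m v)^T *m (c *m v).
      by rewrite trmx_mul !mulmxA.
    rewrite cv tr_scalar_mx -scalar_mxM mxE [X in _ + X = _]mxE.
    by rewrite [X in - X]mxE [X in _ * X]mxE eqxx mulr1n expr2.
  congr (is_true (_ <= _)); field; exact: Mi0.
have [|//|p [G GE]] := IH M'.
  rewrite -ltnS; apply: leq_trans hk; rewrite ltnS; apply: proper_card; apply/properP; split.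
    apply/fintype.subsetP => j; rewrite !inE; apply: contraNN => /eqP Mj0.
    have Mij : M i j = 0 by rewrite -sM mxE; exact: psd_diag0.
    by rewrite M'E Mj0 Mij mul0r mulr0 subrr.
  exists i; rewrite !inE ?Mi0// M'E negbK.
  by rewrite mulrA mulVf// mul1r subrr.
exists (p + 1)%N, (col_mx G ((Num.sqrt (M i i))^-1 *: c)).
rewrite tr_col_mx mul_row_col -GE; set a := _^-1.
have -> : (a *: c)^T = a *: c^T by apply/matrixP => j l; rewrite !mxE.
rewrite -scalemxAl -scalemxAr scalerA /a.
by rewrite -invfM -expr2 sqr_sqrtr ?ltW// /M' subrK.
Qed.

Lemma trace_psd_ge0 p n (H : 'M[R]_(p, n)) X : possemidef X ->
  0 <= \tr (H *m X *m H^T).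
Proof.
move=> /psd_factor[k [G ->]].
rewrite (_ : _ *m _ = (H *m G^T) *m (H *m G^T)^T); first exact: trace_sqr_ge0.
by rewrite trmx_mul trmxK !mulmxA.
Qed.

Lemma trace_psd_eq0 p n (H : 'M[R]_(p, n)) X : possemidef X ->
  \tr (H *m X *m H^T) = 0 -> H *m X = 0.
Proof.
move=> /psd_factor[k [G ->]].
rewrite (_ : _ *m H^T = (H *m G^T) *m (H *m G^T)^T); last first.
  by rewrite trmx_mul trmxK !mulmxA.
by move=> /trace_sqr_eq0 h; rewrite mulmxA h mul0mx.
Qed.

Lemma psdD n (X Y : 'M[R]_n) : possemidef X -> possemidef Y -> possemidef (X + Y).
Proof.
move=> [sX hX] [sY hY]; split; first by rewrite linearD/= sX sY.
by move=> v; rewrite mulmxDr mulmxDl mxE addr_ge0.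
Qed.

Lemma psd0 n : possemidef (0 : 'M[R]_n).
Proof. by split=> [|v]; rewrite ?trmx0// mulmx0 mul0mx mxE. Qed.

Lemma psd_sum n (I : finType) (X : I -> 'M[R]_n) :
  (forall i, possemidef (X i)) -> possemidef (\sum_i X i).
Proof.
move=> h; elim/big_ind: _ => // [|X1 X2]; [exact: psd0|exact: psdD].
Qed.

(** A factorization of [K] replaces correlated noises by uncorrelated ones with coefficients mixed
    by [Rm]; the algebra below then handles a single sum of squares. *)
Lemma noise_diag q k n (Rm : 'M[R]_(k, q)) (L M : 'I_q -> 'M[R]_n) (X : 'M[R]_n) :
  \sum_i \sum_j (Rm^T *m Rm) i j *: (L i *m X *m M j) =
  \sum_l (\sum_i Rm l i *: L i) *m X *m (\sum_j Rm l j *: M j).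
Proof.
under [RHS]eq_bigr => l _.
  rewrite mulmx_suml mulmx_suml.
  under eq_bigr => i _ do rewrite mulmx_sumr.
  over.
rewrite [RHS]exchange_big/=; apply: eq_bigr => i _.
rewrite [RHS]exchange_big/=; apply: eq_bigr => j _.
rewrite mxE scaler_suml; apply: eq_bigr => l _.
by rewrite mxE -scalemxAl -scalemxAl -scalemxAr scalerA.
Qed.

End PositiveSemidefinite.

(** * Lyapunov operators and the balanced Riccati relations *)

Section LyapunovOperators.
Context {R : realType} (n k : nat).
Variables (A : 'M[R]_n) (N : 'I_k -> 'M[R]_n).

Definition lyap (X : 'M[R]_n) : 'M[R]_n :=
  A *m X + X *m A^T + \sum_l N l *m X *m (N l)^T.

Definition dual_lyap (M : 'M[R]_n) : 'M[R]_n :=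
  A^T *m M + M *m A + \sum_l (N l)^T *m M *m N l.

Lemma trace_dual_lyap M X : \tr (M *m lyap X) = \tr (dual_lyap M *m X).
Proof.
rewrite /lyap /dual_lyap !mulmxDr !mulmxDl !mxtraceD.
congr (_ + _); first by rewrite addrC mulmxA mxtrace_mulC mulmxA; congr (_ + _);
  rewrite mulmxA.
rewrite mulmx_sumr mulmx_suml !linear_sum/=; apply: eq_bigr => l _.
by rewrite !mulmxA mxtrace_mulC !mulmxA.
Qed.

End LyapunovOperators.

Section BalancedEquations.
Context {R : realType} (n k p m : nat).
Variables (A : 'M[R]_n) (N : 'I_k -> 'M[R]_n) (B : 'M[R]_(n, m)) (C : 'M[R]_(p, n)).
Variables (D Di J Gm : 'M[R]_n).
Hypotheses (pD : possemidef D) (pDi : possemidef Di) (pGm : possemidef Gm).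
Hypotheses (DDi : D *m Di = 1%:M) (DiD : Di *m D = 1%:M).
Hypotheses (sJ : J^T = J) (JJ : J *m J = J).
Hypotheses (JD : J *m D = D *m J) (JDi : J *m Di = Di *m J).
Hypothesis E1 : dual_lyap A N D + C^T *m C - D *m B *m B^T *m D = 0.
Hypothesis E2 : dual_lyap A N Di - C^T *m C + Di *m B *m B^T *m Di = - Gm.

Local Notation J' := (1%:M - J).

(** [D] stands for Sigma, [Di] for its inverse, [J] for the projector onto the leading coordinates
    and [Gm] for the defect of the Riccati inequality. Zero-output moment matrices of the reduced
    system, padded with zeros, have this form. *)
Definition confined (X : 'M[R]_n) :=
  [/\ possemidef X, J *m X = X & C *m X = 0].

Lemma confined_r X : confined X -> X *m J = X.
Proof. by move=> [[sX _] JX _]; rewrite -[in LHS]sX -sJ -trmx_mul JX sX. Qed.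

Lemma J'J : J' *m J = 0.
Proof. by rewrite mulmxBl mul1mx JJ subrr. Qed.

(** [M] is block diagonal for [J], so compression loses only its complementary block. There the
    drift terms vanish because [J' *m X = 0], and what is left is the noise that leaks out of the
    leading block. *)
Lemma trace_corner M X : J *m M = M *m J -> confined X ->
  \tr (M *m (J *m lyap A N X *m J)) =
  \tr (dual_lyap A N M *m X) - \sum_l \tr (J' *m M *m J' *m (N l *m X *m (N l)^T)).
Proof.
move=> JM cX; have XJ := confined_r cX; have [[sX _] JX _] := cX.
have J'X : J' *m X = 0 by rewrite mulmxBl mul1mx JX subrr.
have XJ' : X *m J' = 0 by rewrite mulmxBr mulmx1 XJ subrr.
have JMJ : M = J *m M *m J + J' *m M *m J'.
  rewrite JM -mulmxA JJ mulmxBl mul1mx JM mulmxBr mulmx1 mulmxBl.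
  by rewrite -mulmxA JJ subrr subr0 addrC subrK.
have -> : \tr (M *m (J *m lyap A N X *m J)) = \tr (J *m M *m J *m lyap A N X).
  by rewrite mulmxA mxtrace_mulC !mulmxA.
rewrite -trace_dual_lyap {2}JMJ mulmxDl mxtraceD -addrA -[LHS]addr0.
congr (_ + _); apply/eqP; rewrite eq_sym subr_eq0; apply/eqP.
set M' := J' *m M *m J'.
have XM' : X *m M' = 0 by rewrite /M' !mulmxA XJ' !mul0mx.
have M'X : M' *m X = 0 by rewrite /M' -mulmxA J'X mulmx0.
rewrite /lyap !mulmxDr mulmx_sumr !mxtraceD.
rewrite (mxtrace_mulC M' (A *m X)) -(mulmxA A) XM' mulmx0 mxtrace0 add0r.
by rewrite (mulmxA M' X) M'X mul0mx mxtrace0 add0r linear_sum.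
Qed.

Lemma psd_J' M : possemidef M -> possemidef (J' *m M *m J').
Proof.
have sJ' : J'^T = J' by rewrite linearB/= trmx1 sJ.
by move=> pM; have := psd_congr J' pM; rewrite sJ'.
Qed.

Lemma trace_psd_mul_ge0 (M X : 'M[R]_n) : possemidef M -> possemidef X ->
  0 <= \tr (M *m X).
Proof.
move=> /psd_factor[r [H ->]] pX; have := trace_psd_ge0 H pX.
by rewrite mxtrace_mulC mulmxA mxtrace_mulC mulmxA.
Qed.

Lemma trace_psd_mul_eq0 (M X : 'M[R]_n) : possemidef M -> possemidef X ->
  \tr (M *m X) = 0 -> M *m X = 0.
Proof.
move=> /psd_factor[r [H ->]] pX h.
rewrite -mulmxA (trace_psd_eq0 pX) ?mulmx0//.
by rewrite mxtrace_mulC mulmxA.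
Qed.

(** Three losses, each nonnegative: the defect of the inequality, the input term and the leaking
    noise. The output term is absent because [C *m X = 0]. *)
Lemma trace_corner_Di X : confined X ->
  \tr (Di *m (J *m lyap A N X *m J)) =
  - (\tr (Gm *m X) + \tr ((B^T *m Di) *m X *m (B^T *m Di)^T) +
     \sum_l \tr (J' *m Di *m J' *m (N l *m X *m (N l)^T))).
Proof.
move=> cX; have [_ _ CX] := cX; rewrite trace_corner//.
have -> : dual_lyap A N Di *m X = - (Gm *m X) - Di *m B *m B^T *m Di *m X.
  have -> : dual_lyap A N Di = - Gm + C^T *m C - Di *m B *m B^T *m Di.
    rewrite -E2; apply/matrixP => i j; rewrite !mxE; ring.
  by rewrite mulmxBl mulmxDl -[C^T *m C *m X]mulmxA CX mulmx0 addr0 mulNmx.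
rewrite mxtraceD !linearN/= -!opprD; congr (- (_ + _ + _)).
rewrite trmx_mul trmxK (pDi.1).
by rewrite [RHS]mxtrace_mulC !mulmxA.
Qed.

Lemma trace_corner_Di_le0 X : confined X ->
  \tr (Di *m (J *m lyap A N X *m J)) <= 0.
Proof.
move=> cX; have [pX _ _] := cX; rewrite trace_corner_Di// oppr_le0.
rewrite !addr_ge0 ?trace_psd_mul_ge0 ?trace_psd_ge0//.
apply: sumr_ge0 => l _; apply: trace_psd_mul_ge0; first exact: psd_J'.
exact: psd_congr.
Qed.

Definition critical X := confined X /\ J *m lyap A N X *m J = 0.

(** Compression to zero makes all three losses of [trace_corner_Di] vanish. Without leaking noise,
    [trace_corner] for [D] has no correction term, so the trace of [E1] against [X] reduces to its
    input term, which must vanish too. *)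
Lemma critical_kernels X : critical X ->
  [/\ Gm *m X = 0, B^T *m Di *m X = 0, B^T *m D *m X = 0 &
      forall l, J' *m N l *m X = 0].
Proof.
move=> [cX LX]; have [pX JX CX] := cX.
have := trace_corner_Di cX; rewrite LX mulmx0 mxtrace0 => /esym/eqP.
have t1 := trace_psd_mul_ge0 pGm pX.
have t2 := trace_psd_ge0 (B^T *m Di) pX.
have t3 l : 0 <= \tr (J' *m Di *m J' *m (N l *m X *m (N l)^T)).
  by apply: trace_psd_mul_ge0; [exact: psd_J'|exact: psd_congr].
have t4 : 0 <= \sum_l \tr (J' *m Di *m J' *m (N l *m X *m (N l)^T)).
  by apply: sumr_ge0 => l _; exact: t3.
rewrite oppr_eq0 paddr_eq0 ?addr_ge0// paddr_eq0// => /andP[/andP[/eqP g1 /eqP g2] /eqP g3].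
have J'N l : J' *m N l *m X = 0.
  have g3l := psumr_eq0P (fun l _ => t3 l) g3 (i := l) isT.
  have := trace_psd_mul_eq0 (psd_J' pDi) (psd_congr (N l) pX) g3l.
  move=> /(congr1 (mulmx D)); rewrite mulmx0 !mulmxA.
  have -> : D *m J' *m Di *m J' = J'.
    have -> : D *m J' = J' *m D by rewrite mulmxBl mulmxBr mul1mx mulmx1 JD.
    by rewrite -(mulmxA J') DDi mulmx1 mulmxBl mul1mx mulmxBr mulmx1 JJ subrr subr0.
  move=> h; apply: (trace_psd_eq0 pX).
  by rewrite !trmx_mul !mulmxA h !mul0mx mxtrace0.
split=> //.
- exact: trace_psd_mul_eq0.
- exact: trace_psd_eq0.
apply: (trace_psd_eq0 pX).
have := trace_corner (esym (esym JD)) cX.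
rewrite LX mulmx0 mxtrace0.
rewrite big1 => [|l _]; last first.
  by rewrite !mulmxA -(mulmxA _ J' (N l)) -(mulmxA _ (J' *m _) X) J'N mulmx0 mul0mx mxtrace0.
rewrite subr0 => e.
have -> : (B^T *m D) *m X *m (B^T *m D)^T = B^T *m D *m X *m (D *m B).
  by rewrite trmx_mul trmxK pD.1.
have : \tr ((dual_lyap A N D + C^T *m C - D *m B *m B^T *m D) *m X) = 0.
  by rewrite E1 mul0mx mxtrace0.
rewrite mulmxBl mulmxDl -[C^T *m C *m X]mulmxA CX mulmx0 addr0.
rewrite mxtraceD -e add0r linearN/= => /eqP; rewrite oppr_eq0 => /eqP <-.
by rewrite [LHS]mxtrace_mulC !mulmxA.
Qed.

Lemma critical_dual_D X : critical X -> dual_lyap A N D *m X = 0.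
Proof.
move=> cX; have [_ _ BD _] := critical_kernels cX; have [[_ _ CX] _] := cX.
have : (dual_lyap A N D + C^T *m C - D *m B *m B^T *m D) *m X = 0.
  by rewrite E1 mul0mx.
rewrite mulmxBl mulmxDl -[C^T *m C *m X]mulmxA CX mulmx0 addr0.
by rewrite -!mulmxA (mulmxA _ D X) BD !mulmx0 subr0.
Qed.

(** The Riccati inequality is an equality on the range of a critical [X], because its defect
    vanishes there. *)
Lemma critical_dual_Di X : critical X -> dual_lyap A N Di *m X = 0.
Proof.
move=> cX; have [GX BDi _ _] := critical_kernels cX; have [[_ _ CX] _] := cX.
have : (dual_lyap A N Di - C^T *m C + Di *m B *m B^T *m Di) *m X = 0.
  by rewrite E2 mulNmx GX oppr0.
rewrite mulmxDl mulmxBl -[C^T *m C *m X]mulmxA CX mulmx0 subr0.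
by rewrite -!mulmxA (mulmxA _ Di X) BDi !mulmx0 addr0.
Qed.

Variable D2 : 'M[R]_n.
Hypotheses (sD2 : D2^T = D2) (DD2 : D *m D2 = Di) (D2D : D2 *m D = Di).
Hypotheses (JD2 : J *m D2 = D2 *m J) (DiD2 : Di *m D2 = D2 *m Di).

Let psd_sandwich_eq0 (H X : 'M[R]_n) : possemidef X ->
  \tr (D *m (H *m X *m H^T)) = 0 -> H *m X = 0.
Proof.
move=> pX h.
have := trace_psd_mul_eq0 pD (psd_congr H pX) h.
move=> /(congr1 (mulmx Di)); rewrite mulmx0 mulmxA DiD mul1mx => e.
by apply: (trace_psd_eq0 pX); rewrite e mxtrace0.
Qed.

(* Testing [E1] against [D2 X D2], [critical_dual_Di] against [D2] and the
   compressed equation against [Di D2] yields a vanishing sum of squares. *)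
Lemma critical_square X : critical X ->
  [/\ forall l, D2 *m N l *m X = N l *m D2 *m X, C *m D2 *m X = 0 &
      A *m D2 *m X = D2 *m A *m X].
Proof.
move=> cX; have [[[sX hX] JX CX] LX] := cX; have pX : possemidef X by [].
have [GX BDi BD J'N] := critical_kernels cX.
have sDi := pDi.1; have sD := pD.1.
(* [a], [b], [c] are the terms in the weighted square of the commutator [H l], while [alpha] and
   [beta] collect the drift. The combination [ec + ea - 2 eb] of the three tests eliminates the
   drift and completes the squares. *)
pose a l := \tr (Di *m N l *m X *m (N l)^T *m D2).
pose b l := \tr (Di *m N l *m X *m D2 *m (N l)^T).
pose c l := \tr (D *m N l *m D2 *m X *m D2 *m (N l)^T).
pose H l := D2 *m N l - N l *m D2.
pose alpha := \tr (A^T *m Di *m X *m D2).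
pose beta := \tr (Di *m A *m X *m D2).
have HE l : \tr (D *m (H l *m X *m (H l)^T)) = a l - 2 * b l + c l.
  have -> : (H l)^T = (N l)^T *m D2 - D2 *m (N l)^T.
    by rewrite linearB/= !trmx_mul sD2.
  have b' : \tr (D *m N l *m D2 *m X *m (N l)^T *m D2) = b l.
    rewrite mxtrace_mulC !mulmxA D2D -mxtrace_tr !trmx_mul trmxK sX sDi sD2.
    by rewrite !mulmxA [LHS]mxtrace_mulC !mulmxA.
  rewrite /H mulmxBl mulmxBr !mulmxBl !mulmxBr !mulmxA DD2 -/(a l) -/(b l).
  rewrite !linearB/= -/(a l) b' -/(b l) -/(c l); ring.
have eb : alpha + beta + \sum_l b l = 0.
  have := congr1 (fun M => \tr (M *m D2)) (critical_dual_Di cX).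
  rewrite mul0mx mxtrace0 /dual_lyap !mulmxDl !mxtraceD !mulmx_suml linear_sum/= => e0.
  rewrite -[RHS]e0; congr (_ + _); apply: eq_bigr => l _.
  by rewrite /b mxtrace_mulC !mulmxA.
have ec : 2 * alpha + \sum_l c l + \tr ((C *m D2) *m X *m (C *m D2)^T) = 0.
  have t1 : \tr (A^T *m D *m (D2 *m X *m D2)) = alpha.
    by rewrite !mulmxA -(mulmxA A^T D D2) DD2.
  have t2 : \tr (D *m A *m (D2 *m X *m D2)) = alpha.
    rewrite !mulmxA mxtrace_mulC !mulmxA D2D -mxtrace_tr !trmx_mul sX sDi sD2.
    by rewrite !mulmxA [LHS]mxtrace_mulC !mulmxA [LHS]mxtrace_mulC !mulmxA.
  have t3 l : \tr ((N l)^T *m D *m N l *m (D2 *m X *m D2)) = c l.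
    by rewrite /c [RHS]mxtrace_mulC !mulmxA.
  have t4 : \tr (C^T *m C *m (D2 *m X *m D2)) =
      \tr ((C *m D2) *m X *m (C *m D2)^T).
    by rewrite trmx_mul sD2 !mulmxA [RHS]mxtrace_mulC !mulmxA.
  have t5 : D *m B *m B^T *m D *m (D2 *m X *m D2) = 0.
    have e : B^T *m (Di *m (X *m D2)) = 0 by rewrite !mulmxA BDi mul0mx.
    by rewrite !mulmxA -(mulmxA _ D D2) DD2 -!mulmxA e !mulmx0.
  have := congr1 (fun M => \tr (M *m (D2 *m X *m D2))) E1.
  rewrite mul0mx mxtrace0 /dual_lyap mulmxBl !mulmxDl t5 subr0 !mxtraceD.
  rewrite t1 t2 t4 mulmx_suml linear_sum/= => e0.
  by rewrite -[RHS]e0 mulr_natl mulr2n; congr (_ + _ + _ + _); apply: eq_bigr => l _.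
have ea : 2 * beta + \sum_l a l = 0.
  have JM : J *m (Di *m D2) = Di *m D2 *m J.
    by rewrite mulmxA JDi -mulmxA JD2 mulmxA.
  have := trace_corner JM cX.1.
  rewrite LX mulmx0 mxtrace0 big1 => [|l _]; last first.
    by rewrite !mulmxA -(mulmxA _ J' (N l)) -(mulmxA _ (J' *m _) X) J'N mulmx0 mul0mx mxtrace0.
  rewrite subr0 /dual_lyap !mulmxDl !mxtraceD mulmx_suml linear_sum/= => e0.
  rewrite [RHS]e0 mulr_natl mulr2n; congr (_ + _ + _).
  - rewrite -[RHS]mxtrace_tr !trmx_mul trmxK sX sDi sD2 /beta.
    by rewrite mxtrace_mulC [RHS]mxtrace_mulC !mulmxA.
  - by rewrite /beta mxtrace_mulC !mulmxA DiD2.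
  - apply: eq_bigr => l _.
    by rewrite /a [LHS]mxtrace_mulC -!mulmxA [RHS]mxtrace_mulC -!mulmxA !mulmxA DiD2.
have S0 : \sum_l \tr (D *m (H l *m X *m (H l)^T)) +
    \tr ((C *m D2) *m X *m (C *m D2)^T) = 0.
  under eq_bigr do rewrite HE.
  rewrite !big_split/= sumrN -mulr_sumr.
  have : 2 * (alpha + beta + \sum_l b l) = 0 by rewrite eb mulr0.
  move: ec ea; lra.
have h1 l : 0 <= \tr (D *m (H l *m X *m (H l)^T)).
  by apply: trace_psd_mul_ge0 => //; exact: psd_congr.
have h2 := trace_psd_ge0 (C *m D2) pX.
have h5 : 0 <= \sum_l \tr (D *m (H l *m X *m (H l)^T)).
  by apply: sumr_ge0 => l _; exact: h1.
move/eqP: S0; rewrite paddr_eq0// => /andP[/eqP h3 /eqP h4].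
have NX l : D2 *m N l *m X = N l *m D2 *m X.
  apply/eqP; rewrite -subr_eq0 -mulmxBl; apply/eqP.
  by apply: psd_sandwich_eq0 => //; exact: (psumr_eq0P (fun l _ => h1 l) h3).
have CT : C *m D2 *m X = 0 by exact: trace_psd_eq0 h4.
split=> //.
(* Commutation with the [N l] turns [E1] applied to [D2 *m X] into an equation that differs from
   [e2] only in the term with [A], so the two can be subtracted. *)
have e2 := critical_dual_Di cX.
have t5 : D *m B *m B^T *m D *m (D2 *m X) = 0.
  by rewrite !mulmxA -(mulmxA _ D D2) DD2 -!mulmxA (mulmxA B^T) BDi !mulmx0.
have e1 : A^T *m Di *m X + D *m A *m D2 *m X +
    \sum_l (N l)^T *m Di *m N l *m X = 0.
  have := congr1 (fun M => M *m (D2 *m X)) E1.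
  rewrite mul0mx /dual_lyap mulmxBl !mulmxDl t5 subr0.
  rewrite -(mulmxA C^T) (mulmxA C) CT mulmx0 addr0 mulmx_suml => e0.
  rewrite -[RHS]e0 !mulmxA -(mulmxA A^T D D2) DD2; congr (_ + _ + _).
  apply: eq_bigr => l _; rewrite -(mulmxA _ (N l) (D2 *m X)) (mulmxA (N l)) -NX.
  by rewrite !mulmxA -(mulmxA _ D D2) DD2.
have : D *m A *m D2 *m X = Di *m A *m X.
  move: e2; rewrite -{1}e1 /dual_lyap !mulmxDl mulmx_suml.
  by move=> /addIr/addrI.
move=> /(congr1 (mulmx Di)); rewrite !mulmxA DiD mul1mx => ->.
by rewrite -[in RHS](mul1mx D2) -DiD -(mulmxA Di D) DD2.
Qed.

(** The shifted [D2] passes through [A] and the [N l] on the range of [X], so [lyap] intertwines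
    with the congruence. This closure is what [diag_eigen_reduction] iterates. *)
Lemma critical_shift X (c : R) : critical X ->
  critical ((D2 - c%:M) *m X *m (D2 - c%:M)).
Proof.
move=> cX; have [[pX JX CX] LX] := cX; have [NX CT AX] := critical_square cX.
set S := D2 - c%:M.
have sS : S^T = S by rewrite /S linearB/= tr_scalar_mx sD2.
have JS : J *m S = S *m J.
  by rewrite /S mulmxBr mulmxBl JD2 scalar_mxC.
have AS : A *m S *m X = S *m A *m X.
  rewrite /S mulmxBr !mulmxBl AX; congr (_ - _ *m _).
  by rewrite scalar_mxC.
have NS l : N l *m S *m X = S *m N l *m X.
  rewrite /S mulmxBr !mulmxBl NX; congr (_ - _ *m _).
  by rewrite scalar_mxC.
have CS : C *m S *m X = 0.
  by rewrite /S mulmxBr mulmxBl CT -mulmxA mul_scalar_mx -scalemxAr CX scaler0 subr0.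
clearbody S.
have trS (M : 'M[R]_n) : M *m S *m X = S *m M *m X -> X *m S *m M^T = X *m M^T *m S.
  move=> /(congr1 trmx); rewrite !trmx_mul sS pX.1 => h.
  by rewrite -mulmxA h mulmxA.
split; first split.
- by have := psd_congr S pX; rewrite sS.
- by rewrite !mulmxA JS -(mulmxA S J) JX.
- by rewrite !mulmxA CS mul0mx.
have LS : lyap A N (S *m X *m S) = S *m lyap A N X *m S.
  rewrite /lyap !mulmxDr !mulmxDl mulmx_sumr mulmx_suml; congr (_ + _ + _).
  - by rewrite !mulmxA AS.
  - by rewrite -!mulmxA (mulmxA X) trS// !mulmxA.
  - apply: eq_bigr => l _.
    rewrite !mulmxA NS -!mulmxA (mulmxA X S) trS//.
    by rewrite !mulmxA.
rewrite LS !mulmxA JS -!mulmxA -JS !mulmxA -(mulmxA S J) -(mulmxA S _ J) LX.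
by rewrite mulmx0 mul0mx.
Qed.

End BalancedEquations.

Section Eigenspace.
Context {R : realType} (n : nat).

(* Rows of [X] are killed one at a time, so a nonzero multiple survives. *)
Lemma diag_eigen_reduction (tau : 'rV[R]_n) (Pr : 'M[R]_n -> Prop) :
  (forall X, Pr X -> possemidef X) ->
  (forall X c, Pr X -> Pr ((diag_mx tau - c%:M) *m X *m (diag_mx tau - c%:M))) ->
  forall X, Pr X -> X != 0 ->
  exists X' c, [/\ Pr X', X' != 0 & diag_mx tau *m X' = c *: X'].
Proof.
move=> Ppsd Pshift X.
have [k] := ubnP #|[pred i | row i X != 0]|.
elim: k X => // k IH X hk PX X0.
have [i iX|Xi] := pickP (fun i => row i X != 0); last first.
  exfalso; move/eqP: X0; apply; apply/row_matrixP => i.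
  by rewrite row0; apply/eqP; move/negbFE: (Xi i).
pose S := diag_mx tau - (tau 0 i)%:M.
have sS : S^T = S by rewrite /S linearB/= tr_scalar_mx tr_diag_mx.
have [SX|SX] := eqVneq (S *m X) 0.
  exists X, (tau 0 i); split=> //.
  by apply/eqP; rewrite -subr_eq0 -mul_scalar_mx -mulmxBl SX.
have rowS j : row j (S *m X) = (tau 0 j - tau 0 i) *: row j X.
  rewrite /S mulmxBl linearB/= mul_scalar_mx linearZ/= row_mul row_diag_mx.
  by rewrite -scalemxAl -rowE scalerBl.
apply: (IH (S *m X *m S)).
- rewrite -ltnS; apply: leq_trans hk; rewrite ltnS; apply: proper_card; apply/properP; split.
    apply/fintype.subsetP => j; rewrite !inE; apply: contraNN => /eqP Xj.
    by rewrite row_mul rowS Xj scaler0 mul0mx.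
  exists i; rewrite !inE// negbK.
  by rewrite row_mul rowS subrr scale0r mul0mx.
- exact: Pshift.
apply: contra SX => /eqP h; apply/eqP.
by apply: (trace_psd_eq0 (Ppsd _ PX)); rewrite sS h mxtrace0.
Qed.

End Eigenspace.

Section Certificate.
Context {R : realType}.

(** The least-squares projector of a row basis of [X], whose row and column spaces agree by
    symmetry. The factor [M] transfers to [Pi] any relation known after multiplication by [X]. *)
Lemma orth_projector n (X : 'M[R]_n) : X^T = X ->
  exists Pi M : 'M[R]_n,
    [/\ Pi^T = Pi, Pi *m Pi = Pi, Pi *m X = X & Pi = X *m M].
Proof.
move=> sX; pose Y := row_base X.
have /submxP[X0 XE] : (X <= Y)%MS by rewrite eq_row_base.
have /submxP[Y0 YE] : (Y <= X)%MS by rewrite eq_row_base.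
have Yf : row_free Y by exact: row_base_free.
clearbody Y.
have Gu : Y *m Y^T \in unitmx.
  rewrite -row_free_unit; apply: inj_row_free => v.
  move=> /(congr1 (fun w => \tr (w *m v^T))).
  rewrite mul0mx mxtrace0.
  rewrite (_ : v *m (Y *m Y^T) *m v^T = (v *m Y) *m (v *m Y)^T); last first.
    by rewrite trmx_mul !mulmxA.
  move=> /trace_sqr_eq0 h; apply: (row_free_inj Yf).
  by rewrite /= h mul0mx.
pose Pi := Y^T *m invmx (Y *m Y^T) *m Y.
have sPi : Pi^T = Pi.
  by rewrite /Pi !trmx_mul trmxK trmx_inv trmx_mul trmxK mulmxA.
have PiX : Pi *m X = X.
  rewrite -sX XE trmx_mul /Pi -!mulmxA (mulmxA Y) (mulmxA (invmx _)).
  by rewrite mulVmx// mul1mx.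
have YT : Y^T = X *m Y0^T by rewrite {1}YE trmx_mul sX.
have PiY : Pi *m Y^T = Y^T by rewrite {1}YT mulmxA PiX -YT.
exists Pi, (Y0^T *m invmx (Y *m Y^T) *m Y); split=> //.
  by rewrite {2}/Pi !mulmxA PiY.
by rewrite /Pi {1}YT !mulmxA.
Qed.

(** The certificate is the orthogonal projector [Pi] onto the range of [X]. Invariance of that range
    comes from [lyap A N X = 0], and the last hypothesis expresses [A^T] on the range through [A]
    and the [N l]. *)
Lemma dual_certificate n k m (A : 'M[R]_n) (N : 'I_k -> 'M[R]_n)
    (B : 'M[R]_(n, m)) (X : 'M[R]_n) :
  possemidef X -> X != 0 -> lyap A N X = 0 -> B^T *m X = 0 ->
  A^T *m X + A *m X + \sum_l (N l)^T *m N l *m X = 0 ->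
  exists Y : 'M[R]_n, [/\ possemidef Y, Y != 0, Y *m B = 0 &
    possemidef (dual_lyap A N Y)].
Proof.
move=> pX X0 LX BX eX; have sX := pX.1.
have [Pi [M [sPi PP PX PE]]] := orth_projector sX.
pose P' := 1%:M - Pi.
have P'E : P' = 1%:M - Pi by [].
have sP' : P'^T = P' by rewrite /P' linearB/= trmx1 sPi.
have P'X : P' *m X = 0 by rewrite mulmxBl mul1mx PX subrr.
have XP' : X *m P' = 0 by rewrite -sX -sP' -trmx_mul P'X trmx0.
clearbody P'.
have P'N l : P' *m N l *m X = 0.
  have p1 j : possemidef (P' *m N j *m X *m (P' *m N j)^T) by exact: psd_congr.
  (* Compression by [P'] on both sides kills the drift terms, which leaves the trace of a sum of
     squares. *)
  have : \sum_l \tr (P' *m N l *m X *m (P' *m N l)^T) = 0.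
    have := congr1 (fun Z => \tr (P' *m Z *m P')) LX.
    rewrite mulmx0 mul0mx mxtrace0 /lyap !mulmxDr !mulmxDl.
    rewrite -!mulmxA XP' !(mulmxA P' X) P'X !mulmx0 !mul0mx !add0r.
    rewrite mulmx_suml mulmx_sumr linear_sum/= => h0; rewrite -[RHS]h0; apply: eq_bigr => j _.
    by rewrite trmx_mul sP' !mulmxA.
  move=> h; have := psumr_eq0P (fun j _ => trace_psd_ge0 (P' *m N j) pX) h (i := l) isT.
  exact: trace_psd_eq0.
have P'A : P' *m A *m X = 0.
  have := congr1 (fun Z => P' *m Z) LX.
  rewrite mulmx0 /lyap !mulmxDr mulmx_sumr big1 => [|j _]; last first.
    by rewrite !mulmxA P'N mul0mx.
  by rewrite (mulmxA P' X) P'X mul0mx !addr0 mulmxA.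
have NP l : N l *m Pi = Pi *m N l *m Pi.
  apply/eqP; rewrite -subr_eq0; apply/eqP.
  rewrite -[N l *m Pi]mul1mx -mulmxA -mulmxBl -P'E PE.
  by rewrite !mulmxA P'N mul0mx.
have AP : A *m Pi = Pi *m A *m Pi.
  apply/eqP; rewrite -subr_eq0; apply/eqP.
  rewrite -[A *m Pi]mul1mx -mulmxA -mulmxBl -P'E PE.
  by rewrite !mulmxA P'A mul0mx.
have eP : A^T *m Pi = - (A *m Pi) - \sum_l (N l)^T *m N l *m Pi.
  have := congr1 (mulmxr M) eX; rewrite /= mul0mx !mulmxDl mulmx_suml.
  rewrite -!mulmxA -PE => h; apply/eqP; rewrite -subr_eq0 opprB.
  rewrite addrA addrAC -[X in _ == X]h; apply/eqP.
  under [in RHS]eq_bigr do rewrite -!mulmxA -PE mulmxA.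
  by rewrite opprK.
have tN l : Pi *m (N l)^T = Pi *m (N l)^T *m Pi.
  by rewrite -[LHS]trmxK trmx_mul trmxK sPi NP !trmx_mul !sPi mulmxA.
have tA : Pi *m A^T *m Pi = Pi *m A^T.
  by rewrite -[RHS]trmxK trmx_mul trmxK sPi AP !trmx_mul !sPi mulmxA.
pose S1 := \sum_l (N l)^T *m N l *m Pi.
have S1T : S1^T = \sum_l Pi *m (N l)^T *m N l.
  rewrite /S1 linear_sum/=; apply: eq_bigr => l _.
  by rewrite !trmx_mul trmxK sPi mulmxA.
have PA : Pi *m A = - (Pi *m A^T) - S1^T.
  have := congr1 trmx eP; rewrite linearB/= linearN/= !trmx_mul !trmxK sPi.
  by [].
have PAT : Pi *m A^T = - (A *m Pi) - Pi *m S1.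
  have := congr1 (mulmx Pi) eP; rewrite mulmxBr mulmxN !mulmxA tA -AP.
  by [].
exists Pi; split.
- have := psd_gram Pi; by rewrite sPi PP.
- by apply: contra X0 => /eqP P0; rewrite -PX P0 mul0mx.
- by rewrite -sPi PE trmx_mul sX -mulmxA -[X *m B]trmxK trmx_mul sX BX trmx0 mulmx0.
(* The drift terms cancel through [eP], [PA] and [PAT]; the remaining noise terms complete a square
   supported on the complement of the range. *)
have -> : dual_lyap A N Pi =
    \sum_l (P' *m (N l)^T) *m Pi *m (P' *m (N l)^T)^T.
  rewrite /dual_lyap eP PA -/S1 PAT.
  have -> : \sum_l (P' *m (N l)^T) *m Pi *m (P' *m (N l)^T)^T =
      \sum_l (N l)^T *m Pi *m N l - S1^T - S1 + Pi *m S1.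
    rewrite S1T /S1 mulmx_sumr -!sumrB -big_split/=; apply: eq_bigr => l _.
    rewrite trmx_mul trmxK sP' P'E mulmxBr mulmx1.
    have -> : (1%:M - Pi) *m (N l)^T *m Pi = (N l)^T *m Pi - Pi *m (N l)^T.
      by rewrite !mulmxBl mul1mx -tN.
    have e : (N l)^T *m Pi *m (N l *m Pi) = (N l)^T *m N l *m Pi.
      by rewrite -mulmxA (mulmxA Pi) -NP mulmxA.
    rewrite mulmxBl !mulmxBr e !mulmxA.
    by apply/matrixP => i j; rewrite !mxE; ring.
  apply/matrixP => i j; rewrite !mxE; ring.
by apply: psd_sum => l; apply: psd_congr; have := psd_gram Pi; rewrite sPi PP.
Qed.

End Certificate.

Section DiagonalMatrices.
Context {R : realType} (n : nat).

Lemma psd_diag (d : 'rV[R]_n) : (forall i, 0 <= d 0 i) -> possemidef (diag_mx d).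
Proof.
move=> d0; split; first exact: tr_diag_mx.
move=> v; rewrite -mulmxA mul_diag_mx mxE; apply: sumr_ge0 => i _.
by rewrite !mxE mulrCA mulr_ge0// -expr2 sqr_ge0.
Qed.

Lemma diag_eigenrows (d : 'rV[R]_n) (Z : 'M[R]_n) c i :
  diag_mx d *m Z = c *: Z -> row i Z != 0 -> d 0 i = c.
Proof.
move=> dZ Zi; have := congr1 (row i) dZ.
rewrite row_mul row_diag_mx -scalemxAl -rowE linearZ/= => /eqP.
by rewrite -subr_eq0 -scalerBl scaler_eq0 (negbTE Zi) orbF subr_eq0 => /eqP.
Qed.

Lemma diag_scale_rows (d : 'rV[R]_n) (Z : 'M[R]_n) c :
  (forall i, row i Z != 0 -> d 0 i = c) -> diag_mx d *m Z = c *: Z.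
Proof.
move=> h; apply/row_matrixP => i.
rewrite row_mul row_diag_mx -scalemxAl -rowE linearZ/=.
by have [->|/h ->] := eqVneq (row i Z) 0; rewrite ?scaler0.
Qed.

End DiagonalMatrices.

Section Balanced.
Context {R : realType} (n r k p m : nat).
Variables (A : 'M[R]_n) (N : 'I_k -> 'M[R]_n) (B : 'M[R]_(n, m)) (C : 'M[R]_(p, n)).
Variables (Gm : 'M[R]_n) (sigma : 'rV[R]_n).
Hypothesis sigma_gt0 : forall i, 0 < sigma 0 i.
Hypothesis sigma_disj : forall i j : 'I_n, (i < r)%N -> (r <= j)%N ->
  sigma 0 i != sigma 0 j.

Definition leading_proj : 'M[R]_n := diag_mx (\row_(i < n) (i < r)%N%:R).
Definition diag_inv : 'M[R]_n := diag_mx (\row_i (sigma 0 i)^-1).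
Local Notation D := (diag_mx sigma).
Local Notation Di := diag_inv.
Local Notation J := leading_proj.
Local Notation tau := (\row_i (sigma 0 i) ^- 2).

Hypothesis pGm : possemidef Gm.
Hypothesis E1 : dual_lyap A N D + C^T *m C - D *m B *m B^T *m D = 0.
Hypothesis E2 : dual_lyap A N Di - C^T *m C + Di *m B *m B^T *m Di = - Gm.

Let s0 i : sigma 0 i != 0. Proof. by rewrite gt_eqF. Qed.

Let pD : possemidef D.
Proof. by apply: psd_diag => i; exact: ltW. Qed.

Let pDi : possemidef Di.
Proof. by apply: psd_diag => i; rewrite mxE invr_ge0 ltW. Qed.

Lemma diag_mulV : D *m Di = 1%:M.
Proof.
rewrite mulmx_diag -diag_const_mx; congr diag_mx; apply/rowP => i.
by rewrite !mxE mulfV.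
Qed.

Lemma diag_Vmul : Di *m D = 1%:M.
Proof. by rewrite diag_mxC diag_mulV. Qed.

Let DD2 : D *m diag_mx tau = Di.
Proof.
rewrite mulmx_diag; congr diag_mx; apply/rowP => i; rewrite !mxE.
by field.
Qed.

Let sJ : J^T = J. Proof. exact: tr_diag_mx. Qed.

Let JJ : J *m J = J.
Proof.
rewrite mulmx_diag; congr diag_mx; apply/rowP => i; rewrite !mxE.
by case: (i < r)%N; rewrite ?mulr1 ?mulr0.
Qed.

Lemma balanced_corner_le0 X : confined C J X ->
  \tr (Di *m (J *m lyap A N X *m J)) <= 0.
Proof.
move=> cX; apply: (trace_corner_Di_le0 (B := B) (Gm := Gm) pDi pGm sJ JJ _ E2 cX).
exact: diag_mxC.
Qed.

Lemma balanced_certificate X : critical A N C J X -> X != 0 ->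
  exists Y : 'M[R]_n, [/\ possemidef Y, Y != 0, Y *m B = 0 &
    possemidef (dual_lyap A N Y)].
Proof.
move=> cX X0.
have sT : (diag_mx tau)^T = diag_mx tau :> 'M[R]_n by exact: tr_diag_mx.
have D2D : diag_mx tau *m D = Di by rewrite diag_mxC DD2.
have JD : J *m D = D *m J by exact: diag_mxC.
have JDi : J *m Di = Di *m J by exact: diag_mxC.
have JT : J *m diag_mx tau = diag_mx tau *m J by exact: diag_mxC.
have DiT : Di *m diag_mx tau = diag_mx tau *m Di by exact: diag_mxC.
have [||X' [c [cX' X'0 TX']]] := @diag_eigen_reduction _ _ tau (critical A N C J) _ _ X cX X0.
- by move=> Z [[]].
- move=> Z e cZ.
  exact: (critical_shift pD pDi pGm diag_mulV diag_Vmul sJ JJ JD JDi E1 E2 sT DD2 D2D JT DiT e cZ).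
have [NX CX AX] := critical_square pD pDi pGm diag_mulV diag_Vmul sJ JJ JD JDi
  E1 E2 sT DD2 D2D JT DiT cX'.
have [GX BDi BD J'N] := critical_kernels pD pDi pGm diag_mulV sJ JJ JD JDi E1 E2 cX'.
have e1 := critical_dual_D pD pDi pGm diag_mulV sJ JJ JD JDi E1 E2 cX'.
have [[pX' JX' _] LX'] := cX'.
have [i0 Xi0] : exists i, row i X' != 0.
  have [i iX|Xi] := pickP (fun i => row i X' != 0); first by exists i.
  exfalso; move/eqP: X'0; apply; apply/row_matrixP => i.
  by rewrite row0; apply/eqP; move/negbFE: (Xi i).
pose s := sigma 0 i0.
have sp : 0 < s by exact: sigma_gt0.
have cE : c = s ^- 2.
  by have := diag_eigenrows TX' Xi0; rewrite mxE.
have i0r : (i0 < r)%N.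
  have JX1 : J *m X' = 1 *: X' by rewrite scale1r.
  have := diag_eigenrows JX1 Xi0; rewrite mxE.
  by case: (i0 < r)%N => // /eqP; rewrite eq_sym oner_eq0.
have sE (Z : 'M[R]_n) i : diag_mx tau *m Z = c *: Z -> row i Z != 0 -> sigma 0 i = s.
  move=> TZ Zi; have := diag_eigenrows TZ Zi; rewrite mxE cE => /invr_inj /eqP.
  by rewrite eqrXn2 ?ltW// => /eqP.
have DE (Z : 'M[R]_n) : diag_mx tau *m Z = c *: Z -> D *m Z = s *: Z.
  by move=> TZ; apply: diag_scale_rows => i; exact: sE TZ.
have JE (Z : 'M[R]_n) : diag_mx tau *m Z = c *: Z -> J *m Z = Z.
  move=> TZ; rewrite -[RHS]scale1r; apply: diag_scale_rows => i Zi; rewrite mxE.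
  have := sE _ _ TZ Zi; case: ltnP => // ri si.
  by have := sigma_disj i0r ri; rewrite si eqxx.
have TA : diag_mx tau *m (A *m X') = c *: (A *m X').
  by rewrite mulmxA -AX -mulmxA TX' scalemxAr.
have TN l : diag_mx tau *m (N l *m X') = c *: (N l *m X').
  by rewrite mulmxA NX -mulmxA TX' scalemxAr.
have XJ : X' *m J = X' by rewrite -[X' in LHS]pX'.1 -sJ -trmx_mul JX' pX'.1.
have JA := JE _ TA.
have JN l := JE _ (TN l).
have AJ : X' *m A^T *m J = X' *m A^T.
  by rewrite -[RHS]trmxK trmx_mul trmxK pX'.1 -JA !trmx_mul sJ pX'.1.
have NJ l : X' *m (N l)^T *m J = X' *m (N l)^T.
  by rewrite -[RHS]trmxK trmx_mul trmxK pX'.1 -JN !trmx_mul sJ pX'.1.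
(* [J] fixes [A *m X'] and every [N l *m X'], so the compression in [LX'] changes nothing. *)
have L0 : lyap A N X' = 0.
  rewrite -LX' /lyap !mulmxDr !mulmxDl mulmx_sumr mulmx_suml; congr (_ + _ + _).
  - by rewrite JA -mulmxA XJ.
  - by rewrite mulmxA JX' AJ.
  - by apply: eq_bigr => l _; rewrite -!mulmxA (mulmxA X') NJ !mulmxA -(mulmxA J) JN.
apply: (dual_certificate (X := X')) => //.
  have := BD; rewrite -mulmxA DE// -scalemxAr => /eqP.
  by rewrite scaler_eq0 gt_eqF//= => /eqP.
(* [D] acts as the scalar [s] on [X'], [A *m X'] and the [N l *m X'], so [e1] is [s] times the
   relation required of the certificate. *)
have : s *: (A^T *m X' + A *m X' + \sum_l (N l)^T *m N l *m X') = 0.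
  rewrite -[RHS]e1 /dual_lyap !mulmxDl !scalerDr; congr (_ + _ + _).
  - by rewrite -mulmxA DE// scalemxAr.
  - by rewrite -mulmxA DE.
  - rewrite scaler_sumr mulmx_suml; apply: eq_bigr => l _.
    by rewrite -!mulmxA DE// -scalemxAr.
by move=> /eqP; rewrite scaler_eq0 gt_eqF//= => /eqP.
Qed.

End Balanced.

(** * Transfer to the reduced and the original coordinates *)

Section Truncation.
Context {R : realType} (n r : nat) (h : (r <= n)%N).

Definition leading_inj : 'M[R]_(n, r) := colsub (widen_ord h) 1%:M.
Local Notation E := leading_inj.

Lemma left_colsE p (C : 'M[R]_(p, n)) : left_cols h C = C *m E.
Proof. by rewrite /left_cols /E mulmx_colsub mulmx1. Qed.

Lemma upper_leftE (M : 'M[R]_n) : upper_left h M = E^T *m M *m E.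
Proof.
rewrite /upper_left /E trmx_mxsub trmx1 mul_rowsub_mx mul1mx mulmx_colsub mulmx1.
by apply/matrixP => i j; rewrite !mxE.
Qed.

Lemma leading_inj_trK : E^T *m E = 1%:M.
Proof.
have := upper_leftE 1%:M; rewrite mulmx1 => <-.
apply/matrixP => i j; rewrite !mxE; congr ((_ : bool)%:R).
Qed.

Lemma leading_inj_proj : E *m E^T = leading_proj n r.
Proof.
apply/matrixP => i j; rewrite !mxE.
have [ir|ri] := ltnP i r; last first.
  rewrite mulr0n big1 ?mul0rn// => l _; rewrite !mxE.
  case: eqP => [/(congr1 val)/= e|]; last by rewrite mul0r.
  by have := ltn_ord l; rewrite -e ltnNge ri.
rewrite (bigD1 (Ordinal ir))//= big1 ?addr0 => [|l lir]; last first.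
  rewrite !mxE; case: eqP => [/(congr1 val)/= e|]; last by rewrite mul0r.
  by move/negP: lir; case; apply/eqP/val_inj.
rewrite !mxE.
have -> : widen_ord h (Ordinal ir) = i by exact: val_inj.
by rewrite eqxx mul1r eq_sym.
Qed.

End Truncation.

Section Original.
Context {R : realType} (q n m p r : nat) (K : 'M[R]_q).
Variables (A : 'M[R]_n) (N : 'I_q -> 'M[R]_n) (B : 'M[R]_(n, m)) (C : 'M[R]_(p, n)).
Variables (P Q Sb : 'M[R]_n) (sigma : 'rV[R]_n).
Hypothesis pK : possemidef K.
Hypothesis hPineq : possemidef
       (- (A^T *m invmx P + invmx P *m A + noise_term K N (invmx P)
           - C^T *m C + invmx P *m B *m B^T *m invmx P)).
Hypothesis hQeq : A^T *m Q + Q *m A + noise_term K N Q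
            + C^T *m C - Q *m B *m B^T *m Q = 0.
Hypothesis hrn : (r < n)%N.
Hypothesis sigma_gt0 : forall i, 0 < sigma 0 i.
Hypothesis hSb : Sb \in unitmx.
Hypothesis hSbP : Sb *m P *m Sb^T = diag_mx sigma.
Hypothesis hSbQ : (invmx Sb)^T *m Q *m invmx Sb = diag_mx sigma.
Hypothesis hdisj : forall i j : 'I_n, (i < r)%N -> (r <= j)%N ->
               sigma 0 i != sigma 0 j.

Local Notation E := (leading_inj (ltnW hrn)).
Local Notation Ar := (balanced_rom_A (ltnW hrn) Sb A).
Local Notation Cr := (balanced_rom_C (ltnW hrn) Sb C).
Local Notation Nr := (fun i => balanced_rom_A (ltnW hrn) Sb (N i)).
Local Notation T := (invmx Sb).
Local Notation J := (leading_proj n r).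

Lemma inv_balanced_P : T^T *m invmx P *m T = diag_inv sigma.
Proof.
have uP : P \in unitmx.
  have : Sb *m P *m Sb^T \in unitmx.
    by rewrite hSbP; apply: (mulmx1_unit (diag_mulV sigma_gt0)).1.
  by rewrite !unitmx_mul => /andP[/andP[]].
have uT : Sb^T \in unitmx by rewrite unitmx_tr.
have DZ : diag_mx sigma *m (T^T *m invmx P *m T) = 1%:M.
  rewrite -hSbP trmx_inv -!mulmxA (mulmxA (Sb^T)) mulmxV// mul1mx.
  by rewrite (mulmxA P) mulmxV// mul1mx mulmxV.
rewrite -[LHS]mul1mx -(diag_Vmul sigma_gt0) -(mulmxA (diag_inv sigma)) DZ mulmx1//.
Qed.

Lemma conj_dual_lyap k (N' : 'I_k -> 'M[R]_n) M :
  dual_lyap (Sb *m A *m T) (fun l => Sb *m N' l *m T) (T^T *m M *m T) =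
  T^T *m dual_lyap A N' M *m T.
Proof.
have ST (Z : 'M[R]_n) : Sb^T *m (T^T *m Z) = Z.
  by rewrite mulmxA -trmx_mul mulVmx// trmx1 mul1mx.
have TS (Z : 'M[R]_n) : T *m (Sb *m Z) = Z by rewrite mulmxA mulVmx// mul1mx.
rewrite /dual_lyap !mulmxDr !mulmxDl mulmx_sumr mulmx_suml; congr (_ + _ + _).
- by rewrite !trmx_mul -!mulmxA ST.
- by rewrite -!mulmxA TS.
- by apply: eq_bigr => l _; rewrite !trmx_mul -!mulmxA ST TS.
Qed.

Lemma noise_termE k (Rm : 'M[R]_(k, q)) M : K = Rm^T *m Rm ->
  noise_term K N M = \sum_l (\sum_i Rm l i *: N i)^T *m M *m (\sum_i Rm l i *: N i).
Proof.
move=> ->; rewrite /noise_term noise_diag; apply: eq_bigr => l _.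
congr (_ *m _ *m _); apply/matrixP => i j; rewrite mxE !summxE.
by apply: eq_bigr => a _; rewrite !mxE.
Qed.

(** Truncation is compression by [E], so the reduced operator is a corner of the balanced one; the
    factor [Rm] passes through it by linearity. *)
Lemma reduced_lyapE k (Rm : 'M[R]_(k, q)) (Z : 'M[R]_r) : K = Rm^T *m Rm ->
  lyapunov_op K Ar Nr Z = E^T *m lyap (Sb *m A *m T)
    (fun l => Sb *m (\sum_i Rm l i *: N i) *m T) (E *m Z *m E^T) *m E.
Proof.
move=> KE; rewrite /lyapunov_op /balanced_rom_A /lyap !mulmxDr !mulmxDl.
have EE (Y : 'M[R]_r) : E^T *m (E *m Y) = Y by rewrite mulmxA leading_inj_trK mul1mx.
rewrite !upper_leftE; congr (_ + _ + _).
- by rewrite -!mulmxA leading_inj_trK mulmx1.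
- by rewrite !trmx_mul trmxK -!mulmxA EE.
rewrite KE noise_diag mulmx_sumr mulmx_suml; apply: eq_bigr => l _.
have e : \sum_i Rm l i *: upper_left (ltnW hrn) (Sb *m N i *m T) =
    E^T *m (Sb *m (\sum_i Rm l i *: N i) *m T) *m E.
  rewrite mulmx_sumr mulmx_suml mulmx_sumr mulmx_suml; apply: eq_bigr => i _.
  by rewrite upper_leftE -scalemxAr -scalemxAl -scalemxAr -scalemxAl.
rewrite e.
have -> : \sum_i Rm l i *: (upper_left (ltnW hrn) (Sb *m N i *m T))^T =
    (E^T *m (Sb *m (\sum_i Rm l i *: N i) *m T) *m E)^T.
  rewrite -e; apply/matrixP => i j; rewrite mxE !summxE.
  by apply: eq_bigr => a _; rewrite !mxE.
by rewrite [in LHS]trmx_mul [in LHS]trmx_mul trmxK !mulmxA.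
Qed.

Let lifted_confined (Z : 'M[R]_r) : possemidef Z -> Cr *m Z = 0 ->
  confined (C *m T) J (E *m Z *m E^T).
Proof.
move=> pZ CZ; split; first exact: psd_congr.
  by rewrite -(leading_inj_proj (ltnW hrn)) !mulmxA -(mulmxA E) leading_inj_trK mulmx1.
by move: CZ; rewrite /balanced_rom_C left_colsE !mulmxA => ->; rewrite mul0mx.
Qed.

Lemma balanced_riccati k (Rm : 'M[R]_(k, q)) : K = Rm^T *m Rm ->
  dual_lyap (Sb *m A *m T) (fun l => Sb *m (\sum_i Rm l i *: N i) *m T) (diag_mx sigma)
   + (C *m T)^T *m (C *m T)
   - diag_mx sigma *m (Sb *m B) *m (Sb *m B)^T *m diag_mx sigma = 0.
Proof.
move=> KE; have := congr1 (fun M => T^T *m M *m T) hQeq.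
rewrite mulmx0 mul0mx (noise_termE _ KE) => h; rewrite -[RHS]h.
rewrite -hSbQ conj_dual_lyap /dual_lyap.
rewrite mulmxBr mulmxBl [in RHS]mulmxDr [in RHS]mulmxDl; congr (_ + _ - _).
  by rewrite trmx_mul !mulmxA.
have ST (Z : 'M[R]_n) : Sb^T *m (T^T *m Z) = Z.
  by rewrite mulmxA -trmx_mul mulVmx// trmx1 mul1mx.
have TS w (Z : 'M[R]_(n, w)) : T *m (Sb *m Z) = Z by rewrite mulmxA mulVmx// mul1mx.
by rewrite trmx_mul -!mulmxA ST TS.
Qed.

Lemma balanced_riccati_ineq k (Rm : 'M[R]_(k, q)) : K = Rm^T *m Rm ->
  exists Gm, possemidef Gm /\
  dual_lyap (Sb *m A *m T) (fun l => Sb *m (\sum_i Rm l i *: N i) *m T) (diag_inv sigma)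
   - (C *m T)^T *m (C *m T)
   + diag_inv sigma *m (Sb *m B) *m (Sb *m B)^T *m diag_inv sigma = - Gm.
Proof.
move=> KE; eexists; split; first exact: (psd_congr T^T hPineq).
rewrite trmxK mulmxN mulNmx opprK (noise_termE _ KE).
rewrite -inv_balanced_P conj_dual_lyap /dual_lyap.
rewrite [in RHS]mulmxDr [in RHS]mulmxDl [in RHS]mulmxBr [in RHS]mulmxBl.
congr (_ - _ + _).
  by rewrite trmx_mul !mulmxA.
have ST (Z : 'M[R]_n) : Sb^T *m (T^T *m Z) = Z.
  by rewrite mulmxA -trmx_mul mulVmx// trmx1 mul1mx.
have TS w (Z : 'M[R]_(n, w)) : T *m (Sb *m Z) = Z by rewrite mulmxA mulVmx// mul1mx.
by rewrite trmx_mul -!mulmxA ST TS.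
Qed.

Lemma reduced_lyapunov_decrease (Z : 'M[R]_r) : possemidef Z -> Cr *m Z = 0 ->
  \tr (E^T *m diag_inv sigma *m E *m lyapunov_op K Ar Nr Z) <= 0.
Proof.
move=> pZ CZ; have [k [Rm KE]] := psd_factor pK.
have [Gm [pGm E2]] := balanced_riccati_ineq KE.
have := balanced_corner_le0 sigma_gt0 pGm E2 (lifted_confined pZ CZ).
rewrite (reduced_lyapE _ KE) -(leading_inj_proj (ltnW hrn)).
set L := lyap _ _ _ => h.
rewrite (_ : \tr _ = \tr (diag_inv sigma *m (E *m E^T *m L *m (E *m E^T))))//.
by rewrite -!mulmxA mxtrace_mulC -!mulmxA.
Qed.

(** The certificate is found in balanced coordinates and pulled back by congruence with [Sb], the
    coordinates in which the control acts being the original ones. *)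
Lemma reduced_certificate (Z : 'M[R]_r) : possemidef Z -> Z != 0 ->
  Cr *m Z = 0 -> lyapunov_op K Ar Nr Z = 0 ->
  exists Y : 'M[R]_n, [/\ possemidef Y, Y != 0, Y *m B = 0 &
    possemidef (A^T *m Y + Y *m A + noise_term K N Y)].
Proof.
move=> pZ Z0 CZ LZ; have [k [Rm KE]] := psd_factor pK.
have [Gm [pGm E2]] := balanced_riccati_ineq KE.
have E1 := balanced_riccati KE.
have X0 : E *m Z *m E^T != 0.
  apply: contra Z0 => /eqP X0; apply/eqP.
  have -> : Z = E^T *m (E *m Z *m E^T) *m E.
    by rewrite !mulmxA leading_inj_trK mul1mx -mulmxA leading_inj_trK mulmx1.
  by rewrite X0 mulmx0 mul0mx.
have cX : critical (Sb *m A *m T) (fun l => Sb *m (\sum_i Rm l i *: N i) *m T)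
    (C *m T) J (E *m Z *m E^T).
  split; first exact: lifted_confined.
  have := reduced_lyapE Z KE; rewrite LZ; set L := lyap _ _ _ => LE.
  rewrite -(leading_inj_proj (ltnW hrn)).
  have -> : E *m E^T *m L *m (E *m E^T) = E *m (E^T *m L *m E) *m E^T.
    by rewrite !mulmxA.
  by rewrite -LE mulmx0 mul0mx.
have [Y [pY Y0 YB pLY]] := balanced_certificate sigma_gt0 hdisj pGm E1 E2 cX X0.
have TS : T *m Sb = 1%:M by rewrite mulVmx.
have ST : Sb *m T = 1%:M by rewrite mulmxV.
have YE : Y = T^T *m (Sb^T *m Y *m Sb) *m T.
  by rewrite !mulmxA -trmx_mul ST trmx1 mul1mx -mulmxA ST mulmx1.
exists (Sb^T *m Y *m Sb); split.
- by have := psd_congr Sb^T pY; rewrite trmxK.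
- by apply: contra Y0 => /eqP Y0; rewrite YE Y0 mulmx0 mul0mx.
- by rewrite -!mulmxA YB mulmx0.
rewrite (noise_termE _ KE) -/(dual_lyap A (fun l => \sum_i Rm l i *: N i) _).
move: pLY; rewrite {1}YE conj_dual_lyap => pLY.
have := psd_congr Sb^T pLY; rewrite trmxK.
by rewrite !mulmxA -trmx_mul TS trmx1 mul1mx -!mulmxA TS mulmx1 !mulmxA.
Qed.

End Original.

Section TraceBounds.
Context {R : realType} (n : nat).

(** Nonnegativity at [e_i + e_j] and [e_j - e_i] gives [2 |M_ij| <= M_ii + M_jj], and each diagonal
    entry is at most the trace. *)
Lemma psd_entry_le_trace (M : 'M[R]_n) i j : possemidef M -> `|M i j| <= \tr M.
Proof.
move=> pM; have [sM hM] := pM.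
have d0 k : 0 <= M k k by exact: psd_diag_ge0.
have le k : M k k <= \tr M.
  rewrite /mxtrace (bigD1 k)//= lerDl; apply: sumr_ge0 => l _; exact: d0.
have := hM (1 *: delta_mx i 0 + delta_mx j 0).
have := hM ((-1) *: delta_mx i 0 + delta_mx j 0).
rewrite !psd_qform2// trmx_delta -rowE -!colE.
rewrite ![(col _ _) _ _]mxE ![(row _ _) _ _]mxE.
have := le i; have := le j; rewrite ler_norml => *; apply/andP; split; lra.
Qed.

Lemma psd_trace_ge0 (M : 'M[R]_n) : possemidef M -> 0 <= \tr M.
Proof. by move=> pM; apply: sumr_ge0 => i _; exact: psd_diag_ge0. Qed.

Lemma trace_mul_le (Y M : 'M[R]_n) : possemidef M ->
  \tr (Y *m M) <= (\sum_i \sum_j `|Y i j|) * \tr M.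
Proof.
move=> pM; rewrite mulr_suml; apply: ler_sum => i _.
rewrite mxE mulr_suml; apply: ler_sum => j _.
apply: le_trans (ler_norm _) _; rewrite normrM ler_wpM2l//.
exact: psd_entry_le_trace.
Qed.

(** Taking the adjoint exchanges the two noise indices, which is where the symmetry of [K]
    enters. *)
Lemma trace_lyapunov_op q (K : 'M[R]_q) (A Y Z : 'M[R]_n) (N : 'I_q -> 'M[R]_n) :
  K^T = K ->
  \tr (Y *m lyapunov_op K A N Z) =
  \tr ((A^T *m Y + Y *m A + noise_term K N Y) *m Z).
Proof.
move=> sK; rewrite /lyapunov_op /noise_term !mulmxDr !mulmxDl !mxtraceD.
congr (_ + _).
  rewrite addrC; congr (_ + _); last by rewrite mulmxA.
  by rewrite mulmxA mxtrace_mulC mulmxA.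
rewrite mulmx_sumr mulmx_suml !linear_sum/=.
under eq_bigr do rewrite mulmx_sumr linear_sum/=.
under [RHS]eq_bigr do rewrite mulmx_suml linear_sum/=.
rewrite exchange_big/=.
apply: eq_bigr => i _; apply: eq_bigr => j _.
rewrite -scalemxAr -scalemxAl !linearZ/=.
rewrite -[in K j i]sK mxE; congr (_ * _).
by rewrite !mulmxA mxtrace_mulC !mulmxA.
Qed.

End TraceBounds.

Section MomentPsd.
Context (R : realType) (d : measure_display) (T : measurableType d).
Variables (Pr : probability T R) (n : nat) (x : R -> T -> 'cV[R]_n).
Hypothesis hs : forall t k, 0 <= t -> sqint Pr (fun w => x t w k 0).
Hypothesis ht : forall t k, 0 <= t -> sqint (@lebesgue_measure R \x Pr)%E
  (trunc t (fun s w => x s w k 0)).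

Lemma second_moment_psd t : 0 <= t -> possemidef (second_moment Pr x t).
Proof.
move=> t0; split; first exact: second_moment_sym.
by move=> v; rewrite -{2}(trmxK v) -ip_linE//; exact: ip_ge0.
Qed.

Lemma integrated_moment_psd t : 0 <= t -> possemidef (integrated_moment Pr x t).
Proof.
move=> t0; split; first exact: integrated_moment_sym.
by move=> v; rewrite -{2}(trmxK v) -ip_trunc_linE//; exact: ip_ge0.
Qed.

Lemma integrated_moment_incr_psd s t : 0 <= s -> s <= t ->
  possemidef (integrated_moment Pr x t - integrated_moment Pr x s).
Proof.
move=> s0 st; split.
  apply/matrixP => i j.
  by have := integrated_moment_sym Pr x t; have := integrated_moment_sym Pr x s;
    move=> /matrixP/(_ i j) es /matrixP/(_ i j) et; move: es et; rewrite !mxE => -> ->.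
move=> v; rewrite mulmxBr mulmxBl mxE [X in _ + X]mxE subr_ge0.
by rewrite -{2 4}(trmxK v); exact: integrated_moment_mono.
Qed.

End MomentPsd.

(** * Obstruction to stabilizability *)

Section Unstabilizable.
Context (R : realType) (d : measure_display) (T : measurableType d).
Variables (Pr : probability T R) (F : R -> set (set T)).
Hypothesis hF : usual_filtration Pr F.
Variables (q : nat) (K : 'M[R]_q) (W : R -> T -> 'cV[R]_q).
Hypothesis hW : wiener_process Pr F K W.
Variables (n m : nat) (A : 'M[R]_n) (N : 'I_q -> 'M[R]_n) (B : 'M[R]_(n, m)).

(* The mean square of [G x], with [Y = G^T G], never decreases along any
   controlled trajectory. *)
Lemma dual_certificate_unstabilizable (Y : 'M[R]_n) : possemidef Y -> Y != 0 ->
  Y *m B = 0 -> possemidef (A^T *m Y + Y *m A + noise_term K N Y) ->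
  ~ stabilizable Pr F W A B N.
Proof.
move=> pY Y0 YB pL stab; have [k [G GE]] := psd_factor pY.
have GB : G *m B = 0.
  rewrite -[G *m B]trmxK [X in X^T](_ : _ = 0) ?trmx0//; apply: trace_sqr_eq0.
  by rewrite trmxK trmx_mul -mulmxA (mulmxA G^T) -GE YB mulmx0 mxtrace0.
have [j Gj|G0] := pickP (fun j => col j G != 0); last first.
  move/eqP: Y0; apply; rewrite GE (_ : G = 0) ?mulmx0//.
  apply/matrixP => i l; have /negbFE/eqP/matrixP/(_ i 0) := G0 l.
  by rewrite !mxE.
pose x0 : 'cV[R]_n := delta_mx j 0; pose c0 := \tr ((G *m x0) *m (G *m x0)^T).
have c0_gt0 : 0 < c0.
  rewrite lt_neqAle trace_sqr_ge0 andbT eq_sym; apply: contra Gj => /eqP c00.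
  by rewrite colE (trace_sqr_eq0 c00).
have [u [x [L2u sx L2x]]] := stab x0.
have hu t i : 0 <= t -> sqint (@lebesgue_measure R \x Pr)%E
    (trunc t (fun s w => u s w i 0)) by move=> _; exact: L2_trunc L2u.
have hs t i : 0 <= t -> sqint Pr (fun w => x t w i 0).
  exact: (solution_sqint hF hW hu sx).
have ht t i : 0 <= t -> sqint (@lebesgue_measure R \x Pr)%E
    (trunc t (fun s w => x s w i 0)) by exact: (solution_trunc_sqint sx).
have sK : K^T = K by apply/matrixP => a b; rewrite mxE (wiener_K_sym hW).
have growth t : 0 <= t -> c0 <= \tr (G *m second_moment Pr x t *m G^T).
  move=> t0; have pI := integrated_moment_psd ht t0.
  have -> : \tr (G *m second_moment Pr x t *m G^T) = c0 +
      \tr (Y *m lyapunov_op K A N (integrated_moment Pr x t)).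
    transitivity (\tr (G *m (x0 *m x0^T +
        lyapunov_op K A N (integrated_moment Pr x t)) *m G^T)).
      rewrite !trace_rows; apply: eq_bigr => i _.
      by rewrite (second_moment_equation hF hW hu sx)// -row_mul GB row0.
    rewrite mulmxDr mulmxDl mxtraceD; congr (_ + _).
      by rewrite /c0 trmx_mul !mulmxA.
    by rewrite GE mxtrace_mulC !mulmxA.
  rewrite trace_lyapunov_op// lerDl; exact: trace_psd_mul_ge0.
(* Global square integrability bounds the integrated moment uniformly in time, against the linear
   lower bound supplied by [growth]. *)
have [c hc] := L2_trunc_bounded L2x.
pose s := \sum_a \sum_b `|Y a b|.
have bound t : 0 <= t -> c0 * t <= s * (n%:R * c).
  move=> t0; apply: le_trans (trace_integrated_moment_ge hs ht t0 _) _.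
    by move=> a a0 _; exact: growth.
  have pI := integrated_moment_psd ht t0.
  have -> : \tr (G *m integrated_moment Pr x t *m G^T) =
      \tr (Y *m integrated_moment Pr x t) by rewrite GE mxtrace_mulC mulmxA.
  apply: le_trans (trace_mul_le _ pI) _; apply: ler_wpM2l.
    by apply: sumr_ge0 => a _; exact: sumr_ge0.
  rewrite mulr_natl -[n in c *+ n]card_ord -sumr_const.
  by apply: ler_sum => a _; rewrite mxE.
have M0 : 0 <= s * (n%:R * c) by have := bound 0 (lexx 0); rewrite mulr0.
(* At this time the lower bound [c0 * t1] exceeds the uniform upper bound by 1. *)
pose t1 := (s * (n%:R * c) + 1) / c0.
have t1_ge0 : 0 <= t1 by apply: divr_ge0; [exact: addr_ge0|exact: ltW].
have := bound t1 t1_ge0; rewrite mulrC divfK ?gt_eqF// gerDl.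
by rewrite ler10.
Qed.

End Unstabilizable.

(** * Decay of the reduced trajectories *)

Section EntrywiseLimits.
Context {R : realType} (I : Type) (U : set_system I).

(** Along an arbitrary filter, since the limit point of the time averages is reached through an
    ultrafilter rather than a subsequence. *)
Definition mx_cvg m n (V : I -> 'M[R]_(m, n)) (L : 'M[R]_(m, n)) :=
  forall i j, V k i j @[k --> U] --> L i j.

Context {FU : ProperFilter U}.

Lemma mx_cvg_unique m n (V : I -> 'M[R]_(m, n)) L L' :
  mx_cvg V L -> mx_cvg V L' -> L = L'.
Proof.
move=> VL VL'; apply/matrixP => i j.
exact: (cvg_unique (@norm_hausdorff R R) (VL i j) (VL' i j)).
Qed.

Lemma mx_cvgD m n (V V' : I -> 'M[R]_(m, n)) L L' :
  mx_cvg V L -> mx_cvg V' L' -> mx_cvg (fun k => V k + V' k) (L + L').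
Proof.
move=> VL VL' i j; rewrite mxE; under eq_fun do rewrite mxE.
exact: (cvgD (VL i j) (VL' i j)).
Qed.

Lemma mx_cvgZ m n a (V : I -> 'M[R]_(m, n)) L :
  mx_cvg V L -> mx_cvg (fun k => a *: V k) (a *: L).
Proof.
move=> VL i j; rewrite mxE; under eq_fun do rewrite mxE.
exact: (cvgM (cvg_cst a) (VL i j)).
Qed.

Lemma mx_cvg_sum m n (J : finType) (V : J -> I -> 'M[R]_(m, n)) L :
  (forall j, mx_cvg (V j) (L j)) ->
  mx_cvg (fun k => \sum_j V j k) (\sum_j L j).
Proof.
move=> VL i j; rewrite summxE; under eq_fun do rewrite summxE.
by apply: cvg_big => [|l _]; [exact: add_continuous|exact: VL].
Qed.

Lemma mx_cvg_mull p m n (A : 'M[R]_(p, m)) (V : I -> 'M[R]_(m, n)) L :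
  mx_cvg V L -> mx_cvg (fun k => A *m V k) (A *m L).
Proof.
move=> VL i j; rewrite mxE; under eq_fun do rewrite mxE.
apply: cvg_big => [|l _]; [exact: add_continuous|].
exact: (cvgM (cvg_cst _) (VL l j)).
Qed.

Lemma mx_cvg_mulr p m n (A : 'M[R]_(n, p)) (V : I -> 'M[R]_(m, n)) L :
  mx_cvg V L -> mx_cvg (fun k => V k *m A) (L *m A).
Proof.
move=> VL i j; rewrite mxE; under eq_fun do rewrite mxE.
apply: cvg_big => [|l _]; [exact: add_continuous|].
exact: (cvgM (VL i l) (cvg_cst _)).
Qed.

Lemma mxtrace_cvg n (V : I -> 'M[R]_n) L : mx_cvg V L ->
  \tr (V k) @[k --> U] --> \tr L.
Proof. by move=> VL; apply: cvg_big => [|l _]; [exact: add_continuous|exact: VL]. Qed.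

Lemma lyapunov_op_cvg n q (K : 'M[R]_q) A N (V : I -> 'M[R]_n) L :
  mx_cvg V L -> mx_cvg (fun k => lyapunov_op K A N (V k)) (lyapunov_op K A N L).
Proof.
move=> VL; apply: mx_cvgD.
  by apply: mx_cvgD; [exact: mx_cvg_mull|exact: mx_cvg_mulr].
apply: mx_cvg_sum => i; apply: mx_cvg_sum => j; apply: mx_cvgZ.
by apply: mx_cvg_mulr; exact: mx_cvg_mull.
Qed.

Lemma possemidef_cvg n (V : I -> 'M[R]_n) L : (forall k, possemidef (V k)) ->
  mx_cvg V L -> possemidef L.
Proof.
move=> pV VL; split.
  apply: (mx_cvg_unique _ VL) => i j; rewrite mxE.
  by under eq_fun => k do rewrite -(pV k).1 mxE; exact: VL.
move=> v.
have c : (v^T *m V k *m v) 0 0 @[k --> U] --> (v^T *m L *m v) 0 0.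
  by apply: mx_cvg_mulr; exact: mx_cvg_mull.
by apply: (cvgr_to_ge c); apply: filterE => k; exact: (pV k).2.
Qed.

End EntrywiseLimits.

(** A segment is compact, and an ultrafilter converges to each of its cluster points. *)
Lemma bounded_ultra_cvg (R : realType) (I : Type) (U : set_system I) (f : I -> R) (c : R) :
  UltraFilter U -> (forall k, `|f k| <= c) -> exists l : R, f k @[k --> U] --> l.
Proof.
move=> UU fc.
have [l [_ cl]] : [set` `[- c, c]] `&` cluster (f @ U) !=set0.
  apply: segment_compact; apply: (@filterE _ U) => k /=.
  by rewrite in_itv/=; have := fc k; rewrite ler_norml.
exists l => A Al.
have [//|nA] := in_ultra_setVsetC (f @^-1` A) UU.
by have [y [nAy Ay]] := cl (~` A) A nA Al.
Qed.

(** One ultrafilter finer than [\oo] serves all entries at once, with no successive extractions;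
    ordinary sequential limits remain valid along it. *)
Lemma bounded_psd_mx_cvg (R : realType) n (V : nat -> 'M[R]_n) c :
  (forall k, possemidef (V k)) -> (forall k, \tr (V k) <= c) ->
  exists (U : set_system nat) L, [/\ ProperFilter U, \oo `<=` U & mx_cvg U V L].
Proof.
move=> pV cV; have [U [UU ooU]] := ultraFilterLemma eventually_filter.
have h i j : exists l : R, V k i j @[k --> U] --> l.
  apply: (bounded_ultra_cvg (c := c)) => k.
  exact: le_trans (psd_entry_le_trace i j (pV k)) (cV k).
exists U, (\matrix_(i, j) projT1 (cid (h i j))); split=> // [|i j].
  exact: ultra_proper.
by rewrite mxE; exact: projT2 (cid (h i j)).
Qed.

(** With vanishing form the matrix is positive semidefinite and has zero diagonal, so [psd_diag0]
    applies. *)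
Lemma psd_qform0 (R : realType) n (M : 'M[R]_n) : M^T = M ->
  (forall g : 'rV[R]_n, (g *m M *m g^T) 0 0 = 0) -> M = 0.
Proof.
move=> sM M0; have pM : possemidef M.
  by split=> // v; rewrite -{2}(trmxK v) M0.
apply/matrixP => i j; rewrite mxE; apply: psd_diag0 => //.
by have := M0 (delta_mx 0 i); rewrite trmx_delta -rowE -colE !mxE.
Qed.

Section LyapunovOpTheory.
Context {R : realType} (n q : nat) (K : 'M[R]_q) (A : 'M[R]_n) (N : 'I_q -> 'M[R]_n).
Local Notation L := (lyapunov_op K A N).

Lemma lyapunov_opZ a Z : L (a *: Z) = a *: L Z.
Proof.
rewrite /lyapunov_op !scalerDr scalemxAr scalemxAl; congr (_ + _).
rewrite scaler_sumr; apply: eq_bigr => i _.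
rewrite scaler_sumr; apply: eq_bigr => j _.
by rewrite -scalemxAr -scalemxAl !scalerA mulrC.
Qed.

Lemma lyapunov_opD Y Z : L (Y + Z) = L Y + L Z.
Proof.
rewrite /lyapunov_op mulmxDr mulmxDl addrACA [RHS]addrACA; congr (_ + _).
rewrite -big_split; apply: eq_bigr => i _; rewrite -big_split; apply: eq_bigr => j _.
by rewrite mulmxDr mulmxDl scalerDr.
Qed.

Lemma lyapunov_opB Y Z : L (Y - Z) = L Y - L Z.
Proof. by rewrite lyapunov_opD -scaleN1r lyapunov_opZ scaleN1r. Qed.

Lemma lyapunov_op_sym Z : K^T = K -> Z^T = Z -> (L Z)^T = L Z.
Proof.
move=> sK sZ; rewrite /lyapunov_op !raddfD/= !trmx_mul trmxK sZ.
rewrite (addrC (Z *m _)); congr (_ + _).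
rewrite raddf_sum/= exchange_big; apply: eq_bigr => i _.
rewrite raddf_sum/=; apply: eq_bigr => j _.
by rewrite linearZ/= !trmx_mul trmxK sZ -[in LHS]sK mxE mulmxA.
Qed.

End LyapunovOpTheory.

Section Decay.
Context (R : realType) (d : measure_display) (T : measurableType d).
Variables (Pr : probability T R) (F : R -> set (set T)).
Hypothesis hF : usual_filtration Pr F.
Variables (q : nat) (K : 'M[R]_q) (W : R -> T -> 'cV[R]_q).
Hypothesis hW : wiener_process Pr F K W.
Variables (n p : nat) (A : 'M[R]_n) (N : 'I_q -> 'M[R]_n) (C : 'M[R]_(p, n)).
Variables (M : 'M[R]_n) (c : R).
Hypothesis pM : possemidef M.
Hypothesis trM : forall Z, possemidef Z -> \tr Z <= c * \tr (M *m Z).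
Hypothesis decM : forall Z, possemidef Z -> C *m Z = 0 ->
  \tr (M *m lyapunov_op K A N Z) <= 0.
Hypothesis critical0 : forall Z, possemidef Z -> C *m Z = 0 ->
  lyapunov_op K A N Z = 0 -> Z = 0.
Hypothesis c_ge0 : 0 <= c.

Variables (x0 : 'cV[R]_n) (x : R -> T -> 'cV[R]_n).
Hypothesis hx : free_solution Pr F W A N x0 x.
Hypothesis hC : zero_output Pr C x.

Local Notation X := (second_moment Pr x).
Local Notation Y := (integrated_moment Pr x).
Local Notation L := (lyapunov_op K A N).

(** A control with values in the zero-dimensional space presents the free equation as a controlled
    one, to which the moment results apply. *)
Let u0 (s : R) (w : T) : 'cV[R]_0 := 0.

Let hu0 (t : R) k : 0 <= t -> sqint (@lebesgue_measure R \x Pr)%E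
  (trunc t (fun s w => u0 s w k 0)).
Proof. by case: k. Qed.

Let hx' : sde_solution Pr F W A N
  (fun s w => (0 : 'M[R]_(n, 0)) *m u0 s w) x0 x.
Proof.
rewrite (_ : (fun s w => 0 *m u0 s w) = fun _ _ => 0); first exact: hx.
by apply/funext => s; apply/funext => w; rewrite mul0mx.
Qed.

Let hs (t : R) k : 0 <= t -> sqint Pr (fun w => x t w k 0).
Proof. exact: (solution_sqint (B := 0) (u := u0) hF hW hu0 hx'). Qed.

Let ht (t : R) k : 0 <= t -> sqint (@lebesgue_measure R \x Pr)%E
  (trunc t (fun s w => x s w k 0)).
Proof. exact: (solution_trunc_sqint hx'). Qed.

(** With a zero input matrix every row [g] is admissible in [second_moment_equation], and equal
    quadratic forms of symmetric matrices give equality. *)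
Lemma free_second_moment t : 0 <= t -> X t = x0 *m x0^T + L (Y t).
Proof.
move=> t0; have sK : K^T = K by apply/matrixP => a b; rewrite mxE (wiener_K_sym hW).
apply/eqP; rewrite -subr_eq0; apply/eqP; apply: psd_qform0.
  rewrite linearB/= linearD/= trmx_mul trmxK second_moment_sym.
  by rewrite lyapunov_op_sym// integrated_moment_sym.
move=> g; rewrite mulmxBr mulmxBl mxE [X in _ + X]mxE.
by rewrite (second_moment_equation (B := 0) hF hW hu0 hx') ?mulmx0 ?subrr.
Qed.

Let psi (t : R) := \tr (M *m X t).

Let psi_ge0 (t : R) : 0 <= t -> 0 <= psi t.
Proof. by move=> t0; apply: trace_psd_mul_ge0 => //; exact: second_moment_psd. Qed.

(** The increment of [X] is the operator [L] at the increment of [Y], which is positive semidefinite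
    and annihilated by [C]: [decM] applies with no derivative in time. *)
Let psi_nonincreasing (s t : R) : 0 <= s -> s <= t -> psi t <= psi s.
Proof.
move=> s0 st; have t0 := le_trans s0 st.
rewrite -subr_le0 /psi -linearB/= -mulmxBr !free_second_moment// opprD addrACA.
rewrite subrr add0r -lyapunov_opB; apply: decM.
  exact: integrated_moment_incr_psd.
by rewrite mulmxBr !zero_output_integrated_moment// subrr.
Qed.

Let psi_small (e : R) : 0 < e -> exists t, 0 <= t /\ psi t < e.
Proof.
move=> e0; apply: contrapT => /forallNP h.
have {}h t : 0 <= t -> e <= psi t.
  by move=> t0; rewrite leNgt; apply/negP => ht'; apply: (h t).
have [k [G GE]] := psd_factor pM.
have trGE Z : \tr (G *m Z *m G^T) = \tr (M *m Z).
  by rewrite GE mxtrace_mulC mulmxA.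
pose V (j : nat) := j.+1%:R^-1 *: Y j.+1%:R.
have j0 j : 0 <= j.+1%:R :> R by rewrite ler0n.
have jp j : 0 < j.+1%:R :> R by rewrite ltr0n.
have pV j : possemidef (V j).
  have [sY hY] := integrated_moment_psd ht (j0 j).
  split; first by rewrite linearZ/= sY.
  by move=> v; rewrite -scalemxAr -scalemxAl mxE mulr_ge0// invr_ge0.
have CV j : C *m V j = 0 by rewrite -scalemxAr zero_output_integrated_moment// scaler0.
(* The upper bound gives compactness of the averages, and the lower one keeps their limit away from
   0. *)
have MV j : e <= \tr (M *m V j) <= psi 0.
  rewrite -scalemxAr linearZ/= -trGE mulrC; apply/andP; split.
    rewrite ler_pdivlMr//; apply: trace_integrated_moment_ge => // s s0 _.
    by rewrite trGE; exact: h.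
  rewrite ler_pdivrMr//; apply: trace_integrated_moment_le => // s s0 _.
  by rewrite trGE; exact: psi_nonincreasing.
have trV j : \tr (V j) <= c * psi 0.
  by apply: le_trans (trM (pV j)) _; apply: ler_wpM2l => //; have /andP[] := MV j.
have [U [Z [UP ooU VZ]]] := bounded_psd_mx_cvg pV trV.
have pZ : possemidef Z by exact: (possemidef_cvg pV VZ).
have CZ : C *m Z = 0.
  apply: (mx_cvg_unique (mx_cvg_mull VZ)) => i j.
  by under eq_fun do rewrite CV; exact: cvg_cst.
have LZ : L Z = 0.
  have cL : mx_cvg U (fun j => L (V j)) (L Z) by exact: lyapunov_op_cvg.
  apply: (mx_cvg_unique cL) => i l; apply: (cvg_trans (cvg_app _ ooU)).
  (* [L (V j)] is the difference of [X] at time [j.+1] and [x0 *m x0^T], divided by [j.+1]; [b]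
     bounds the numerator entrywise, since [trM] controls the entries of [X] by [c * psi 0]. *)
  pose b := c * psi 0 + `|(x0 *m x0^T) i l|.
  have Vb j : `|L (V j) i l| <= b * harmonic j.
    rewrite lyapunov_opZ mxE normrM ger0_norm ?invr_ge0// mulrC ler_wpM2r ?invr_ge0//.
    have -> : L (Y j.+1%:R) = X j.+1%:R - x0 *m x0^T.
      by rewrite free_second_moment// addrAC subrr add0r.
    rewrite mxE [X in _ + X]mxE; apply: le_trans (ler_normB _ _) _; rewrite lerD2r.
    have pX := second_moment_psd hs (j0 j).
    apply: le_trans (psd_entry_le_trace i l pX) _; apply: le_trans (trM pX) _.
    by apply: ler_wpM2l => //; exact: psi_nonincreasing.
  have b0 a : a * harmonic j @[j --> \oo] --> (0 : R).
    by rewrite -[X in _ --> X](mulr0 a); apply: cvgM; [exact: cvg_cst|exact: cvg_harmonic].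
  rewrite mxE; apply: (squeeze_cvgr _ (b0 (- b)) (b0 b)).
  by apply: nearW => j; rewrite mulNr -ler_norml.
have : e <= \tr (M *m Z).
  apply: (cvgr_to_ge (mxtrace_cvg (mx_cvg_mull VZ))).
  by apply: filterE => j; have /andP[] := MV j.
by rewrite (critical0 pZ CZ LZ) mulmx0 mxtrace0 leNgt e0.
Qed.

Lemma expectation_sqnorm t : 0 <= t ->
  'E_Pr[fun w => sqnorm (x t w)]%E = (\tr (X t))%:E.
Proof.
move=> t0; have h k : Pr.-integrable setT (EFin \o (fun w => x t w k 0 * x t w k 0)).
  exact: (sqint_mul (hs k t0) (hs k t0)).
rewrite unlock /mxtrace -sumEFin.
transitivity (\sum_k \int[Pr]_w (x t w k 0 * x t w k 0)%:E)%E.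
  rewrite -integral_sum//; apply: eq_integral => w _.
  by rewrite sumEFin; congr EFin; apply: eq_bigr => k _; rewrite expr2.
apply: eq_bigr => k _; rewrite mxE /ip /Rintegral fineK//.
exact: integrable_fin_num (h k).
Qed.

Lemma free_solution_decay :
  (fun t : R => 'E_Pr[fun w => sqnorm (x t w)])%E @ +oo --> 0%E.
Proof.
suff h : \tr (X t) @[t --> +oo] --> (0 : R).
  have h' : (\tr (X t))%:E @[t --> +oo] --> (0%:E : \bar R).
    by apply: cvg_EFin => //; exact: nearW.
  apply: cvg_trans h'; apply: near_eq_cvg.
  near=> t; rewrite expectation_sqnorm//; near: t.
apply/cvgrPdist_lt => e e0.
(* Smallness at one time persists by monotonicity. Dividing by [c + 1] avoids a division by zero, as
   [c] is only nonnegative. *)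
have [t1 [t10 ht1]] : exists t, 0 <= t /\ psi t < e / (c + 1).
  by apply: psi_small; rewrite divr_gt0// ltr_wpDl.
near=> t; have tt : t1 <= t by near: t; apply: nbhs_pinfty_ge; rewrite num_real.
have t0 := le_trans t10 tt; have pX := second_moment_psd hs t0.
rewrite sub0r normrN ger0_norm ?psd_trace_ge0//.
apply: le_lt_trans (trM pX) _.
apply: (@le_lt_trans _ _ (c * psi t1)).
  by apply: ler_wpM2l => //; exact: psi_nonincreasing.
move: ht1; rewrite ltr_pdivlMr ?ltr_wpDl// mulrC; apply: le_lt_trans.
by rewrite mulrDl lerDl mul1r psi_ge0.
Unshelve. all: by end_near.
Qed.

End Decay.

Lemma reduced_weight_diag (R : realType) n r (h : (r <= n)%N) (sigma : 'rV[R]_n) :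
  (leading_inj h)^T *m diag_inv sigma *m leading_inj h =
  diag_mx (\row_i (sigma 0 (widen_ord h i))^-1).
Proof.
rewrite -upper_leftE; apply/matrixP => i j; rewrite !mxE.
by congr (_ *+ (_ : bool)).
Qed.

(** Each diagonal entry is [s_i] times a weighted entry, and the latter is at most the whole
    weighted trace. *)
Lemma trace_le_weighted (R : realType) n (s : 'rV[R]_n) (Z : 'M[R]_n) :
  (forall i, 0 < s 0 i) -> possemidef Z ->
  \tr Z <= (\sum_i s 0 i) * \tr (diag_mx (\row_i (s 0 i)^-1) *m Z).
Proof.
move=> s0 pZ; rewrite mulr_suml; apply: ler_sum => i _.
have t0 j : 0 <= (diag_mx (\row_i (s 0 i)^-1) *m Z) j j.
  by rewrite mul_diag_mx !mxE mulr_ge0 ?psd_diag_ge0// invr_ge0 ltW.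
apply: (@le_trans _ _ (s 0 i * (diag_mx (\row_i (s 0 i)^-1) *m Z) i i)).
  by rewrite mul_diag_mx !mxE mulrA mulfV ?mul1r// gt_eqF.
rewrite ler_pM2l// /mxtrace (bigD1 i)//= lerDl.
by apply: sumr_ge0 => j _; exact: t0.
Qed.

Theorem proposition4p3 (R : realType) (d : measure_display)
    (T : measurableType d) (Pr : probability T R) (F : R -> set (set T))
    (hF : usual_filtration Pr F)
    (q : nat) (K : 'M[R]_q) (W : R -> T -> 'cV[R]_q)
    (hW : wiener_process Pr F K W)
    (n m p r : nat) (A : 'M[R]_n) (N : 'I_q -> 'M[R]_n)
    (B : 'M[R]_(n, m)) (C : 'M[R]_(p, n))
    (hstab : stabilizable Pr F W A B N)
    (hobs : observable Pr F W A C N)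
    (P Q : 'M[R]_n)
    (hP : posdef P)
    (hPineq : possemidef
       (- (A^T *m invmx P + invmx P *m A + noise_term K N (invmx P)
           - C^T *m C + invmx P *m B *m B^T *m invmx P)))
    (hQ : posdef Q)
    (hQeq : A^T *m Q + Q *m A + noise_term K N Q
            + C^T *m C - Q *m B *m B^T *m Q = 0)
    (hQstab : ms_stable Pr F W (A - B *m B^T *m Q) N)
    (hr1 : (1 <= r)%N) (hrn : (r < n)%N)
    (sigma : 'rV[R]_n)
    (hsigma_pos : forall i, 0 < sigma 0 i)
    (hsigma_noninc : forall i j : 'I_n, (i <= j)%N -> sigma 0 j <= sigma 0 i)
    (hsigma_eig : char_poly (P *m Q) = \prod_i ('X - (sigma 0 i ^+ 2)%:P))
    (Sb : 'M[R]_n) (hSb : Sb \in unitmx)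
    (hSbP : Sb *m P *m Sb^T = diag_mx sigma)
    (hSbQ : (invmx Sb)^T *m Q *m invmx Sb = diag_mx sigma)
    (hdisj : forall i j : 'I_n, (i < r)%N -> (r <= j)%N ->
               sigma 0 i != sigma 0 j) :
  detectable Pr F W
    (balanced_rom_A (ltnW hrn) Sb A)
    (balanced_rom_C (ltnW hrn) Sb C)
    (fun i => balanced_rom_A (ltnW hrn) Sb (N i)).
Proof.
pose s := \row_i sigma 0 (widen_ord (ltnW hrn) i).
have s0 i : 0 < s 0 i by rewrite mxE.
pose M := (leading_inj (ltnW hrn))^T *m diag_inv sigma *m leading_inj (ltnW hrn).
have ME : M = diag_mx (\row_i (s 0 i)^-1).
  by rewrite /M reduced_weight_diag; congr diag_mx; apply/rowP => i; rewrite !mxE.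
have pM : possemidef M.
  by rewrite ME; apply: psd_diag => i; rewrite mxE invr_ge0 ltW.
have pK := wiener_K_psd hF hW.
move=> x0 x hx hC; apply: (free_solution_decay (M := M) hF hW pM _ _ _ _ hx hC).
(* This fixes the constant [c] as the sum of the leading singular values. *)
- by move=> Z pZ; rewrite ME; apply: trace_le_weighted pZ.
- move=> Z pZ CZ.
  exact: (reduced_lyapunov_decrease pK hPineq hsigma_pos hSb hSbP).
- move=> Z pZ CZ LZ; apply/eqP; apply: contraT => Z0; exfalso.
  have [Y [pY Y0 YB pL]] := reduced_certificate pK hPineq hQeq hsigma_pos hSb
    hSbP hSbQ hdisj pZ Z0 CZ LZ.
  exact: (dual_certificate_unstabilizable hF hW pY Y0 YB pL hstab).
by apply: sumr_ge0 => i _; exact: ltW.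
Qed.
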